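(* Let $0<q<1$, $n\ge1$, let $\beta=(\beta_1,\dots,\beta_n)\in\{+1,-1\}^n$, and put $b_i=0$ if $\beta_i=+1$, $b_i=1$ if $\beta_i=-1$, $B_j=\sum_{i<j}b_i$, $B^j=\sum_{i>j}b_i$. Let $\sigma\in S_n$ and let $\gamma\in\mathbb R^n_{>0}$ be given by $\gamma_{\sigma(k)}=q^{\,B^{\sigma(k)}+k-1+\#\{j<k\,:\,\sigma(j)>\sigma(k)\}}$, and let $\tilde\gamma_k=\gamma_k\,q^{B^k}$ for all $k$. For $\delta\in(\mathbb R\setminus\{0\})^n$ set $$\kappa_\beta(\delta)=I''_{(\sigma,\tilde\gamma)}\Big(E_{q^4}\big(-q^4\textstyle\sum_jx_j^2\big)\Big)\cdot\prod_{j=1}^n\int_{-q^{\,n-j+B_j}\delta_j\cdot\infty}^{q^{\,n-j+B_j}\delta_j\cdot\infty}e_{q^4}(-t^2)\,d_{q^2}t .$$ Then: (1) for every $f=E_{q^4}(-q^4x_n^2)\,p_n(x_n)\cdots E_{q^4}(-q^4x_1^2)\,p_1(x_1)\in\mathcal A$, where each $p_j$ is a complex polynomial in one variable with $p_j(-t)=\beta_jp_j(t)$, and every $\delta\in(\mathbb R\setminus\{0\})^n$, one has $G_S^{\delta}\big(F''(\sigma,\gamma)(f)\big)=\kappa_\beta(\delta)\,f$; (2) for every $g=r_n(\partial_n)\,e_{q^4}(-\partial_n^2)\cdots r_1(\partial_1)\,e_{q^4}(-\partial_1^2)\in\mathcal D$, where each $r_j$ is a complex polynomial in one variable with $r_j(-t)=\beta_jr_j(t)$,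 and every $\delta\in(\mathbb R\setminus\{0\})^n$, one has $F''(\sigma,\gamma)\big(G_S^{\delta}(g)\big)=\kappa_\beta(\delta)\,g$.
   Context: Algebras. $\mathcal A$ is the complex algebra of formal power series in $x_1,\dots,x_n$ with relations $x_ix_j=q\,x_jx_i$ for $i>j$; every element is uniquely $\sum_{e}c_e\,x_1^{e_1}\cdots x_n^{e_n}$. $\mathcal D$ is the complex algebra of formal power series in $\partial_1,\dots,\partial_n$ with relations $\partial_i\partial_j=q\,\partial_j\partial_i$ for $i<j$; every element is uniquely $\sum_e c_e\,\partial_n^{e_n}\cdots\partial_1^{e_1}$. For $f=\sum_e c_e x_1^{e_1}\cdots x_n^{e_n}\in\mathcal A$ put $f_{\cdot1}(z)=\sum_e c_ez_1^{e_1}\cdots z_n^{e_n}$, and for $g=\sum_ec_e\partial_n^{e_n}\cdots\partial_1^{e_1}\in\mathcal D$ put ${}_{1\cdot}g(z)=\sum_ec_ez_1^{e_1}\cdots z_n^{e_n}$ (commuting variables). $q$-notation. $(a;p)_k=\prod_{l=0}^{k-1}(1-ap^l)$; $e_p(z)=\sum_{k\ge0}z^k/(p;p)_k$ (analytically continued as $1/(z;p)_\infty$ when evaluated numerically); $E_p(z)=\sum_{k\ge0}p^{k(k-1)/2}z^k/(p;p)_k$. Jackson integral: $\int_{-c\cdot\infty}^{c\cdot\infty}\varphi(t)\,d_{q^2}t=(1-q^2)\sum_{k\in\mathbb Z}\sum_{\varepsilon=\pm1}q^{2k}c\,\varphi(\varepsilon q^{2k}c)$; multiple Jackson integrals are iterated.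 Lattice order integral. Let $\sigma\in S_n$, $\gamma\in\mathbb R_{>0}^n$. For a power series $\varphi$ in commuting variables $z_i$, $i\in S\subseteq\{1,\dots,n\}$, and $l\in S$, let $\varphi^{ev}$ be the part of $\varphi$ with all exponents even, and define the function $\int_l\varphi$ of the variables $z_i$, $i\in S\setminus\{l\}$, by $$\Big(\int_l\varphi\Big)(z)=(1-q^2)\sum_{h\in\mathbb Z}\ \sum_{\varepsilon=\pm1}q^{2h}\gamma_l\ \varphi^{ev}(w),\qquad w_i=q^{-1}z_i\ (i<l),\quad w_l=\varepsilon q^{2h}\gamma_l,\quad w_i=z_i\ (i>l)$$ (with $\varphi^{ev}$ analytically extended where needed). An element $f\in\mathcal A$ with $f_{\cdot1}$ absolutely convergent near $0$ is lattice order integrable for $(\sigma,\gamma)$ if, setting $\varphi_0=f_{\cdot1}$ and $\varphi_k=\int_{\sigma(k)}\varphi_{k-1}$, each $\varphi_k$ ($k=1,\dots,n$) is given by an absolutely convergent series and is an entire function of the remaining variables; then $I''_{(\sigma,\gamma)}f:=\varphi_n\in\mathbb C$. Weak transform. If $f\,x_1^{e_1}\cdots x_n^{e_n}$ is lattice order integrable for $(\sigma,\gamma)$ for all $e\in\mathbb Z_{\ge0}^n$, then, with $|E|=\sum_je_j$, $$F''(\sigma,\gamma)(f)=\sum_{e}I''_{(\sigma,\gamma)}\big(f\,x_1^{e_1}\cdots x_n^{e_n}\big)\ \frac{i^{|E|}\,q^{-\sum_j(j-1)e_j}}{\prod_j(q^2;q^2)_{e_j}}\ \partial_n^{e_n}\cdots\partial_1^{e_1}\in\mathcal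 D .$$ Integral on $\mathcal D$ and transform $G_S$. For $g\in\mathcal D$ let $P_0g$ be its part with all exponents even. When ${}_{1\cdot}(P_0g)$ continues analytically to a neighbourhood of $\mathbb R^n$ in $\mathbb C^n$ of the form $\mathbb R^n+iU$ and is absolutely $q^2$-Jackson integrable over all lattices with non-zero coordinates, put $$J'_\delta(g)=\int_{-q^{n-1}\delta_1\cdot\infty}^{q^{n-1}\delta_1\cdot\infty}\cdots\int_{-q^{n-j}\delta_j\cdot\infty}^{q^{n-j}\delta_j\cdot\infty}\cdots\int_{-\delta_n\cdot\infty}^{\delta_n\cdot\infty}{}_{1\cdot}(P_0g)(t)\,d_{q^2}t_n\cdots d_{q^2}t_1 .$$ If this applies to $\partial_n^{e_n}\cdots\partial_1^{e_1}g$ for all $e\in\mathbb Z^n_{\ge0}$, then $$G_S^\delta(g)=\sum_e\frac{(-i)^{|E|}q^{|E|^2+|E|+\sum_j(n-j)e_j}}{\prod_j(q^2;q^2)_{e_j}}\ J'_\delta\big(\partial_n^{e_n}\cdots\partial_1^{e_1}\,g\big)\ x_1^{e_1}\cdots x_n^{e_n}\in\mathcal A .$$ (In the source $G_S$ takes values in a tensor product whose second component is a formal integral expression; $G_S^\delta$ is its value at $\delta$, and equality of such expressions means equality of values for all $\delta$.) *)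

(* Defs.v *)
From HB Require Import structures.
From mathcomp Require Import all_boot all_order all_algebra all_fingroup.
From mathcomp Require Import complex.
From mathcomp Require Import all_classical all_reals all_analysis.

Set Implicit Arguments.
Unset Strict Implicit.
Unset Printing Implicit Defensive.

Import Order.TTheory GRing.Theory Num.Theory.
Import numFieldNormedType.Exports.

Local Open Scope classical_set_scope.
Local Open Scope complex_scope.
Local Open Scope ring_scope.

(** Indices run over ['I_n], i.e. they are shifted by one with respect to the
    usual 1, ..., n: an index j there is [j.+1] here. *)

(** * q-commuting formal power series *)

Definition expv (n : nat) := {ffun 'I_n -> nat}.

(** [qpser q r] is the algebra of complex formal power series in generators
    X_i (i : 'I_n) with X_i X_j = q X_j X_i whenever [r i j]; an element is the
    family of its coefficients on the normally ordered monomials, in which X_j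
    stands to the left of X_i whenever [r i j] (see [qgenC], [xmonE] and [dmonE]
    below). *)
Definition qpser (R : realType) (q : R) (n : nat) (r : rel 'I_n) : Type :=
  expv n -> R[i].

HB.instance Definition _ (R : realType) (q : R) (n : nat) (r : rel 'I_n) :=
  GRing.Lmodule.copy (qpser q r) (expv n -> R[i]).

(** Number of transpositions X_i X_j -> X_j X_i with [r i j] needed to order
    the product of two normally ordered monomials. *)
Definition twist (n : nat) (r : rel 'I_n) (a b : expv n) : nat :=
  (\sum_(i < n) \sum_(j < n | r i j) a i * b j)%N.

Definition below (n : nat) (e : expv n) : seq (expv n) :=
  [seq [ffun i => a i : nat] | a : {dffun forall i : 'I_n, 'I_(e i).+1}].

Definition expv_sub (n : nat) (e a : expv n) : expv n :=
  [ffun i => (e i - a i)%N].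

Definition qmul (R : realType) (q : R) (n : nat) (r : rel 'I_n)
    (f g : qpser q r) : qpser q r :=
  fun e => \sum_(a <- below e)
    (q ^+ twist r a (expv_sub e a))%:C * (f a * g (expv_sub e a)).

Definition qmon (R : realType) (q : R) (n : nat) (r : rel 'I_n)
    (e : expv n) : qpser q r := fun e' => (e' == e)%:R.

Section qpser_ring.
Variables (R : realType) (q : R) (n : nat) (r : rel 'I_n).
Implicit Types (f g h : qpser q r) (a b e : expv n).

Lemma mem_below a e : (a \in below e) = [forall i, (a i <= e i)%N].
Proof.
apply/mapP/forallP => [[x _ ->] i|le_ae]; first by rewrite ffunE -ltnS.
exists [ffun i => inord (a i) : 'I_(e i).+1]; first by rewrite mem_enum.
by apply/ffunP => i; rewrite !ffunE inordK // ltnS.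
Qed.

Lemma below_uniq e : uniq (below e).
Proof.
rewrite map_inj_uniq ?enum_uniq // => x y /ffunP xy.
by apply/ffunP => i; apply: val_inj; have := xy i; rewrite !ffunE.
Qed.

Lemma expv_subK a e : a \in below e -> a + expv_sub e a = e.
Proof.
rewrite mem_below => /forallP le_ae; apply/ffunP => i.
by rewrite !ffunE; exact: subnKC.
Qed.

Lemma below_add a b : a \in below (a + b).
Proof. by rewrite mem_below; apply/forallP => i; rewrite ffunE leq_addr. Qed.

Lemma expv_addK a b : expv_sub (a + b) a = b.
Proof. by apply/ffunP => i; rewrite !ffunE; exact: addKn. Qed.

Lemma twistDl a b e : twist r (a + b) e = (twist r a e + twist r b e)%N.
Proof.
rewrite /twist -big_split; apply: eq_bigr => i _ /=.
rewrite -big_split; apply: eq_bigr => j _ /=.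
by rewrite ffunE; exact: mulnDl.
Qed.

Lemma twistDr a b e : twist r e (a + b) = (twist r e a + twist r e b)%N.
Proof.
rewrite /twist -big_split; apply: eq_bigr => i _ /=.
rewrite -big_split; apply: eq_bigr => j _ /=.
by rewrite ffunE; exact: mulnDr.
Qed.

Lemma big_below (F : expv n -> expv n -> expv n -> R[i]) e :
  \sum_(a <- below e) \sum_(b <- below a) F b (expv_sub a b) (expv_sub e a) =
  \sum_(b <- below e) \sum_(c <- below (expv_sub e b))
    F b c (expv_sub (expv_sub e b) c).
Proof.
pose s := [seq (a, b) | a <- below e, b <- below a].
pose t := [seq (b, c) | b <- below e, c <- below (expv_sub e b)].
transitivity
    (\sum_(x <- s) F x.2 (expv_sub x.1 x.2) (expv_sub e x.1)).
  by rewrite big_allpairs_dep.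
transitivity
    (\sum_(x <- t) F x.1 x.2 (expv_sub (expv_sub e x.1) x.2)); last first.
  by rewrite big_allpairs_dep.
pose phi (x : expv n * expv n) := (x.1 + x.2, x.1).
have inj_phi : injective phi.
  move=> [x1 x2] [y1 y2] [] /= eq12 eq1; rewrite eq1 in eq12 *.
  by rewrite -(expv_addK y1 x2) eq12 expv_addK.
have st : perm_eq s [seq phi x | x <- t].
  apply: uniq_perm.
  - by apply: allpairs_uniq_dep => [|x _|[x1 x2] [y1 y2] _ _ [-> ->]] //;
       exact: below_uniq.
  - rewrite map_inj_uniq //.
    by apply: allpairs_uniq_dep => [|x _|[x1 x2] [y1 y2] _ _ [-> ->]] //;
       exact: below_uniq.
  move=> [x y]; apply/allpairsPdep/mapP => [[a [b [ae ba [-> ->]]]]|].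
    exists (b, expv_sub a b); last by rewrite /phi /= expv_subK.
    apply/allpairsPdep; exists b, (expv_sub a b); split=> //.
      move: ae ba; rewrite !mem_below => /forallP ae /forallP ba.
      by apply/forallP => i; exact: leq_trans (ba i) (ae i).
    rewrite mem_below; apply/forallP => i; rewrite !ffunE leq_sub2r //.
    by move: ae; rewrite mem_below => /forallP.
  case=> -[b c] /allpairsPdep [b' [c' [be ce [-> ->]]]] [-> ->] /=.
  exists (b' + c'), b'; split=> //; last exact: below_add.
  move: be ce; rewrite !mem_below => /forallP be /forallP ce.
  apply/forallP => i; have := ce i; rewrite !ffunE => cei.
  by rewrite -(subnKC (be i)) leq_add2l.
rewrite (perm_big _ st) big_map; apply: eq_bigr => -[b c] _ /=.
rewrite expv_addK; congr F; apply/ffunP => i; rewrite !ffunE.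
exact: subnDA.
Qed.

Lemma qmulA : associative (@qmul R q n r).
Proof.
move=> f g h; apply/funext => e; rewrite /qmul.
pose F a b c := (q ^+ (twist r a b + twist r a c + twist r b c))%:C *
  (f a * g b * h c).
transitivity (\sum_(b <- below e) \sum_(c <- below (expv_sub e b))
    F b c (expv_sub (expv_sub e b) c)).
  apply: eq_big_seq => a ae; rewrite !mulr_sumr; apply: eq_big_seq => b ba.
  rewrite /F -twistDr expv_subK // exprD rmorphM /=.
  by rewrite !mulrA; congr (_ * _ * _); rewrite -!mulrA; congr (_ * _);
     rewrite mulrC.
rewrite -(big_below F); apply: eq_big_seq => a ae.
rewrite mulr_suml mulr_sumr; apply: eq_big_seq => b ba.
rewrite /F -addnA -twistDl expv_subK // addnC exprD rmorphM /=.
by rewrite !mulrA.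
Qed.

Lemma twist0l a : twist r 0 a = 0%N.
Proof. by rewrite /twist big1 // => i _; rewrite big1 // => j _; rewrite ffunE. Qed.

Lemma twist0r a : twist r a 0 = 0%N.
Proof.
rewrite /twist big1 // => i _; rewrite big1 // => j _.
by rewrite ffunE; exact: muln0.
Qed.

Lemma qmonMl f a e :
  qmul (qmon q r a) f e =
  if a \in below e then
    (q ^+ twist r a (expv_sub e a))%:C * f (expv_sub e a) else 0.
Proof.
rewrite /qmul /qmon; case: ifPn => ae.
  rewrite (bigD1_seq a) ?below_uniq //= eqxx mul1r big1 ?addr0 //.
  by move=> b /negPf ->; rewrite mul0r mulr0.
rewrite big_seq big1 // => b be; case: eqVneq => [ba|_].
  by rewrite ba (negPf ae) in be.
by rewrite mul0r mulr0.
Qed.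

Lemma qmonMr f b a :
  qmul f (qmon q r b) (a + b) = (q ^+ twist r a b)%:C * f a.
Proof.
rewrite /qmul /qmon (bigD1_seq a) ?below_uniq ?below_add //=.
rewrite expv_addK eqxx mulr1 big_seq_cond big1 ?addr0 // => c /andP[ce ca].
case: eqVneq => [cb|_]; last by rewrite !mulr0.
case/eqP: ca; apply/ffunP => i.
have /ffunP/(_ i) := expv_subK ce; rewrite cb !ffunE.
exact: addIn.
Qed.

Lemma qmul1l : left_id (qmon q r 0) (@qmul R q n r).
Proof.
move=> f; apply/funext => e; rewrite qmonMl.
have -> : (0 : expv n) \in below e.
  by rewrite mem_below; apply/forallP => i; rewrite ffunE.
rewrite twist0l expr0 mul1r; congr f.
by apply/ffunP => i; rewrite !ffunE; exact: subn0.
Qed.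

Lemma qmul1r : right_id (qmon q r 0) (@qmul R q n r).
Proof.
move=> f; apply/funext => e; rewrite -[in LHS](addr0 e) qmonMr.
by rewrite twist0r expr0 mul1r.
Qed.

Lemma qmulDl : left_distributive (@qmul R q n r) +%R.
Proof.
move=> f g h; apply/funext => e; rewrite /qmul [in RHS]/GRing.add /=.
rewrite -big_split; apply: eq_bigr => a _ /=.
by rewrite -mulrDr -mulrDl.
Qed.

Lemma qmulDr : right_distributive (@qmul R q n r) +%R.
Proof.
move=> f g h; apply/funext => e; rewrite /qmul [in RHS]/GRing.add /=.
rewrite -big_split; apply: eq_bigr => a _ /=.
by rewrite -mulrDr -mulrDr.
Qed.

End qpser_ring.

HB.instance Definition _ (R : realType) (q : R) (n : nat) (r : rel 'I_n) :=
  GRing.Zmodule_isPzRing.Build (qpser q r) (@qmulA R q n r) (@qmul1l R q n r)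
    (@qmul1r R q n r) (@qmulDl R q n r) (@qmulDr R q n r).

(** The algebra A (generators x_i, normal order x_1 ... x_n) and the algebra D
    (generators d_i, normal order d_n ... d_1). *)
Notation qA q n := (@qpser _ q n (fun i j : 'I_n => (j < i)%N)).
Notation qD q n := (@qpser _ q n (fun i j : 'I_n => (i < j)%N)).

Definition expv1 (n : nat) (i : 'I_n) : expv n := [ffun j => (j == i) : nat].

Definition qgen (R : realType) (q : R) (n : nat) (r : rel 'I_n) (i : 'I_n) :
  qpser q r := qmon q r (expv1 i).

Section qpser_gen.
Variables (R : realType) (q : R) (n : nat).

Lemma qmonM (r : rel 'I_n) (a b : expv n) :
  qmon q r a * qmon q r b = (q ^+ twist r a b)%:C *: qmon q r (a + b).
Proof.
apply/funext => e; rewrite [LHS]qmonMl.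
rewrite -[RHS]/((q ^+ twist r a b)%:C * qmon q r (a + b) e) /qmon.
case: ifPn => ae.
  case: (eqVneq e (a + b)) => [->|neq]; first by rewrite expv_addK eqxx.
  case: (eqVneq (expv_sub e a) b) => [eb|_]; last by rewrite !mulr0.
  by rewrite -eb expv_subK // eqxx in neq.
case: (eqVneq e (a + b)) => [eab|_]; last by rewrite mulr0.
by rewrite eab below_add in ae.
Qed.

Lemma qgenC (r : rel 'I_n) (i j : 'I_n) : r i j -> ~~ r j i ->
  qgen q r i * qgen q r j = q%:C *: (qgen q r j * qgen q r i).
Proof.
have tw k l : twist r (expv1 k) (expv1 l) = r k l.
  rewrite /twist (bigD1 k) //= [X in (_ + X)%N]big1 => [|x /negPf xk]; last first.
    by rewrite big1 // => y _; rewrite ffunE xk.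
  rewrite addn0 big_mkcond (bigD1 l) //= big1 => [|x /negPf xl]; last first.
    by rewrite !ffunE xl muln0 if_same.
  by rewrite !ffunE !eqxx addn0; case: r.
move=> rij /negPf rji; rewrite !qmonM !tw rij rji expr1 expr0 scale1r.
by rewrite addrC.
Qed.

Lemma qmon_prod (r : rel 'I_n) (s : seq 'I_n) (e : expv n) :
    irreflexive r -> uniq s -> pairwise (fun i j => ~~ r i j) s ->
  \prod_(i <- s) qgen q r i ^+ e i =
  qmon q r [ffun i => if i \in s then e i else 0%N].
Proof.
move=> rr; have gX i k :
    qgen q r i ^+ k = qmon q r [ffun j => if j == i then k else 0%N].
  elim: k => [|k IH].
    by rewrite expr0; congr qmon; apply/ffunP => j; rewrite !ffunE if_same.
  rewrite exprS IH qmonM (_ : twist _ _ _ = 0%N) ?expr0 ?scale1r.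
    congr qmon; apply/ffunP => j; rewrite !ffunE.
    by case: eqP.
  rewrite /twist big1 // => x _; rewrite big1 // => y rxy; rewrite !ffunE.
  by case: eqP rxy => [->|_]; case: eqP => [->|_]; rewrite ?rr ?muln0.
elim: s => [_ _|i s IH /= /andP[is_ us] /andP[ris prs]].
  by rewrite big_nil; congr qmon; apply/ffunP => j; rewrite !ffunE.
rewrite big_cons IH // gX qmonM (_ : twist _ _ _ = 0%N) ?expr0 ?scale1r.
  congr qmon; apply/ffunP => j; rewrite !ffunE inE.
  by case: eqP => [->|_] /=; rewrite ?(negPf is_); [exact: addn0|exact: add0n].
rewrite /twist big1 // => x _; rewrite big1 // => y rxy; rewrite !ffunE.
case: eqP rxy => [->|_] // riy; case: ifPn => [ys|_]; last by rewrite muln0.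
by move/allP: ris => /(_ y ys); rewrite riy.
Qed.

Let pairwise_enum : pairwise (fun i j : 'I_n => (i <= j)%N) (enum 'I_n).
Proof.
rewrite -(pairwise_map (@nat_of_ord n) leq) val_enum_ord.
by rewrite -(sorted_pairwise leq_trans) iota_sorted.
Qed.

(** [qmon] is the normally ordered monomial x_1^e_1 ... x_n^e_n of A ... *)
Lemma xmonE (e : expv n) :
  (qmon q _ e : qA q n) = \prod_(i <- enum 'I_n) qgen q _ i ^+ e i.
Proof.
rewrite qmon_prod ?enum_uniq //.
- by congr qmon; apply/ffunP => i; rewrite ffunE mem_enum.
- by move=> i; rewrite ltnn.
by apply: sub_pairwise pairwise_enum => i j ij; rewrite -leqNgt.
Qed.

(** ... and d_n^e_n ... d_1^e_1 of D. *)
Lemma dmonE (e : expv n) :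
  (qmon q _ e : qD q n) = \prod_(i <- rev (enum 'I_n)) qgen q _ i ^+ e i.
Proof.
rewrite qmon_prod ?rev_uniq ?enum_uniq //.
  by congr qmon; apply/ffunP => i; rewrite ffunE mem_rev mem_enum.
apply: (@sub_pairwise _ (fun i j : 'I_n => (j <= i)%N)) => [i j|].
  by rewrite -leqNgt.
have ge_trans : transitive (fun i j : 'I_n => (j <= i)%N).
  by move=> j i k ji kj; exact: leq_trans kj ji.
have le_trans : transitive (fun i j : 'I_n => (i <= j)%N).
  by move=> j i k; exact: leq_trans.
by rewrite -(sorted_pairwise ge_trans) rev_sorted (sorted_pairwise le_trans).
Qed.

End qpser_gen.

(** [qcomp h u] is h(u) = \sum_k h_k u^k, for a one-variable formal power series
    h and u without constant term: then u^k only involves monomials of degree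
    at least k, so that the k <= |e| give the whole coefficient at e. *)
Definition qcomp (R : realType) (q : R) (n : nat) (r : rel 'I_n)
    (h : nat -> R[i]) (u : qpser q r) : qpser q r :=
  fun e => \sum_(k < (\sum_(i < n) e i).+1) h k * (u ^+ k) e.

Definition qpoly (R : realType) (q : R) (n : nat) (r : rel 'I_n)
    (p : {poly R[i]}) (u : qpser q r) : qpser q r :=
  \sum_(k < size p) p`_k *: u ^+ k.

(** * q-exponentials *)

Definition qpoch (R : realType) (a p : R) (k : nat) : R :=
  \prod_(l < k) (1 - a * p ^+ l).

Definition eq_coef (R : realType) (p : R) (k : nat) : R[i] :=
  ((qpoch p p k)^-1)%:C.

Definition Eq_coef (R : realType) (p : R) (k : nat) : R[i] :=
  (p ^+ 'C(k, 2) / qpoch p p k)%:C.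

(** The numerical value 1 / (z; p)_oo of e_p at z. *)
Definition eq_val (R : realType) (p z : R) : R :=
  (lim (qpoch z p @ \oo))^-1.

(** * Sums of absolutely convergent families *)

Definition rsum (R : realType) (I : choiceType) (a : I -> R) : R :=
  fine (\esum_(i in [set: I]) (Num.max (a i) 0)%:E -
        \esum_(i in [set: I]) (Num.max (- a i) 0)%:E)%E.

Definition csum (R : realType) (I : choiceType) (a : I -> R[i]) : R[i] :=
  rsum (fun i => complex.Re (a i)) +i* rsum (fun i => complex.Im (a i)).

Definition csummable (R : realType) (I : choiceType) (a : I -> R[i]) : Prop :=
  summable [set: I] (fun i => (Normc.normc (a i))%:E).

(** * Power series in commuting variables and analytic continuation *)

(** The detour through [numClosedFieldType] equips C^n with its topology. *)
Notation Cn R n := 'rV[(R[i] : numClosedFieldType)]_n.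

Definition pterm (R : realType) (n : nat) (c : expv n -> R[i]) (z : Cn R n)
  (e : expv n) : R[i] := c e * \prod_(i < n) z 0 i ^+ e i.

Definition psummable (R : realType) (n : nat) (c : expv n -> R[i])
  (z : Cn R n) : Prop := csummable (pterm c z).

Definition psum (R : realType) (n : nat) (c : expv n -> R[i])
  (z : Cn R n) : R[i] := csum (pterm c z).

Definition expansion (R : realType) (n : nat) (F : Cn R n -> R[i])
    (a : Cn R n) (c : expv n -> R[i]) : Prop :=
  \forall z \near a, psummable c (z - a) /\ F z = psum c (z - a).

Definition analytic_at (R : realType) (n : nat) (F : Cn R n -> R[i])
  (a : Cn R n) : Prop := exists c, expansion F a c.

Definition entire (R : realType) (n : nat) (F : Cn R n -> R[i]) : Prop :=
  forall a, analytic_at F a.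

(** The power series at 0 of a function that is analytic there. *)
Definition taylor (R : realType) (n : nat) (F : Cn R n -> R[i]) :
  expv n -> R[i] := xget (fun=> 0) [set c | expansion F 0 c].

(** [F] is an analytic continuation to [W] of the sum of [c] near 0. *)
Definition continues (R : realType) (n : nat) (c : expv n -> R[i])
    (W : set (Cn R n)) (F : Cn R n -> R[i]) : Prop :=
  [/\ open W, (forall a, W a -> analytic_at F a) & expansion F 0 c].

(** [continuation c w v]: the power series [c] has an analytic continuation to
    an open set which is star-shaped about 0 and contains [w], with value [v] at
    [w].  The star shape makes [v] unique. *)
Definition continuation (R : realType) (n : nat) (c : expv n -> R[i])
    (w : Cn R n) (v : R[i]) : Prop :=
  exists (W : set (Cn R n)) (F : Cn R n -> R[i]),
    [/\ continues c W F,
        (forall z (s : R), W z -> 0 <= s <= 1 -> W (s%:C *: z)),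
        W w & F w = v].

Definition continuable (R : realType) (n : nat) (c : expv n -> R[i])
  (w : Cn R n) : Prop := exists v, continuation c w v.

Definition ext_val (R : realType) (n : nat) (c : expv n -> R[i])
  (w : Cn R n) : R[i] := xget 0 [set v | continuation c w v].

Definition even_part (R : realType) (n : nat) (c : expv n -> R[i]) :
    expv n -> R[i] :=
  fun e => if [forall i, ~~ odd (e i)] then c e else 0.

(** * Jackson integrals *)

(** The pair (h, b) stands for the point (-1)^b q^(2h) c of the lattice; its
    weight in the integral is (1 - q^2) q^(2h) c. *)
Definition lat_pt (R : realType) (q c : R) (x : int * bool) : R :=
  (-1) ^+ x.2 * (q ^ (2 * x.1) * c).

Definition jackson_term (R : realType) (q c : R) (phi : R -> R[i])
  (x : int * bool) : R[i] := (q ^ (2 * x.1) * c)%:C * phi (lat_pt q c x).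

Definition jackson_integrable (R : realType) (q c : R) (phi : R -> R[i]) :
  Prop := csummable (jackson_term q c phi).

Definition jackson (R : realType) (q c : R) (phi : R -> R[i]) : R[i] :=
  (1 - q ^+ 2)%:C * csum (jackson_term q c phi).

(** Iterated Jackson integral, the variable of index n-1 being integrated first
    and the variable of index 0 last. *)
Definition mjackson (R : realType) (q : R) (n : nat) (c : 'I_n -> R)
    (phi : 'rV[R]_n -> R[i]) : R[i] :=
  foldr
    (fun j (psi : 'rV[R]_n -> R[i]) t =>
       jackson q (c j) (fun s => psi (\row_i if i == j then s else t 0 i)))
    phi (enum 'I_n) 0.

Definition mjackson_integrable (R : realType) (q : R) (n : nat)
    (c : 'I_n -> R) (phi : 'rV[R]_n -> R[i]) : Prop :=
  csummable (fun x : {ffun 'I_n -> int * bool} =>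
    (\prod_(j < n) (q ^ (2 * (x j).1) * c j))%:C *
    phi (\row_j lat_pt q (c j) (x j))).

(** * The lattice order integral *)

(** Functions of the remaining variables are seen as functions of all n
    variables that do not depend on the variables already integrated. *)

Definition lat_subst (R : realType) (q : R) (n : nat) (l : 'I_n) (z : Cn R n)
    (t : R) : Cn R n :=
  \row_i if (i < l)%N then (q^-1)%:C * z 0 i else if i == l then t%:C else z 0 i.

Definition lat_fun (R : realType) (q : R) (n : nat) (l : 'I_n)
    (c : expv n -> R[i]) (z : Cn R n) (t : R) : R[i] :=
  ext_val (even_part c) (lat_subst q l z t).

Definition lat_int (R : realType) (q : R) (n : nat) (gamma : 'I_n -> R)
    (l : 'I_n) (c : expv n -> R[i]) (z : Cn R n) : R[i] :=
  jackson q (gamma l) (lat_fun q l c z).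

(** At the end [c] is the expansion of the constant phi_n, whose value is c_0. *)
Fixpoint lat_integrable_seq (R : realType) (q : R) (n : nat)
    (gamma : 'I_n -> R) (s : seq 'I_n) (c : expv n -> R[i]) : Prop :=
  if s is l :: s' then
    [/\ (forall z x,
           continuable (even_part c) (lat_subst q l z (lat_pt q (gamma l) x))),
        (forall z, jackson_integrable q (gamma l) (lat_fun q l c z)),
        entire (lat_int q gamma l c) &
        lat_integrable_seq q gamma s' (taylor (lat_int q gamma l c))]
  else True.

Fixpoint lat_value_seq (R : realType) (q : R) (n : nat)
    (gamma : 'I_n -> R) (s : seq 'I_n) (c : expv n -> R[i]) : R[i] :=
  if s is l :: s' then
    lat_value_seq q gamma s' (taylor (lat_int q gamma l c))
  else c 0.

(** The power series f_{.1} has the same coefficients as f. *)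
Definition lat_integrable (R : realType) (q : R) (n : nat) (sigma : 'S_n)
    (gamma : 'I_n -> R) (f : qA q n) : Prop :=
  (\forall z \near (0 : Cn R n), psummable f z) /\
  lat_integrable_seq q gamma [seq sigma k | k <- enum 'I_n] f.

Definition lat_integral (R : realType) (q : R) (n : nat) (sigma : 'S_n)
    (gamma : 'I_n -> R) (f : qA q n) : R[i] :=
  lat_value_seq q gamma [seq sigma k | k <- enum 'I_n] f.

(** * The transform F'' *)

Definition Ftrans_def (R : realType) (q : R) (n : nat) (sigma : 'S_n)
    (gamma : 'I_n -> R) (f : qA q n) : Prop :=
  forall e, lat_integrable sigma gamma (f * qmon q _ e).

Definition Ftrans (R : realType) (q : R) (n : nat) (sigma : 'S_n)
    (gamma : 'I_n -> R) (f : qA q n) : qD q n :=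
  fun e => lat_integral sigma gamma (f * qmon q _ e) *
    ('i%C ^+ (\sum_(j < n) e j) * (q ^- (\sum_(j < n) j * e j))%:C /
     (\prod_(j < n) qpoch (q ^+ 2) (q ^+ 2) (e j))%:C).

(** * The integral J' and the transform G_S *)

Definition real_pt (R : realType) (n : nat) (t : 'rV[R]_n) : Cn R n :=
  \row_i (t 0 i)%:C.

Definition Jfun (R : realType) (q : R) (n : nat) (g : qD q n)
    (t : 'rV[R]_n) : R[i] :=
  ext_val (even_part g) (real_pt t).

Definition Jint_def (R : realType) (q : R) (n : nat) (g : qD q n) : Prop :=
  (exists (U : set 'rV[R]_n) (F : Cn R n -> R[i]),
     [/\ open U, U 0 &
         continues (even_part g) [set z | U (\row_i complex.Im (z 0 i))] F]) /\
  (forall c : 'I_n -> R, (forall j, c j != 0) ->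
     mjackson_integrable q c (Jfun g)).

Definition Jint (R : realType) (q : R) (n : nat) (delta : 'I_n -> R)
    (g : qD q n) : R[i] :=
  mjackson q (fun j => q ^+ (n - j.+1) * delta j) (Jfun g).

Definition Gtrans_def (R : realType) (q : R) (n : nat) (g : qD q n) : Prop :=
  forall e, Jint_def (qmon q _ e * g).

Definition Gtrans (R : realType) (q : R) (n : nat) (delta : 'I_n -> R)
    (g : qD q n) : qA q n :=
  fun e => (- 'i%C) ^+ (\sum_(j < n) e j) *
    (q ^+ ((\sum_(j < n) e j) ^ 2 + \sum_(j < n) e j +
           \sum_(j < n) (n - j.+1) * e j))%:C /
    (\prod_(j < n) qpoch (q ^+ 2) (q ^+ 2) (e j))%:C *
    Jint delta (qmon q _ e * g).

(** * The elements and the constant of the inversion formulas *)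

Definition Egauss (R : realType) (q : R) (n : nat) (u : qA q n) : qA q n :=
  qcomp (Eq_coef (q ^+ 4)) (- (q ^+ 4)%:C *: u).

Definition egauss (R : realType) (q : R) (n : nat) (u : qD q n) : qD q n :=
  qcomp (eq_coef (q ^+ 4)) (- u).

Definition Egauss_sum (R : realType) (q : R) (n : nat) : qA q n :=
  Egauss (\sum_(j < n) qgen q _ j ^+ 2).

Arguments Egauss_sum {R} q n.

(** E_{q^4}(- q^4 x_n^2) p_n(x_n) ... E_{q^4}(- q^4 x_1^2) p_1(x_1) *)
Definition Aelt (R : realType) (q : R) (n : nat) (p : 'I_n -> {poly R[i]}) :
    qA q n :=
  \prod_(j <- rev (enum 'I_n))
    (Egauss (qgen q _ j ^+ 2) * qpoly (p j) (qgen q _ j)).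

(** r_n(d_n) e_{q^4}(- d_n^2) ... r_1(d_1) e_{q^4}(- d_1^2) *)
Definition Delt (R : realType) (q : R) (n : nat) (p : 'I_n -> {poly R[i]}) :
    qD q n :=
  \prod_(j <- rev (enum 'I_n))
    (qpoly (p j) (qgen q _ j) * egauss (qgen q _ j ^+ 2)).

(** b_i, B_j (lower sums) and B^j (upper sums) for a sign vector beta. *)
Definition sgn_exp (n : nat) (beta : 'I_n -> int) (i : 'I_n) : nat :=
  if beta i == 1 then 0%N else 1%N.

Definition sgn_lower (n : nat) (beta : 'I_n -> int) (j : 'I_n) : nat :=
  (\sum_(i < n | i < j) sgn_exp beta i)%N.

Definition sgn_upper (n : nat) (beta : 'I_n -> int) (j : 'I_n) : nat :=
  (\sum_(i < n | j < i) sgn_exp beta i)%N.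

Definition gauss_fun (R : realType) (q t : R) : R[i] :=
  (eq_val (q ^+ 4) (- t ^+ 2))%:C.

Definition kappa_lattice (R : realType) (q : R) (n : nat)
    (beta : 'I_n -> int) (delta : 'I_n -> R) (j : 'I_n) : R :=
  q ^+ (n - j.+1 + sgn_lower beta j) * delta j.

Definition kappa_def (R : realType) (q : R) (n : nat) (beta : 'I_n -> int)
    (sigma : 'S_n) (tgamma delta : 'I_n -> R) : Prop :=
  lat_integrable sigma tgamma (Egauss_sum q n) /\
  forall j, jackson_integrable q (kappa_lattice q beta delta j) (gauss_fun q).

Definition kappa (R : realType) (q : R) (n : nat) (beta : 'I_n -> int)
    (sigma : 'S_n) (tgamma delta : 'I_n -> R) : R[i] :=
  lat_integral sigma tgamma (Egauss_sum q n) *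
  \prod_(j < n) jackson q (kappa_lattice q beta delta j) (gauss_fun q).

(* Main.v *)
(** Commuting factors past each other only rescales variables by powers of q, so
    both transforms act on the products f and g one variable at a time.  Each
    successive lattice integral contributes a power of q, which the choice of
    gamma turns into an even one; since a Jackson lattice is invariant under
    multiplication by q^2, the integral factors into one-variable moments.  The
    same holds for J', the parities of the r_j fixing the lattices that occur in
    kappa.

    In one variable, the two Gaussians E and e satisfy first order q^2-difference
    equations, hence their moments satisfy the matching recurrences.  They show
    first that the transforms exchange E and e up to the zeroth moment, and then
    that multiplication by the variable on one side corresponds to a q-derivative
    on the other.  By induction every polynomial r has a partner s such that r E
    is mapped to a multiple of s e, and s e to a multiple of r E.

    The constant kappa is the product of the zeroth moments, because
    E_{q^4}(- q^4 sum_j x_j^2) is the product of the one-variable Gaussians, by a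
    q-multinomial theorem. *)

Require Import Defs.
From mathcomp Require Import all_boot all_order all_algebra all_fingroup.
From mathcomp Require Import complex.
From mathcomp Require Import all_classical all_reals all_analysis.
From mathcomp Require Import ring lra zify.
Set Implicit Arguments.
Unset Strict Implicit.
Unset Printing Implicit Defensive.
Import Order.TTheory GRing.Theory Num.Theory.
Import numFieldNormedType.Exports.
Import Normc.
Local Open Scope classical_set_scope.
Local Open Scope complex_scope.
Local Open Scope ring_scope.

(** * Unconditional sums *)

(** The Jackson sum of E converges because E vanishes at all points q^(-2k) and -q^(-2k), k >= 1;
    hence every lattice integral has to be brought back to the lattice q^(2Z), and only parities of
    exponents matter. Commuting a monomial with exponents e past f or g produces exponents that are
    sums of the e_i. The even part of the integrand vanishes unless each e_j has the parity b_j, so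
    these parities are dictated by beta: this is the origin of B^j in gamma and of B_j in kappa. The
    Gaussian in kappa is the case e = 0, where nothing is left to compensate, so tgamma carries B^j
    twice. The order sigma leaves a power of q that is the same for gamma and tgamma. Values of
    integrands are defined by continuation, so uniqueness along segments in star-shaped domains
    comes before any computation. E is entire; e has poles on the imaginary axis, and its
    continuation to |Im z| < 1 is built from its functional equation. The exponent |E|^2 of G_S is
    sum_j e_j^2 plus twice the reordering exponent of e: one copy is the normal ordering of f, the
    other is cancelled by the dilations inside J'. *)

Section UnconditionalSums.
Variable R : realType.
Implicit Types (I J : choiceType).

Definition rsummable I (a : I -> R) : Prop :=
  (\esum_(i in [set: I]) `|a i|%:E < +oo)%E.

Lemma rsummable_le I (a b : I -> R) :
  (forall i, `|a i| <= `|b i|) -> rsummable b -> rsummable a.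
Proof.
by move=> ab; apply: le_lt_trans; apply: le_esum => i _; rewrite lee_fin.
Qed.

Lemma rsummableD I (a b : I -> R) :
  rsummable a -> rsummable b -> rsummable (fun i => a i + b i).
Proof.
move=> sa sb; apply: le_lt_trans (lte_add_pinfty sa sb).
rewrite -esumD => [|i _|i _]; rewrite ?lee_fin ?normr_ge0 //.
by apply: le_esum => i _; rewrite -EFinD lee_fin ler_normD.
Qed.

Lemma esum_fin I (u : I -> R) : (forall i, 0 <= u i) -> rsummable u ->
  (\esum_(i in [set: I]) (u i)%:E)%E \is a fin_num.
Proof.
move=> u0 su; rewrite ge0_fin_numE; last first.
  by apply: esum_ge0 => i _; rewrite lee_fin.
apply: le_lt_trans su; apply: le_esum => i _; rewrite lee_fin.
exact: ler_norm.
Qed.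

Lemma rsum_ge0 I (u : I -> R) : (forall i, 0 <= u i) ->
  rsum u = fine (\esum_(i in [set: I]) (u i)%:E)%E.
Proof.
move=> u0; rewrite /rsum [X in (_ - X)%E]esum1 ?sube0.
  by congr fine; apply: eq_esum => i _; congr EFin; apply/max_idPl.
by move=> i _; congr EFin; apply/max_idPr; rewrite oppr_le0.
Qed.

(** Any splitting into nonnegative summable families computes [rsum], not just the one into positive
    and negative parts; additivity, homogeneity and Fubini reduce to the nonnegative case through
    it. *)
Lemma rsumB_ge0 I (u v : I -> R) : (forall i, 0 <= u i) -> (forall i, 0 <= v i) ->
  rsummable u -> rsummable v -> rsum (fun i => u i - v i) = rsum u - rsum v.
Proof.
move=> u0 v0 su sv; rewrite (rsum_ge0 u0) (rsum_ge0 v0).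
rewrite -fineB ?esum_fin // /rsum; congr fine.
have cu : summable [set: I] (fun i => (u i)%:E) by [].
have cv : summable [set: I] (fun i => (v i)%:E) by [].
rewrite -(esumB cu cv) => [|i _|i _]; rewrite ?lee_fin //.
congr (_ - _)%E; apply: eq_esum => i _.
  by rewrite funeposE -EFinB EFin_max.
by rewrite funenegE -EFinB -EFinN EFin_max.
Qed.

Definition posp I (a : I -> R) i := Num.max (a i) 0.
Definition negp I (a : I -> R) i := Num.max (- a i) 0.

Lemma posp_ge0 I (a : I -> R) i : 0 <= posp a i.
Proof. by rewrite /posp le_max lexx orbT. Qed.
Lemma negp_ge0 I (a : I -> R) i : 0 <= negp a i.
Proof. by rewrite /negp le_max lexx orbT. Qed.

Lemma pospBnegp I (a : I -> R) i : a i = posp a i - negp a i.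
Proof.
rewrite /posp /negp; case: (leP (a i) 0) => ai; case: (leP (- a i) 0) => nai; lra.
Qed.

Lemma posp_le I (a : I -> R) i : `|posp a i| <= `|a i|.
Proof.
rewrite ger0_norm ?posp_ge0 // /posp ge_max normr_ge0 ler_norm //.
Qed.

Lemma negp_le I (a : I -> R) i : `|negp a i| <= `|a i|.
Proof.
by rewrite ger0_norm ?negp_ge0 // /negp ge_max normr_ge0 -normrN ler_norm.
Qed.

Lemma rsummable_posp I (a : I -> R) : rsummable a -> rsummable (posp a).
Proof. by apply: rsummable_le => i; exact: posp_le. Qed.
Lemma rsummable_negp I (a : I -> R) : rsummable a -> rsummable (negp a).
Proof. by apply: rsummable_le => i; exact: negp_le. Qed.

Lemma rsumE I (a : I -> R) : rsummable a -> rsum a = rsum (posp a) - rsum (negp a).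
Proof.
move=> sa; rewrite -rsumB_ge0 //; [|exact: posp_ge0|exact: negp_ge0|
  exact: rsummable_posp|exact: rsummable_negp].
by congr rsum; apply/funext => i; exact: pospBnegp.
Qed.

Lemma rsumD_ge0 I (u v : I -> R) : (forall i, 0 <= u i) -> (forall i, 0 <= v i) ->
  rsummable u -> rsummable v -> rsum (fun i => u i + v i) = rsum u + rsum v.
Proof.
move=> u0 v0 su sv; rewrite !rsum_ge0 => //; last by move=> i; rewrite addr_ge0.
rewrite -fineD ?esum_fin // -esumD // => i _; rewrite lee_fin //.
Qed.

Lemma rsumD I (a b : I -> R) : rsummable a -> rsummable b ->
  rsum (fun i => a i + b i) = rsum a + rsum b.
Proof.
move=> sa sb; rewrite (rsumE sa) (rsumE sb).
transitivity (rsum (fun i => (posp a i + posp b i) - (negp a i + negp b i))).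
  by congr rsum; apply/funext => i; rewrite {1}(pospBnegp a) {1}(pospBnegp b); ring.
have [pa na] := (rsummable_posp sa, rsummable_negp sa).
have [pb nb] := (rsummable_posp sb, rsummable_negp sb).
rewrite rsumB_ge0 => [|i|i||]; rewrite ?addr_ge0 ?posp_ge0 ?negp_ge0 //;
  try exact: rsummableD.
by rewrite !rsumD_ge0 // => [|i|i|i|i];
  rewrite ?posp_ge0 ?negp_ge0 //; ring.
Qed.

Lemma rsummableN I (a : I -> R) : rsummable a -> rsummable (fun i => - a i).
Proof. by apply: rsummable_le => i; rewrite normrN. Qed.

Lemma rsumN I (a : I -> R) : rsummable a -> rsum (fun i => - a i) = - rsum a.
Proof.
move=> sa; rewrite (rsumE sa) (rsumE (rsummableN sa)) opprB.
by congr (rsum _ - rsum _); apply/funext => i; rewrite /posp /negp ?opprK.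
Qed.

Lemma esumZl I (r : R) (u : I -> R) : 0 <= r -> (forall i, 0 <= u i) ->
  (\esum_(i in [set: I]) (r * u i)%:E = r%:E * \esum_(i in [set: I]) (u i)%:E)%E.
Proof.
move=> r0 u0; rewrite /esum -ereal_supZl //; last first.
  by apply/set0P; exists (\sum_(x \in set0) (u x)%:E)%E, set0 => //; exact: fsets_set0.
rewrite image_comp; congr ereal_sup; apply: eq_imagel => A _ /=.
by rewrite ge0_mule_fsumr // => i; rewrite lee_fin.
Qed.

Lemma rsummableZ I (r : R) (a : I -> R) :
  rsummable a -> rsummable (fun i => r * a i).
Proof.
move=> sa; rewrite /rsummable.
under eq_esum do rewrite normrM.
by rewrite esumZl // lte_mul_pinfty // lee_fin.
Qed.

Lemma rsumZ_ge0 I (r : R) (u : I -> R) : 0 <= r -> (forall i, 0 <= u i) ->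
  rsummable u -> rsum (fun i => r * u i) = r * rsum u.
Proof.
move=> r0 u0 su; rewrite !rsum_ge0 // => [|i]; last by rewrite mulr_ge0.
by rewrite esumZl // fineM // esum_fin.
Qed.

Lemma rsumZ I (r : R) (a : I -> R) : rsummable a ->
  rsum (fun i => r * a i) = r * rsum a.
Proof.
move=> sa; wlog r0 : r / 0 <= r => [wl|].
  have [|/ltW r0] := leP 0 r; first exact: wl.
  rewrite -[r in RHS]opprK mulNr -wl ?oppr_ge0 // -rsumN; last exact: rsummableZ.
  by congr rsum; apply/funext => i; rewrite mulNr opprK.
have [pa na] := (rsummable_posp sa, rsummable_negp sa).
rewrite (rsumE sa) mulrBr -!rsumZ_ge0 //; try by move=> i; rewrite ?posp_ge0 ?negp_ge0.
rewrite -rsumB_ge0; try exact: rsummableZ;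
  try by move=> i; rewrite mulr_ge0 ?posp_ge0 ?negp_ge0.
by congr rsum; apply/funext => i; rewrite {1}(pospBnegp a) mulrBr.
Qed.

Lemma esum_pair I J (u : I * J -> R) : (forall x, 0 <= u x) ->
  (\esum_(x in [set: I * J]) (u x)%:E =
   \esum_(i in [set: I]) \esum_(j in [set: J]) (u (i, j))%:E)%E.
Proof.
move=> u0; rewrite esum_esum; last by move=> *; rewrite lee_fin.
have -> : [set: I] `*`` (fun=> [set: J]) = [set: I * J].
  by apply/seteqP; split.
by apply: eq_esum => -[].
Qed.

Lemma rsummable_row I J (u : I * J -> R) i :
  rsummable u -> rsummable (fun j => u (i, j)).
Proof.
rewrite /rsummable esum_pair // => h.
have g0 k : (0 <= \esum_(j in [set: J]) (`|u (k, j)|)%:E)%E.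
  by apply: esum_ge0 => j _; rewrite lee_fin.
have := @summable_pinfty _ _ [set: I]
  (fun i => \esum_(j in [set: J]) (`|u (i, j)|)%:E)%E.
rewrite /summable => /(_ _ i Logic.I); rewrite (gee0_abs (g0 i)); apply.
by under eq_esum do rewrite gee0_abs //.
Qed.

Lemma rsummable_rsum_ge0 I J (u : I * J -> R) : (forall x, 0 <= u x) ->
  rsummable u -> rsummable (fun i => rsum (fun j => u (i, j))).
Proof.
move=> u0 su; have : (\esum_(x in [set: I * J]) (u x)%:E < +oo)%E.
  by apply: le_lt_trans su; apply: le_esum => x _; rewrite lee_fin ler_norm.
rewrite esum_pair //; apply: le_lt_trans; apply: le_esum => i _.
rewrite rsum_ge0 // ger0_norm; last first.
  by apply: fine_ge0; apply: esum_ge0 => j _; rewrite lee_fin.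
by rewrite fineK //; apply: esum_fin => //; exact: rsummable_row.
Qed.

Lemma rsum_pair_ge0 I J (u : I * J -> R) : (forall x, 0 <= u x) ->
  rsummable u -> rsum u = rsum (fun i => rsum (fun j => u (i, j))).
Proof.
move=> u0 su; rewrite rsum_ge0 // esum_pair // rsum_ge0.
  congr fine; apply: eq_esum => i _; rewrite rsum_ge0 // fineK //.
  by apply: esum_fin => //; exact: rsummable_row.
move=> i; rewrite rsum_ge0 //; apply: fine_ge0; apply: esum_ge0 => j _.
by rewrite lee_fin.
Qed.

Lemma rsum_pair I J (a : I * J -> R) : rsummable a ->
  rsum a = rsum (fun i => rsum (fun j => a (i, j))).
Proof.
move=> sa; have [pa na] := (rsummable_posp sa, rsummable_negp sa).
rewrite (rsumE sa) (rsum_pair_ge0 (@posp_ge0 _ a)) //.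
rewrite (rsum_pair_ge0 (@negp_ge0 _ a)) // -rsumB_ge0.
- congr rsum; apply/funext => i.
  by rewrite (rsumE (rsummable_row i sa)); congr (rsum _ - rsum _).
- move=> i; rewrite rsum_ge0 => [|j]; last exact: posp_ge0.
  by apply: fine_ge0; apply: esum_ge0 => j _; rewrite lee_fin posp_ge0.
- move=> i; rewrite rsum_ge0 => [|j]; last exact: negp_ge0.
  by apply: fine_ge0; apply: esum_ge0 => j _; rewrite lee_fin negp_ge0.
- by apply: rsummable_rsum_ge0 => //; exact: posp_ge0.
- by apply: rsummable_rsum_ge0 => //; exact: negp_ge0.
Qed.

Lemma rsummable_pair I J (a : I * J -> R) (b : I -> R) :
  (forall i, rsummable (fun j => a (i, j))) ->
  (forall i, rsum (fun j => `|a (i, j)|) <= b i) -> rsummable b -> rsummable a.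
Proof.
move=> sr ab; rewrite /rsummable esum_pair //; apply: le_lt_trans.
apply: le_esum => i _; rewrite -(@fineK _ (esum _ _)); last first.
  by apply: esum_fin => //; rewrite /rsummable; under eq_esum do rewrite normr_id; exact: sr.
rewrite lee_fin; apply: le_trans (ler_norm _).
by apply: le_trans (ab i); rewrite rsum_ge0.
Qed.

(** Reindexing along an injection whose image contains the support; most later changes of summation
    index have this form. *)
Lemma esum_inj I J (e : I -> J) (u : J -> R) : injective e ->
  (forall j, (forall i, e i != j) -> u j = 0) ->
  (\esum_(j in [set: J]) (u j)%:E = \esum_(i in [set: I]) (u (e i))%:E)%E.
Proof.
move=> inj out; rewrite -(esum_image [set: I] e (fun j => (u j)%:E)); last first.
  by move=> x y _ _; exact: inj.
rewrite [RHS]esum_mkcond; apply: eq_esum => j _; case: ifPn => // /negP jn.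
rewrite out // => i; apply/eqP => ij; apply: jn; rewrite inE.
by exists i.
Qed.

Lemma rsummable_inj I J (e : I -> J) (a : J -> R) : injective e ->
  (forall j, (forall i, e i != j) -> a j = 0) ->
  rsummable (fun i => a (e i)) -> rsummable a.
Proof.
move=> inj out; rewrite /rsummable (esum_inj inj) // => j h.
by rewrite out // normr0.
Qed.

Lemma rsummable_comp I J (e : I -> J) (a : J -> R) : injective e ->
  rsummable a -> rsummable (fun i => a (e i)).
Proof.
move=> inj; apply: le_lt_trans.
rewrite -(esum_image [set: I] e (fun j => `|a j|%:E)); last first.
  by move=> x y _ _; exact: inj.
rewrite [leLHS]esum_mkcond; apply: le_esum => j _.
by case: ifP => // _; rewrite lee_fin.
Qed.

Lemma rsum_inj I J (e : I -> J) (a : J -> R) : injective e ->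
  (forall j, (forall i, e i != j) -> a j = 0) ->
  rsum a = rsum (fun i => a (e i)).
Proof.
move=> inj out; rewrite /rsum (esum_inj inj) => [|j /out ->]; last first.
  by rewrite maxxx.
by rewrite (esum_inj inj) // => j /out ->; rewrite oppr0 maxxx.
Qed.

Lemma rsum_fin I (u : I -> R) (s : seq I) : uniq s ->
  (forall i, i \notin s -> u i = 0) -> rsummable u /\ rsum u = \sum_(i <- s) u i.
Proof.
move=> us out; have fs : finite_set [set` s] by exact: finite_seq.
have ge0E (v : I -> R) : (forall i, 0 <= v i) -> (forall i, i \notin s -> v i = 0) ->
    (\esum_(i in [set: I]) (v i)%:E = (\sum_(i <- s) v i)%:E)%E.
  move=> v0 outv; transitivity (\esum_(i in [set` s]) (v i)%:E)%E.
    rewrite [RHS]esum_mkcond; apply: eq_esum => i _; case: ifPn => // h.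
    by rewrite outv //; apply/negP => si; move/negP: h; apply; rewrite inE.
  rewrite -sumEFin fsbig_seq // -esum_fset // => i _; by rewrite lee_fin.
have sp (v : I -> R) : (forall i, 0 <= v i) -> (forall i, i \notin s -> v i = 0) ->
    rsum v = \sum_(i <- s) v i.
  by move=> v0 ov; rewrite rsum_ge0 // ge0E.
have su : rsummable u.
  rewrite /rsummable ge0E // ?ltry // => i /out ->; exact: normr0.
split=> //; rewrite (rsumE su) !sp; try by move=> i; rewrite ?posp_ge0 ?negp_ge0.
- by rewrite -sumrB; apply: eq_bigr => i _; rewrite -pospBnegp.
- by move=> i /out ui; rewrite /negp ui oppr0 maxxx.
- by move=> i /out ui; rewrite /posp ui maxxx.
Qed.

Lemma rsum_ge0_ge0 I (u : I -> R) : (forall i, 0 <= u i) -> 0 <= rsum u.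
Proof.
move=> u0; rewrite rsum_ge0 //; apply: fine_ge0; apply: esum_ge0 => i _.
by rewrite lee_fin.
Qed.

Lemma ler_rsum I (a b : I -> R) : rsummable a -> rsummable b ->
  (forall i, a i <= b i) -> rsum a <= rsum b.
Proof.
move=> sa sb ab; have sna := rsummableN sa.
rewrite -subr_ge0 -rsumN // -rsumD //.
by apply: rsum_ge0_ge0 => i; rewrite subr_ge0.
Qed.

Lemma ler_norm_rsum I (a : I -> R) : rsummable a -> `|rsum a| <= rsum (fun i => `|a i|).
Proof.
move=> sa; have sna : rsummable (fun i => `|a i|).
  by apply: rsummable_le sa => i; rewrite normr_id.
have snna := rsummableN sna.
rewrite ler_norml -rsumN // !ler_rsum // => i; first exact: ler_norm.
by rewrite lerNl -normrN ler_norm.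
Qed.

End UnconditionalSums.

(** * Absolutely summable complex families *)

Section ComplexSums.
Variable R : realType.
Local Notation C := R[i].
Implicit Types (I J : choiceType) (z w s t : C).

Lemma normc_ge0 z : 0 <= normc z.
Proof. by case: z => a b; exact: sqrtr_ge0. Qed.

Lemma normcD z w : normc (z + w) <= normc z + normc w.
Proof. exact: (@le_normcD R z w). Qed.

Lemma normc_opp z : normc (- z) = normc z.
Proof. exact: (@normcN R z). Qed.

Lemma normc_real (r : R) : normc r%:C = `|r|.
Proof. by rewrite /= expr0n /= addr0 sqrtr_sqr. Qed.

Lemma normcX z k : normc (z ^+ k) = normc z ^+ k.
Proof. by elim: k => [|k IH]; rewrite ?expr0 ?normc1 // !exprS normcM IH. Qed.

Lemma normc_prod I (r : seq I) (P : pred I) (F : I -> C) :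
  normc (\prod_(i <- r | P i) F i) = \prod_(i <- r | P i) normc (F i).
Proof. by elim/big_ind2: _ => [|x y z w <- <-|//]; [exact: normc1|exact: normcM]. Qed.

Lemma normc_Re z : `|complex.Re z| <= normc z.
Proof.
case: z => a b /=; rewrite -(sqrtr_sqr a); apply: ler_wsqrtr.
by rewrite lerDl sqr_ge0.
Qed.

Lemma normc_Im z : `|complex.Im z| <= normc z.
Proof.
case: z => a b /=; rewrite -(sqrtr_sqr b); apply: ler_wsqrtr.
by rewrite lerDr sqr_ge0.
Qed.

Lemma normc_ReIm z : normc z <= `|complex.Re z| + `|complex.Im z|.
Proof.
rewrite {1}[z]complexE; apply: le_trans (normcD _ _) _.
rewrite normcM !normc_real.
by rewrite /= expr0n expr1n add0r sqrtr1 mul1r.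
Qed.

Lemma normc_eq0 z : (normc z == 0) = (z == 0).
Proof. by apply/eqP/eqP => [/eq0_normc //|->]; exact: normc0. Qed.

Lemma csummableE I (a : I -> C) :
  csummable a = rsummable (fun i => normc (a i)).
Proof. by []. Qed.

Lemma csummable_le I (a : I -> C) (b : I -> R) :
  (forall i, normc (a i) <= b i) -> rsummable b -> csummable a.
Proof.
move=> ab; apply: rsummable_le => i; rewrite ger0_norm ?normc_ge0 //.
exact: le_trans (ab i) (ler_norm _).
Qed.

Lemma csummable_Re I (a : I -> C) : csummable a -> rsummable (fun i => complex.Re (a i)).
Proof.
apply: rsummable_le => i; rewrite [leRHS]ger0_norm ?normc_ge0 //.
exact: normc_Re.
Qed.

Lemma csummable_Im I (a : I -> C) : csummable a -> rsummable (fun i => complex.Im (a i)).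
Proof.
apply: rsummable_le => i; rewrite [leRHS]ger0_norm ?normc_ge0 //.
exact: normc_Im.
Qed.

(** The crude constant 2 comes from bounding real and imaginary parts separately; it suffices for
    boundedness and smallness estimates. *)
Lemma normc_csum I (a : I -> C) : csummable a ->
  normc (csum a) <= 2 * rsum (fun i => normc (a i)).
Proof.
move=> sa; apply: le_trans (normc_ReIm _) _; rewrite mulr_natl mulr2n /=.
have [sR sI] := (csummable_Re sa, csummable_Im sa).
apply: lerD; (apply: le_trans (ler_norm_rsum _) _ => //); apply: ler_rsum => //.
- by apply: rsummable_le sR => i; rewrite normr_id.
- by move=> i; exact: normc_Re.
- by apply: rsummable_le sI => i; rewrite normr_id.
- by move=> i; exact: normc_Im.
Qed.

(** Summability and value are bundled so that a computation carries both along. *)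
Definition csums I (a : I -> C) s := csummable a /\ csum a = s.

Lemma csumsP I (a : I -> C) : csummable a -> csums a (csum a).
Proof. by []. Qed.

Lemma eq_csums I (a b : I -> C) s : a =1 b -> csums a s -> csums b s.
Proof. by move=> /funext ->. Qed.

Lemma csumsD I (a b : I -> C) s t : csums a s -> csums b t ->
  csums (fun i => a i + b i) (s + t).
Proof.
move=> [sa <-] [sb <-]; split.
  apply: csummable_le (rsummableD sa sb) => i; exact: normcD.
rewrite /csum; have [saR saI] := (csummable_Re sa, csummable_Im sa).
have [sbR sbI] := (csummable_Re sb, csummable_Im sb).
transitivity ((rsum (fun i => complex.Re (a i)) + rsum (fun i => complex.Re (b i))) +i*
  (rsum (fun i => complex.Im (a i)) + rsum (fun i => complex.Im (b i)))); last by [].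
by rewrite -!rsumD //; congr (_ +i* _); congr rsum; apply/funext => i;
  case: (a i) (b i) => ? ? [].
Qed.

Lemma csumsZ I (a : I -> C) s w : csums a s -> csums (fun i => w * a i) (w * s).
Proof.
move=> [sa <-]; split.
  by apply: csummable_le (rsummableZ (normc w) sa) => i; rewrite normcM.
have [saR saI] := (csummable_Re sa, csummable_Im sa).
case: w => x y; rewrite /csum.
transitivity ((x * rsum (fun i => complex.Re (a i)) - y * rsum (fun i => complex.Im (a i))) +i*
  (x * rsum (fun i => complex.Im (a i)) + y * rsum (fun i => complex.Re (a i)))); last first.
  by [].
have zR u := rsummableZ u saR; have zI u := rsummableZ u saI.
rewrite -!rsumZ // -rsumN // -!rsumD //; last exact: rsummableN.
by congr (_ +i* _); congr rsum; apply/funext => i; case: (a i).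
Qed.

Lemma csumsZr I (a : I -> C) s w : csums a s -> csums (fun i => a i * w) (s * w).
Proof.
by move=> /(csumsZ w); rewrite mulrC; apply: eq_csums => i; rewrite mulrC.
Qed.

Lemma csumsN I (a : I -> C) s : csums a s -> csums (fun i => - a i) (- s).
Proof. by move=> /(csumsZ (-1)); rewrite mulN1r; apply: eq_csums => i; rewrite mulN1r. Qed.

Lemma csumsB I (a b : I -> C) s t : csums a s -> csums b t ->
  csums (fun i => a i - b i) (s - t).
Proof. by move=> sa /csumsN; exact: csumsD. Qed.

Lemma csums_fin I (a : I -> C) (r : seq I) : uniq r ->
  (forall i, i \notin r -> a i = 0) -> csums a (\sum_(i <- r) a i).
Proof.
move=> ur out; split.
  by have [] := @rsum_fin R I (fun i => normc (a i)) r ur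
    (fun i h => etrans (congr1 (@normc R) (out i h)) (normc0 R)).
rewrite /csum (@rsum_fin _ _ _ r ur _).2 => [|i /out -> //].
rewrite (@rsum_fin _ _ _ r ur _).2 => [|i /out -> //].
by elim: r {ur out} => [|i r IH]; rewrite ?big_nil // !big_cons -IH; case: (a i).
Qed.

Lemma csums0 I : csums (fun _ : I => 0) 0.
Proof. by have := @csums_fin I (fun=> 0) [::] erefl (fun _ _ => erefl); rewrite big_nil. Qed.

Lemma csums_single I (a : I -> C) i : (forall j, j != i -> a j = 0) -> csums a (a i).
Proof.
move=> out; have := @csums_fin I a [:: i] erefl; rewrite big_seq1; apply => j.
by rewrite inE => /out.
Qed.

Lemma csums_sum I J (r : seq J) (a : J -> I -> C) (s : J -> C) :
  (forall j, csums (a j) (s j)) ->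
  csums (fun i => \sum_(j <- r) a j i) (\sum_(j <- r) s j).
Proof.
move=> h; elim: r => [|j r IH].
  by rewrite big_nil; apply: eq_csums (csums0 I) => i; rewrite big_nil.
by rewrite big_cons; apply: eq_csums (csumsD (h j) IH) => i; rewrite big_cons.
Qed.

Lemma csummable_inj I J (e : I -> J) (a : J -> C) : injective e ->
  (forall j, (forall i, e i != j) -> a j = 0) ->
  csummable (fun i => a (e i)) -> csummable a.
Proof.
move=> inj out; apply: (@rsummable_inj R I J e (fun j => normc (a j)) inj) => j.
by move=> /out ->; exact: normc0.
Qed.

Lemma csummable_comp I J (e : I -> J) (a : J -> C) : injective e ->
  csummable a -> csummable (fun i => a (e i)).
Proof. by move=> inj; exact: (@rsummable_comp R I J e (fun j => normc (a j))). Qed.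

Lemma csum_inj I J (e : I -> J) (a : J -> C) : injective e ->
  (forall j, (forall i, e i != j) -> a j = 0) ->
  csum a = csum (fun i => a (e i)).
Proof.
by move=> inj out; rewrite /csum !(rsum_inj inj) // => j /out ->.
Qed.

Lemma csums_inj I J (e : I -> J) (a : J -> C) s : injective e ->
  (forall j, (forall i, e i != j) -> a j = 0) ->
  csums (fun i => a (e i)) s <-> csums a s.
Proof.
move=> inj out; rewrite /csums -csum_inj //; split=> -[h1 h2]; split=> //.
  exact: (csummable_inj inj).
exact: csummable_comp.
Qed.

Lemma csums_bij I J (e : I -> J) (a : J -> C) s : bijective e ->
  csums (fun i => a (e i)) s <-> csums a s.
Proof.
move=> be; apply: csums_inj (bij_inj be) _ => j out; have [e' _ ke'] := be.
by have := out (e' j); rewrite ke' eqxx.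
Qed.

Lemma csummable_row I J (a : I * J -> C) i :
  csummable a -> csummable (fun j => a (i, j)).
Proof. by move=> sa; exact: (@rsummable_row R I J (fun x => normc (a x)) i sa). Qed.

Lemma csum_pair I J (a : I * J -> C) : csummable a ->
  csums (fun i => csum (fun j => a (i, j))) (csum a).
Proof.
move=> sa; split.
  apply: csummable_le (rsummableZ 2 (rsummable_rsum_ge0 _ sa)) => [i|x].
    exact/normc_csum/csummable_row.
  exact: normc_ge0.
by rewrite /csum -(rsum_pair (csummable_Re sa)) -(rsum_pair (csummable_Im sa)).
Qed.

Lemma csums_pair I J (a : I * J -> C) (g : I -> C) s : csums a s ->
  (forall i, csum (fun j => a (i, j)) = g i) -> csums g s.
Proof.
move=> [sa <-] ag; have := csum_pair sa; apply: eq_csums => i; exact: ag.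
Qed.

(** The direction of Fubini that needs absolute summability of the double family as an input. *)
Lemma csums_pair' I J (a : I * J -> C) (g : I -> C) s : csummable a ->
  (forall i, csum (fun j => a (i, j)) = g i) -> csums g s -> csums a s.
Proof.
by move=> sa ag [_ <-]; split=> //; have [_ ->] := csums_pair (csumsP sa) ag.
Qed.

Lemma csums_swap I J (a : I * J -> C) s : csums a s ->
  csums (fun x : J * I => a (x.2, x.1)) s.
Proof.
move=> sa; apply/(@csums_bij _ _ (fun x : J * I => (x.2, x.1)) a s) => //.
by exists (fun x => (x.2, x.1)) => -[].
Qed.

Lemma csummable_pair I J (a : I * J -> C) (b : I -> R) :
  (forall i, csummable (fun j => a (i, j))) ->
  (forall i, rsum (fun j => normc (a (i, j))) <= b i) -> rsummable b ->
  csummable a.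
Proof.
move=> sr ab sb; apply: (rsummable_pair _ _ sb) => [i|i]; first exact: sr.
by under eq_fun do rewrite ger0_norm ?normc_ge0 //; exact: ab.
Qed.

Lemma rsum_csum I (u : I -> R) : csum (fun i => (u i)%:C) = (rsum u)%:C.
Proof.
rewrite /csum /=; congr (_ +i* _).
by have [_] := @rsum_fin R I (fun=> 0) [::] erefl (fun _ _ => erefl); rewrite big_nil.
Qed.

Lemma csums_mul I J (a : I -> C) (b : J -> C) s t : csums a s -> csums b t ->
  csums (fun x => a x.1 * b x.2) (s * t).
Proof.
move=> sa sb; apply: csums_pair' (csumsZr t sa) => [|i]; last first.
  by have [_] := csumsZ (a i) sb.
apply: (@csummable_pair _ _ _ (fun i => rsum (fun j => normc (b j)) * normc (a i))).
- by move=> i; have [] := csumsZ (a i) sb.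
- move=> i /=; under eq_fun do rewrite normcM.
  by rewrite (rsumZ _ sb.1) [leRHS]mulrC lexx.
- by apply: rsummableZ; case: sa.
Qed.

(** Distributivity of a finite product of absolutely convergent series, by splitting off coordinate
    0. This is what reduces series indexed by exponent vectors, and multiple Jackson sums, to one
    variable. *)
Lemma csums_ffun I n (a : 'I_n -> I -> C) (s : 'I_n -> C) :
  (forall i, csums (a i) (s i)) ->
  csums (fun e : {ffun 'I_n -> I} => \prod_i a i (e i)) (\prod_i s i).
Proof.
elim: n => [|n IH] in a s * => h.
  rewrite big_ord0; pose e0 : {ffun 'I_0 -> I} := ffun0 (card_ord 0).
  have := @csums_single _ (fun e : {ffun 'I_0 -> I} => \prod_i a i (e i)) e0.
  rewrite [X in csums _ X]big_ord0; apply=> j /eqP[].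
  by apply/ffunP => -[].
pose phi (x : I * {ffun 'I_n -> I}) : {ffun 'I_n.+1 -> I} :=
  [ffun k => if unlift ord0 k is Some j then x.2 j else x.1].
pose psi (e : {ffun 'I_n.+1 -> I}) := (e ord0, [ffun j => e (lift ord0 j)]).
have bphi : bijective phi.
  exists psi => [[i f]|e].
    congr pair => /=; first by rewrite ffunE unlift_none.
    by apply/ffunP => j; rewrite !ffunE liftK.
  by apply/ffunP => k; rewrite ffunE; case: unliftP => [j|] -> //=; rewrite ffunE.
apply/(csums_bij _ _ bphi); rewrite big_ord_recl.
have := csums_mul (h ord0) (IH _ _ (fun i => h (lift ord0 i))).
apply: eq_csums => -[i f] /=; rewrite big_ord_recl ffunE unlift_none; congr (_ * _).
by apply: eq_bigr => j _; rewrite ffunE liftK.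
Qed.

Lemma csummable_ffun I n (a : 'I_n -> I -> C) : (forall i, csummable (a i)) ->
  csummable (fun e : {ffun 'I_n -> I} => \prod_i a i (e i)).
Proof. by move=> sa; have [] := csums_ffun (fun i => csumsP (sa i)). Qed.

Lemma rsummable_ffun I n (a : 'I_n -> I -> R) : (forall i, rsummable (a i)) ->
  rsummable (fun e : {ffun 'I_n -> I} => \prod_i a i (e i)).
Proof.
move=> sa; have := @csummable_ffun I n (fun i j => (a i j)%:C).
rewrite !csummableE => h; apply: rsummable_le (h _) => [e|i].
  by rewrite -rmorph_prod normc_real normr_id.
by rewrite csummableE; apply: rsummable_le (sa i) => j; rewrite normc_real normr_id.
Qed.

Lemma rsummable_nat (a : nat -> R) (M : R) :
  (forall N, \sum_(k < N) `|a k| <= M) -> rsummable a.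
Proof.
move=> h; rewrite /rsummable -nneseries_esumT; last by move=> k; rewrite lee_fin.
apply: (@le_lt_trans _ _ M%:E); last exact: ltry.
apply: lime_le.
  by apply: is_cvg_nneseries => k _ _; rewrite lee_fin.
by apply: nearW => N; rewrite sumEFin lee_fin big_mkord; exact: h.
Qed.

Lemma rsummable_geo (r : R) : 0 <= r < 1 -> rsummable (fun k : nat => r ^+ k).
Proof.
move=> /andP[r0 r1]; apply: (@rsummable_nat _ (1 - r)^-1) => N.
have h : (1 - r) * \sum_(k < N) `|r ^+ k| = 1 - r ^+ N.
  rewrite -[1 in RHS](expr1n _ N) subrXX; congr (_ * _); apply: eq_bigr => k _.
  by rewrite expr1n mul1r ger0_norm ?exprn_ge0.
have r1' : 0 < 1 - r by rewrite subr_gt0.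
by rewrite -(ler_pM2l r1') h divff ?gt_eqF // lerBlDr lerDl exprn_ge0.
Qed.

End ComplexSums.
(** * Power series and analytic continuation *)

Section Topology.
Variable R : realType.

(** Ball radii in [Cn R n] are elements of [R[i]]; a positive one is real, so neighbourhoods can be
    described by a real radius. *)
Lemma near_CnP n (a : Cn R n) (P : set (Cn R n)) :
  (\forall z \near a, P z) <->
  exists2 r : R, 0 < r & forall z : Cn R n, (forall i, normc (z 0 i - a 0 i) < r) -> P z.
Proof.
split.
  move=> /nbhs_ballP[/= e e0 h]; have e0' := e0; move: e0'; rewrite ltcE /= => /andP[/eqP ei er].
  exists (complex.Re e) => // z hz; apply: h; split=> // i j; rewrite (ord1 i) /ball /= distrC.
  have -> : e = (complex.Re e)%:C by move: ei; case: (e) => x y /= ->.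
  by rewrite [X in X < _](_ : _ = (normc (z 0 j - a 0 j))%:C) // ltcR.
move=> [r r0 h]; apply/nbhs_ballP; exists (r%:C); first by rewrite /= ltcR.
move=> z [_ hz]; apply: h => i; have := hz 0 i; rewrite /ball /= distrC.
by rewrite [X in X < _](_ : _ = (normc (z 0 i - a 0 i))%:C) // ltcR.
Qed.

Lemma near_RnP n (a : 'rV[R]_n) (P : set 'rV[R]_n) :
  (\forall z \near a, P z) <->
  exists2 r : R, 0 < r & forall z : 'rV[R]_n, (forall i, `|z 0 i - a 0 i| < r) -> P z.
Proof.
split.
  move=> /nbhs_ballP[/= r r0 h]; exists r => // z hz; apply: h; split=> // i j.
  by rewrite (ord1 i) /ball /= distrC.
move=> [r r0 h]; apply/nbhs_ballP; exists r => //= z [_ hz]; apply: h => i.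
by have := hz 0 i; rewrite /ball /= distrC.
Qed.

End Topology.

(** * Power series along a real segment *)

Section Series1.
Variable R : realType.
Local Notation C := R[i].

Lemma small_eq0 (x M s0 : R) : 0 <= x -> 0 < s0 ->
  (forall s, 0 < s < s0 -> x <= s * M) -> x = 0.
Proof.
move=> x0 s00 h; apply/eqP; rewrite eq_le x0 andbT leNgt; apply/negP => xp.
have M0 : 0 < M.
  have /h : 0 < s0 / 2 < s0 by lra.
  move=> xM; have : 0 < s0 / 2 * M by lra.
  by rewrite pmulr_rgt0 //; lra.
pose s := Num.min (s0 / 2) (x / (2 * M)).
have xM0 : 0 < x / (2 * M) by rewrite divr_gt0 // mulr_gt0.
have ss : 0 < s < s0.
  rewrite lt_min xM0 gt_min; apply/andP; split; first by apply/andP; split; lra.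
  by apply/orP; left; lra.
have := h _ ss; have : s * M <= x / (2 * M) * M.
  by rewrite ler_pM2r // ge_min lexx orbT.
have -> : x / (2 * M) * M = x / 2 by field; rewrite gt_eqF.
lra.
Qed.

(** Once the lower coefficients vanish, A_k s^k is minus the tail of the series, which is of order
    s^(k+1); letting s tend to 0 kills A_k. Only positive real arguments are used, which is what
    both applications provide. *)
Lemma series_eq0 (A : nat -> C) (s0 : R) : 0 < s0 ->
  csummable (fun k => A k * s0%:C ^+ k) ->
  (forall s : R, 0 < s < s0 -> csum (fun k => A k * s%:C ^+ k) = 0) ->
  forall k, A k = 0.
Proof.
move=> s00 sA h; elim/ltn_ind => k IH.
have nA s j : 0 <= s -> normc (A j * s%:C ^+ j) = normc (A j) * s ^+ j.
  by move=> s_0; rewrite normcM normcX normc_real ger0_norm.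
have sA' : rsummable (fun k => normc (A k) * s0 ^+ k).
  by apply: rsummable_le sA => j; have := ltW s00 => ?; rewrite nA.
have sAs s : 0 < s < s0 -> csummable (fun k => A k * s%:C ^+ k).
  move=> /andP[s_0 ss]; apply: csummable_le sA' => j; have := ltW s_0 => ?; rewrite nA //.
  by rewrite ler_wpM2l ?normc_ge0 // lerXn2r ?nnegrE // ltW.
apply/eqP; rewrite -normc_eq0; apply/eqP.
pose S := rsum (fun k => normc (A k) * s0 ^+ k).
apply: (@small_eq0 _ (2 * S / s0 ^+ k.+1) s0) => // [|s hs]; first exact: normc_ge0.
have [s_0 ss0] := andP hs; have s_ge0 := ltW s_0; have s0_ge0 := ltW s00.
have ss0' := ltW ss0.
pose u j := (if j == k then 0 else A j * s%:C ^+ j).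
have su : csums u (0 - A k * s%:C ^+ k).
  pose v j := if j == k then A k * s%:C ^+ k else 0.
  have sv : csums v (A k * s%:C ^+ k).
    by have := @csums_single _ _ v k; rewrite /v eqxx; apply=> j /negPf ->.
  have h0 : csums (fun k => A k * s%:C ^+ k) 0 by split; [exact: sAs|exact: h].
  by apply: eq_csums (csumsB h0 sv) => j; rewrite /u /v;
     case: eqP => [->|_]; rewrite ?subrr ?subr0.
have [cu eu] := su; have := normc_csum cu; rewrite eu sub0r normc_opp nA //.
move=> le1.
have le2 : rsum (fun i => normc (u i)) <= (s / s0) ^+ k.+1 * S.
  rewrite /S -rsumZ //; apply: ler_rsum => //; first exact: rsummableZ.
  move=> j; rewrite /u; case: (ltngtP j k) => jk.
  - by rewrite IH // mul0r normc0 mul0r mulr0.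
  - rewrite nA // mulrCA ler_wpM2l ?normc_ge0 //.
    rewrite -(subnK jk) [s ^+ _]exprD [s0 ^+ _]exprD exprMn exprVn.
    have -> : s ^+ k.+1 / s0 ^+ k.+1 * (s0 ^+ (j - k.+1) * s0 ^+ k.+1) =
      s0 ^+ (j - k.+1) * s ^+ k.+1 by field; rewrite expf_neq0 // gt_eqF.
    by rewrite ler_pM2r ?exprn_gt0 // lerXn2r ?nnegrE.
  - by rewrite normc0 !mulr_ge0 ?exprn_ge0 ?normc_ge0 ?divr_ge0.
have sk : 0 < s ^+ k by rewrite exprn_gt0.
rewrite -(ler_pM2r sk); apply: le_trans le1 _.
apply: le_trans (_ : 2 * ((s / s0) ^+ k.+1 * S) <= _); first by rewrite ler_pM2l.
have -> : s * (2 * S / s0 ^+ k.+1) * s ^+ k = 2 * ((s / s0) ^+ k.+1 * S) => //.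
by rewrite exprMn exprVn [s ^+ k.+1]exprS; ring.
Qed.

(* The zero set of a real-analytic function on [0, 1] that vanishes near 0 is
   both open and closed. *)
Lemma analytic_segment_eq0 (H : R -> C) :
  (forall s : R, 0 <= s <= 1 -> exists (r : R) (D : nat -> C),
     0 < r /\ forall t : R, `|t| <= r -> csums (fun k => D k * t%:C ^+ k) (H (s + t))) ->
  (exists2 r : R, 0 < r & forall s : R, 0 <= s < r -> H s = 0) -> H 1 = 0.
Proof.
move=> ana [r0 r00 H0].
pose S := [set s : R | 0 <= s <= 1 /\ forall s' : R, 0 <= s' <= s -> H s' = 0].
have S0 : S 0.
  split=> [|s' ?]; first by rewrite lexx ler01.
  have -> : s' = 0 by apply/eqP; rewrite eq_le; lra.
  by apply: H0; rewrite lexx.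
have S1 s : S s -> s <= 1 by case=> /andP[].
have hS : has_sup S by split; [exists 0|exists 1].
set sg := sup S.
have sg1 : sg <= 1 by apply: ge_sup => //; exists 0.
have Hlt (s' : R) : 0 <= s' < sg -> H s' = 0.
  move=> /andP[s'0 s's]; have [s [_ hs] lts] : exists2 s, S s & s' < s.
    have e0 : 0 < sg - s' by rewrite subr_gt0.
    by have [s Ss] := sup_adherent e0 hS; rewrite subKr => lt; exists s.
  by apply: hs; rewrite s'0 ltW.
pose m := Num.min (r0 / 2) 1.
have m0 : 0 < m by rewrite lt_min ltr01 andbT; lra.
have sg0 : 0 < sg.
  apply: (lt_le_trans m0); apply: sup_ubound => //; first by case: hS.
  split=> [|s' /andP[s'0 s'm]]; first by rewrite (ltW m0) ge_min lexx orbT.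
  apply: H0; rewrite s'0 /=; apply: le_lt_trans s'm _.
  by rewrite gt_min; apply/orP; left; lra.
have sg01 : 0 <= sg <= 1 by rewrite sg1 ltW.
have [r [D [r_0 hD]]] := ana _ sg01.
have D0 k : D k = 0.
  (* At the supremum H is known to vanish only on the left; alternating the signs of the
     coefficients turns this into vanishing at positive arguments. *)
  pose D' k := D k * (-1) ^+ k.
  have DE t : (fun k => D k * (- t)%:C ^+ k) = (fun k => D' k * t%:C ^+ k).
    by apply/funext => j; rewrite /D' -mulrA -exprMn mulN1r rmorphN.
  have r10 : 0 < Num.min r sg by rewrite lt_min r_0.
  have /(_ k)/eqP : forall k, D' k = 0.
    apply: (series_eq0 r10) => [|s /andP[s0]].
      rewrite -DE; have /hD[] // : `|- Num.min r sg| <= r.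
      by rewrite normrN gtr0_norm // ge_min lexx.
    rewrite lt_min => /andP[sr ssg]; rewrite -DE.
    have /hD[_ ->] : `|- s| <= r by rewrite normrN gtr0_norm // ltW.
    by apply: Hlt; lra.
  by rewrite /D' mulf_eq0 signr_eq0 orbF => /eqP.
have Hr t : `|t| <= r -> H (sg + t) = 0.
  move=> /hD [_ <-]; rewrite -[RHS](csums0 R nat).2; congr csum.
  by apply/funext => k; rewrite D0 mul0r.
have [sg1'|sg1'] := eqVneq sg 1.
  by rewrite -sg1' -(addr0 sg); apply: Hr; rewrite normr0 ltW.
have sglt : sg < 1 by rewrite lt_neqAle sg1'.
pose s1 := Num.min 1 (sg + r).
have : s1 <= sg.
  apply: sup_ubound; first by case: hS.
  split; first by rewrite ge_min lexx /= le_min ler01 /=; lra.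
  move=> s' /andP[s'0]; rewrite le_min => /andP[_ s'r].
  have [lt|ge] := ltP s' sg; first by apply: Hlt; rewrite s'0.
  have -> : s' = sg + (s' - sg) by lra.
  by apply: Hr; rewrite ger0_norm; lra.
by rewrite ge_min => /orP[] h; exfalso; lra.
Qed.

Lemma csums_binomial (a u : C) m :
  csums (fun k => 'C(m, k)%:R * a ^+ (m - k) * u ^+ k) ((a + u) ^+ m).
Proof.
rewrite exprDn.
have -> : \sum_(i < m.+1) a ^+ (m - i) * u ^+ i *+ 'C(m, i) =
  \sum_(k <- iota 0 m.+1) 'C(m, k)%:R * a ^+ (m - k) * u ^+ k.
  rewrite -[iota 0 _]/(index_iota 0 m.+1) big_mkord.
  by apply: eq_bigr => i _; rewrite -mulr_natl mulrA.
apply: csums_fin; first exact: iota_uniq.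
by move=> k; rewrite mem_iota add0n /= ltnS -ltnNge => /bin_small ->; rewrite !mul0r.
Qed.

End Series1.

(** * Power series in several variables and uniqueness of continuation *)

Section SeriesN.
Variable R : realType.
Local Notation C := R[i].
Variable n : nat.
Implicit Types (c d : expv n -> C) (z w a : Cn R n).

Definition setl (l : 'I_n) (k : nat) (b : expv n) : expv n :=
  [ffun i => if i == l then k else b i].

Lemma setlK l (e : expv n) : setl l (e l) (setl l 0 e) = e.
Proof. by apply/ffunP => i; rewrite !ffunE; case: eqP => [->|]. Qed.

Lemma setl_setl l k k' (b : expv n) : setl l k (setl l k' b) = setl l k b.
Proof. by apply/ffunP => i; rewrite !ffunE; case: eqP. Qed.

Lemma setl_id l (b : expv n) k : b l = k -> setl l k b = b.
Proof. by move=> <-; apply/ffunP => i; rewrite ffunE; case: eqP => [->|]. Qed.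

(** Splits off the exponent of variable l. Vectors with zero l-th entry are not given a type of
    their own: the other vectors stay in the index set with value 0. *)
Lemma csums_setl (l : 'I_n) (F : expv n -> C) s :
  csums F s <->
  csums (fun x : expv n * nat => if x.1 l == 0%N then F (setl l x.2 x.1) else 0) s.
Proof.
pose phi (e : expv n) := (setl l 0 e, e l).
have iphi : injective phi by move=> e e' [h1 h2]; rewrite -(setlK l e) h1 h2 setlK.
rewrite -(csums_inj s iphi) => [|[b k] out /=]; last first.
  case: eqP => // b0; have := out (setl l k b).
  rewrite /phi setl_setl (setl_id b0) ffunE eqxx eqxx //.
by split; apply: eq_csums => e; rewrite /phi /= ffunE !eqxx setlK.
Qed.

Lemma pterm_setl (l : 'I_n) c z k (b : expv n) :
  pterm c z (setl l k b) =
  c (setl l k b) * (\prod_(i < n | i != l) z 0 i ^+ b i) * z 0 l ^+ k.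
Proof.
rewrite /pterm (bigD1 l) //= ffunE eqxx mulrCA mulrC; congr (_ * _ * _).
by apply: eq_bigr => i /negPf il; rewrite ffunE il.
Qed.

(** The coefficient of z_l^k, as a series in the other variables that is still indexed by all
    exponent vectors. *)
Definition slice (l : 'I_n) k c : expv n -> C :=
  fun b => if b l == 0%N then c (setl l k b) else 0.

Lemma pterm_slice (l : 'I_n) k c z (b : expv n) : pterm (slice l k c) z b =
  if b l == 0%N then c (setl l k b) * \prod_(i < n | i != l) z 0 i ^+ b i else 0.
Proof.
rewrite /pterm /slice; case: eqP => [b0|_]; last by rewrite mul0r.
by congr (_ * _); rewrite (bigD1 l) //= b0 mul1r.
Qed.

Definition vanishing c := exists2 r : R, 0 < r &
  forall z, (forall i, normc (z 0 i) < r) -> csums (pterm c z) 0.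

(** With the other variables frozen, the sum is a power series in z_l = t that vanishes for small
    positive t, so each of its coefficients does. *)
Lemma vanishing_slice l k c : vanishing c -> vanishing (slice l k c).
Proof.
move=> [r r0 h]; exists r => // z hz.
pose zt (t : R) : Cn R n := \row_i if i == l then t%:C else z 0 i.
have hzt t : 0 < t < r -> csums (fun x : nat * expv n =>
    pterm (slice l x.1 c) z x.2 * t%:C ^+ x.1) 0.
  move=> /andP[t0 tr]; have /h/(csums_setl l)/csums_swap :
      forall i, normc (zt t 0 i) < r.
    by move=> i; rewrite mxE; case: eqP => // _; rewrite normc_real gtr0_norm.
  apply: eq_csums => -[j b] /=; rewrite pterm_slice; case: eqP => // _; last first.
    by rewrite mul0r.
  rewrite pterm_setl mxE eqxx; congr (_ * _ * _); apply: eq_bigr => i /negPf il.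
  by rewrite mxE il.
have r2 : 0 < r / 2 < r by lra.
have row j : csummable (pterm (slice l j c) z).
  have [/(@csummable_row _ _ _ _ j) /= sj _] := hzt _ r2.
  have [+ _] := csumsZr ((r / 2)%:C ^- j) (csumsP sj); congr csummable.
  apply/funext => b; rewrite mulfK // expf_neq0 // eq_complex /= eqxx andbT.
  by rewrite gt_eqF //; case/andP: r2.
split; first exact: row.
have r20 : 0 < r / 2 by lra.
have sk t : 0 < t < r ->
    csums (fun j => csum (pterm (slice l j c) z) * t%:C ^+ j) 0.
  move=> /hzt hs; apply: (csums_pair hs) => j /=.
  by have [_ ->] := csumsZr (t%:C ^+ j) (csumsP (row j)).
apply: (@series_eq0 R (fun j => csum (pterm (slice l j c) z)) _ r20 _ _ k) => [|t /andP[t0 tr]].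
  by case: (sk _ r2).
by case: (sk t) => //; lra.
Qed.

(** Slicing reduces the exponent e to 0 one variable at a time, and the coefficient at 0 is the
    value at the origin. The list [s] in the induction contains the variables whose exponent may
    still be nonzero. *)
Lemma vanishing_eq0 c : vanishing c -> c = fun=> 0.
Proof.
move=> h; apply/funext => e.
suff H (s : seq 'I_n) c' : vanishing c' ->
    (forall i, i \notin s -> e i = 0%N) -> c' e = 0.
  by apply: (H (enum 'I_n)) => // i; rewrite mem_enum.
elim: s e c' {h c} => [|l s IH] e c [r r0 h] e0.
  have /h : forall i, normc ((0 : Cn R n) 0 i) < r by move=> i; rewrite mxE normc0.
  have eE : e = 0 by apply/ffunP => i; rewrite ffunE; exact: e0.
  move=> [_ <-]; rewrite (_ : c e = pterm c 0 e).
    symmetry; apply: (csums_single _).2 => b be; rewrite /pterm.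
    have [i bi] : exists i, b i != 0%N.
      apply/existsP; apply: contra_neqT be; rewrite negb_exists => /forallP b0.
      by rewrite eE; apply/ffunP => i; rewrite ffunE; have := b0 i; rewrite negbK => /eqP.
    by rewrite (bigD1 i) //= mxE expr0n (negPf bi) mul0r mulr0.
  by rewrite /pterm eE big1 ?mulr1 // => i _; rewrite ffunE expr0.
have := IH (setl l 0 e) _ (vanishing_slice l (e l) (ex_intro2 _ _ r r0 h)).
rewrite /slice ffunE eqxx /= setlK; apply => i; rewrite ffunE.
case: eqP => // /eqP il ins; apply: e0; by rewrite inE negb_or il.
Qed.

Lemma expansionP (F : Cn R n -> C) a c : expansion F a c <->
  exists2 r : R, 0 < r &
    forall u : Cn R n, (forall i, normc (u 0 i) < r) -> csums (pterm c u) (F (a + u)).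
Proof.
split=> [/near_CnP[r r0 h]|[r r0 h]].
  exists r => // u hu; have [] := h (a + u).
    by move=> i; rewrite !mxE addrAC subrr add0r; exact: hu.
  by rewrite /psummable addrAC subrr add0r => ? ->.
apply/near_CnP; exists r => // z hz; have [] := h (z - a).
  by move=> i; have := hz i; rewrite !mxE.
by rewrite [a + _]addrC subrK => ? <-.
Qed.

Lemma expansion_uniq (F : Cn R n -> C) a c d :
  expansion F a c -> expansion F a d -> c = d.
Proof.
move=> /expansionP[r r0 h] /expansionP[r' r0' h'].
suff /vanishing_eq0 E : vanishing (fun e => c e - d e).
  by apply/funext => e; have /eqP := congr1 (fun f => f e) E; rewrite subr_eq0 => /eqP.
exists (Num.min r r') => [|u hu]; first by rewrite lt_min r0.
have := csumsB (h u _) (h' u _); rewrite subrr => H.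
apply: eq_csums (H _ _) => [e|i|i].
- by rewrite /pterm mulrBl.
- by apply: lt_le_trans (hu i) _; rewrite ge_min lexx.
- by apply: lt_le_trans (hu i) _; rewrite ge_min lexx orbT.
Qed.

Lemma taylorE (F : Cn R n -> C) c : expansion F 0 c -> taylor F = c.
Proof.
move=> h; apply: (@expansion_uniq F 0); last exact: h.
exact: (@xgetPex _ _ [set c | expansion F 0 c] (ex_intro _ c h)).
Qed.

(** Grouping the terms by total degree gives a one-variable series along the ray through w. *)
Lemma psum_radial c w (t0 : R) : 0 < t0 -> psummable c (t0%:C *: w) ->
  exists D : nat -> C, forall t : R, `|t| <= t0 ->
    csums (fun k => D k * t%:C ^+ k) (psum c (t%:C *: w)).
Proof.
move=> t00 sc; pose W e := c e * \prod_(i < n) w 0 i ^+ e i.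
pose deg (e : expv n) := (\sum_(i < n) e i)%N.
have ptE (t : R) e : pterm c (t%:C *: w) e = W e * t%:C ^+ deg e.
  rewrite /pterm /W -mulrA; congr (_ * _); rewrite /deg -prodrXr -big_split.
  by apply: eq_bigr => i _; rewrite mxE exprMn mulrC.
pose a (t : R) (x : nat * expv n) := if deg x.2 == x.1 then W x.2 * t%:C ^+ x.1 else 0.
pose phi (e : expv n) := (deg e, e).
have iphi : injective phi by move=> e e' [].
have st t : `|t| <= t0 -> csums (a t) (psum c (t%:C *: w)).
  move=> tt; apply/(csums_inj _ iphi) => [[k e] out|].
    by rewrite /a /=; case: eqP => // ke; have := out e; rewrite /phi ke eqxx.
  split; last by congr csum; apply/funext => e; rewrite /a /= eqxx ptE.
  apply: csummable_le (_ : rsummable (fun e => normc (pterm c (t0%:C *: w) e))) => [e|//].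
  rewrite /a /= eqxx ptE !(normcM (W e)) !normcX !normc_real ler_wpM2l ?normc_ge0 //.
  by rewrite lerXn2r ?nnegrE // (gtr0_norm t00).
have nt00 : t0%:C != 0 by rewrite eq_complex /= gt_eqF.
pose D k := csum (fun e => if deg e == k then W e else 0).
have rowD k : csummable (fun e => if deg e == k then W e else 0).
  have t0t0 : `|t0| <= t0 by rewrite gtr0_norm.
  have [/(@csummable_row _ _ _ _ k) /= sj _] := st _ t0t0.
  have [+ _] := csumsZr (t0%:C ^- k) (csumsP sj); congr csummable.
  apply/funext => e; rewrite /a /=; case: eqP => _; last by rewrite mul0r.
  by rewrite mulfK // expf_neq0.
exists D => t /st hs; apply: (csums_pair hs) => k /=.
have [_ <-] := csumsZr (t%:C ^+ k) (csumsP (rowD k)).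
by congr csum; apply/funext => e; rewrite /a /=; case: eqP; rewrite ?mul0r.
Qed.

Lemma analytic_radial (F : Cn R n -> C) a w : analytic_at F a ->
  exists (r : R) (D : nat -> C), 0 < r /\ forall t : R, `|t| <= r ->
    csums (fun k => D k * t%:C ^+ k) (F (a + t%:C *: w)).
Proof.
move=> [c /expansionP[r r0 h]].
pose M := 1 + \sum_(i < n) normc (w 0 i).
have M1 : 1 <= M by rewrite lerDl sumr_ge0 // => i _; exact: normc_ge0.
have wM i : normc (w 0 i) <= M.
  rewrite /M (bigD1 i) //= addrCA lerDl addr_ge0 // sumr_ge0 // => j _; exact: normc_ge0.
pose t0 := r / (2 * M).
have t00 : 0 < t0 by rewrite divr_gt0 // mulr_gt0 // (lt_le_trans ltr01).
have t0M : t0 * M = r / 2 by rewrite /t0; field; lra.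
have ht t : `|t| <= t0 -> csums (pterm c (t%:C *: w)) (F (a + t%:C *: w)).
  move=> tt; apply: h => i; rewrite !mxE normcM normc_real.
  apply: (@le_lt_trans _ _ (t0 * M)); last by rewrite t0M; lra.
  by apply: ler_pM; rewrite ?normc_ge0.
have [] := ht t0; first by rewrite gtr0_norm.
move=> s0 _; have [D hD] := psum_radial t00 s0.
by exists t0, D; split=> // t tt; have [_ <-] := ht t tt; exact: hD.
Qed.

(** Both star-shaped domains contain the segment from 0 to w. On it the difference of the two
    continuations is real-analytic and vanishes near 0, hence also at the endpoint. *)
Lemma continuation_uniq c w (v v' : C) :
  continuation c w v -> continuation c w v' -> v = v'.
Proof.
move=> [W [F [[oW aF e0] star Ww <-]]] [W' [F' [[oW' aF' e0'] star' Ww' <-]]].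
pose H (s : R) := F (s%:C *: w) - F' (s%:C *: w).
suff : H 1 = 0 by rewrite /H !scale1r => /eqP; rewrite subr_eq0 => /eqP.
apply: analytic_segment_eq0 => [s hs|].
  have [r [D [r0 hD]]] := analytic_radial w (aF _ (star _ _ Ww hs)).
  have [r' [D' [r0' hD']]] := analytic_radial w (aF' _ (star' _ _ Ww' hs)).
  exists (Num.min r r'), (fun k => D k - D' k); split; first by rewrite lt_min r0.
  move=> t; rewrite le_min => /andP[/hD h1 /hD' h2].
  rewrite /H rmorphD scalerDl; apply: eq_csums (csumsB h1 h2) => k.
  by rewrite mulrBl.
have [/expansionP[r r0 h] /expansionP[r' r0' h']] := (e0, e0').
pose M := 1 + \sum_(i < n) normc (w 0 i).
have M1 : 1 <= M by rewrite lerDl sumr_ge0 // => i _; exact: normc_ge0.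
have wM i : normc (w 0 i) <= M.
  rewrite /M (bigD1 i) //= addrCA lerDl addr_ge0 // sumr_ge0 // => j _; exact: normc_ge0.
have m0 : 0 < Num.min r r' by rewrite lt_min r0.
exists (Num.min r r' / M); first by rewrite divr_gt0 // (lt_le_trans ltr01).
move=> s /andP[s0 sr]; rewrite /H.
have hs i : normc ((s%:C *: w) 0 i) < Num.min r r'.
  rewrite !mxE normcM normc_real ger0_norm //.
  apply: (@le_lt_trans _ _ (s * M)); first by rewrite ler_wpM2l.
  by rewrite -ltr_pdivlMr // (lt_le_trans ltr01).
have [] := h (s%:C *: w).
  by move=> i; apply: lt_le_trans (hs i) _; rewrite ge_min lexx.
have [] := h' (s%:C *: w).
  by move=> i; apply: lt_le_trans (hs i) _; rewrite ge_min lexx orbT.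
by rewrite !add0r => _ <- _ <-; rewrite subrr.
Qed.

Lemma ext_valE c w v : continuation c w v -> ext_val c w = v.
Proof.
move=> h; apply: (continuation_uniq _ (h)).
exact: (@xgetPex _ 0 [set v | continuation c w v] (ex_intro _ v h)).
Qed.

(** By the binomial theorem for the norms, the norms in the row of e sum to |c e| times the product
    of the (|x_i| + |y_i|)^(e_i). *)
Lemma csummable_binomial c (x y : 'I_n -> C) :
  rsummable (fun e => normc (c e) * \prod_i (normc (x i) + normc (y i)) ^+ e i) ->
  csummable (fun p : expv n * expv n => c p.1 *
    \prod_i ('C(p.1 i, p.2 i)%:R * x i ^+ (p.1 i - p.2 i) * y i ^+ p.2 i)).
Proof.
move=> sc; apply: (csummable_pair _ _ sc) => e /=.
  have := csums_ffun (fun i => csums_binomial (x i) (y i) (e i)).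
  by move=> /(csumsZ (c e)) [].
(* Norms are viewed as complex numbers so that the complex binomial identity applies to them. *)
pose N (z : C) := (normc z)%:C.
have E := csums_ffun (fun i => csums_binomial (N (x i)) (N (y i)) (e i)).
have := csumsZ (N (c e)) E => -[_].
set A := (fun b => _); have -> : A = fun b : expv n => (normc (c e *
   \prod_i ('C(e i, b i)%:R * x i ^+ (e i - b i) * y i ^+ b i)))%:C.
  apply/funext => b; rewrite /A normcM rmorphM; congr (_ * _).
  rewrite normc_prod rmorph_prod; apply: eq_bigr => i _.
  rewrite !normcM !normcX !rmorphM !rmorphXn /=; congr (_ * _ * _).
  by rewrite -(rmorph_nat (real_complex R)) normc_real ger0_norm.
rewrite rsum_csum (_ : N (c e) * _ =
  (normc (c e) * \prod_i (normc (x i) + normc (y i)) ^+ e i)%:C).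
  by move=> /complexI ->.
rewrite rmorphM rmorph_prod; congr (_ * _); apply: eq_bigr => i _.
by rewrite rmorphXn rmorphD.
Qed.

(** Recentring: (a + u)^e is expanded binomially and the order of summation exchanged, which is
    legitimate as long as |a_i| + |u_i| stays below [rho i]. *)
Lemma analytic_psum c a (rho : 'I_n -> R) (r : R) : 0 < r ->
  (forall i, normc (a 0 i) + r <= rho i) ->
  rsummable (fun e => normc (c e) * \prod_i rho i ^+ e i) ->
  analytic_at (psum c) a.
Proof.
move=> r0 ar sc.
pose G (u : Cn R n) (p : expv n * expv n) := c p.1 *
  \prod_i ('C(p.1 i, p.2 i)%:R * a 0 i ^+ (p.1 i - p.2 i) * u 0 i ^+ p.2 i).
have sG (u : Cn R n) : (forall i, normc (u 0 i) < r) -> csummable (G u).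
  move=> ur; apply: (csummable_binomial (x := fun i => a 0 i) (y := fun i => u 0 i)).
  have nn i : 0 <= normc (a 0 i) + normc (u 0 i) by rewrite addr_ge0 ?normc_ge0.
  have rho0 i : 0 <= rho i.
    by apply: le_trans (ar i); rewrite addr_ge0 ?normc_ge0 // ltW.
  apply: rsummable_le sc => e.
  have p0 : 0 <= \prod_i (normc (a 0 i) + normc (u 0 i)) ^+ e i.
    by rewrite prodr_ge0 // => i _; rewrite exprn_ge0.
  have p1 : 0 <= \prod_i rho i ^+ e i.
    by rewrite prodr_ge0 // => i _; rewrite exprn_ge0.
  rewrite !ger0_norm ?mulr_ge0 ?normc_ge0 //.
  rewrite ler_wpM2l ?normc_ge0 // ler_prod // => i _; rewrite exprn_ge0 //=.
  have h : normc (a 0 i) + normc (u 0 i) <= rho i.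
    by apply: le_trans (ar i); rewrite lerD2l ltW.
  by rewrite lerXn2r ?nnegrE // (le_trans (nn i)).
pose D (b : expv n) := csum (fun e : expv n => c e *
  \prod_i ('C(e i, b i)%:R * a 0 i ^+ (e i - b i))).
have GE (u : Cn R n) (e b : expv n) : G u (e, b) =
    (c e * \prod_i ('C(e i, b i)%:R * a 0 i ^+ (e i - b i))) * \prod_i u 0 i ^+ b i.
  by rewrite /G /= -mulrA -big_split.
(* A point of the polydisc with nonzero coordinates: dividing by its monomials yields summability of
   the series defining each new coefficient. *)
pose u0 : Cn R n := const_mx (r / 2)%:C.
have u0r i : normc (u0 0 i) < r by rewrite mxE normc_real gtr0_norm; lra.
have sD (b : expv n) : csummable (fun e : expv n => c e *
    \prod_i ('C(e i, b i)%:R * a 0 i ^+ (e i - b i))).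
  have [h0 _] := csums_swap (csumsP (sG _ u0r)); have h := csummable_row b h0.
  have [+ _] := csumsZr (\prod_i u0 0 i ^+ b i)^-1 (csumsP h); congr csummable.
  apply/funext => e; rewrite GE mulfK // prodf_seq_neq0; apply/allP => i _ /=.
  by rewrite expf_neq0 // mxE eq_complex /= eqxx andbT gt_eqF //; lra.
exists D; apply/near_CnP; exists r => // z hz.
have ur i : normc ((z - a) 0 i) < r by have := hz i; rewrite !mxE.
have h1 := csums_swap (csumsP (sG _ ur)).
have h2 : csums (pterm D (z - a)) (csum (G (z - a))).
  apply: (csums_pair h1) => b; rewrite /pterm.
  have [_ <-] := csumsZr (\prod_i (z - a) 0 i ^+ b i) (csumsP (sD b)).
  by congr csum; apply/funext => e; rewrite /= GE.
split; first by case: h2.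
rewrite /psum; case: h2 => _ ->; symmetry.
have h3 : csums (pterm c z) (csum (G (z - a))).
  apply: (csums_pair (csumsP (sG _ ur))) => e; rewrite /G /pterm /=.
  have := csums_ffun (fun i => csums_binomial (a 0 i) ((z - a) 0 i) (e i)).
  move=> /(csumsZ (c e)) [_ ->]; congr (_ * _); apply: eq_bigr => i _.
  by rewrite !mxE addrCA subrr addr0.
by case: h3.
Qed.

Definition entire_coef c := forall rho : 'I_n -> R, (forall i, 0 <= rho i) ->
  rsummable (fun e => normc (c e) * \prod_i rho i ^+ e i).

Lemma psummable_entire c z : entire_coef c -> psummable c z.
Proof.
move=> ec; apply: csummable_le (ec (fun i => normc (z 0 i)) _) => [e|i].
  by rewrite normcM normc_prod; under [X in _ * X <= _]eq_bigr do rewrite normcX.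
exact: normc_ge0.
Qed.

Lemma entire_psum c : entire_coef c -> entire (psum c).
Proof.
move=> ec a; apply: (@analytic_psum _ _ (fun i => normc (a 0 i) + 1) 1) => //.
by apply: ec => i; rewrite addr_ge0 ?normc_ge0.
Qed.

Lemma expansion_psum c : entire_coef c -> expansion (psum c) 0 c.
Proof.
move=> ec; apply/near_CnP; exists 1 => // z _; rewrite subr0.
by split=> //; exact: psummable_entire.
Qed.

Lemma continuation_entire c w : entire_coef c -> continuation c w (psum c w).
Proof.
move=> ec; exists [set: Cn R n], (psum c); split=> //; split=> [|a _|].
- exact: openT.
- exact: entire_psum.
- exact: expansion_psum.
Qed.

End SeriesN.
(** * The lattice order integral of q-twisted products *)

Section LatticeIntegral.
Variable R : realType.
Local Notation C := R[i].

Definition ser (h : nat -> C) (z : C) : C := csum (fun k => h k * z ^+ k).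

Definition entire_coef1 (h : nat -> C) := forall rho : R, 0 <= rho ->
  rsummable (fun k => normc (h k) * rho ^+ k).

Definition delta0 : nat -> C := fun k => (k == 0%N)%:R.

Lemma csums_ser (h : nat -> C) z : entire_coef1 h -> csums (fun k => h k * z ^+ k) (ser h z).
Proof.
move=> eh; split=> //; apply: csummable_le (eh (normc z) (normc_ge0 z)) => k.
by rewrite normcM normcX.
Qed.

Lemma entire_delta0 : entire_coef1 delta0.
Proof.
move=> rho rho0; apply: (@rsum_fin _ _ _ [:: 0%N] _ _).1 => // k.
by rewrite inE /delta0 => /negPf ->; rewrite normc0 mul0r.
Qed.

Variables (q : R) (hq : 0 < q < 1) (n : nat).

Let q0 : 0 < q. Proof. by case/andP: hq. Qed.
Let qn0 : q != 0. Proof. by rewrite gt_eqF. Qed.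

Local Notation tw := (@twist n (fun i j : 'I_n => (j < i)%N)).

(* Families of this shape are stable under the lattice integrals: integrating
   out [z_l] multiplies [K] by a moment of [h l], replaces [h l] by [delta0] and
   shifts the exponents [nu]; see [lat_step]. *)
Definition aform (K : C) (nu : 'I_n -> int) (h : 'I_n -> nat -> C) : expv n -> C :=
  fun a => K * (q ^+ tw a a)%:C * \prod_i ((q ^ (nu i * (a i)%:Z))%:C * h i (a i)).

Lemma entire_aform K nu h : (forall i, entire_coef1 (h i)) ->
  entire_coef (aform K nu h).
Proof.
move=> eh rho rho0.
have sP : rsummable (fun e : expv n =>
    \prod_i (normc (h i (e i)) * (q ^ nu i * rho i) ^+ e i)).
  apply: (@rsummable_ffun R nat n (fun i k => normc (h i k) * (q ^ nu i * rho i) ^+ k)) => i.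
  by apply: eh; rewrite mulr_ge0 // exprz_ge0 // ltW.
apply: rsummable_le (rsummableZ (normc K) sP) => e.
have p0 : 0 <= \prod_i rho i ^+ e i.
  by rewrite prodr_ge0 // => i _; rewrite exprn_ge0.
have p1 : 0 <= \prod_i (normc (h i (e i)) * (q ^ nu i * rho i) ^+ e i).
  rewrite prodr_ge0 // => i _; rewrite mulr_ge0 ?normc_ge0 // exprn_ge0 //.
  by rewrite mulr_ge0 // exprz_ge0 // ltW.
rewrite !ger0_norm ?mulr_ge0 ?normc_ge0 //.
rewrite /aform !normcM -!mulrA ler_wpM2l ?normc_ge0 //.
have -> : \prod_i (normc (h i (e i)) * (q ^ nu i * rho i) ^+ e i) =
    normc (\prod_i ((q ^ (nu i * e i))%:C * h i (e i))) * \prod_i rho i ^+ e i.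
  rewrite normc_prod -big_split; apply: eq_bigr => i _ /=.
  rewrite normcM normc_real ger0_norm ?exprz_ge0 ?(ltW q0) // exprMn.
  by rewrite [(q ^ nu i) ^+ _]exprnP exprz_exp; ring.
(* Here q < 1 is used: the quadratic twist can only improve convergence. *)
have Q : normc (q ^+ tw e e)%:C <= 1.
  have [h0 /ltW h1] := andP hq.
  by rewrite normc_real ger0_norm ?exprn_ge0 ?exprn_ile1 ?(ltW h0).
by rewrite -[leRHS]mul1r ler_wpM2r ?mulr_ge0 ?normc_ge0.
Qed.

(** Each other variable contributes one crossing with z_l, on whichever side of l it stands. The
    k-dependence is therefore q^(k |b|), a dilation of z_l by q^|b|. *)
Lemma twist_setl (l : 'I_n) k (b : expv n) : b l = 0%N ->
  tw (setl l k b) (setl l k b) = (tw b b + k * \sum_(i < n) b i)%N.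
Proof.
move=> bl; pose u : expv n := [ffun i => if i == l then k else 0%N].
have -> : setl l k b = b + u.
  apply/ffunP => i; rewrite !ffunE; case: eqP => [->|_]; first by rewrite bl.
  by symmetry; exact: addn0.
rewrite !twistDl !twistDr.
have -> : tw u u = 0%N.
  rewrite /twist big1 // => i _; rewrite big1 // => j ji; rewrite !ffunE.
  by case: eqP ji => [->|_]; case: eqP => [->|_]; rewrite ?ltnn ?muln0.
rewrite addn0 -addnA; congr (_ + _)%N.
have -> : tw b u = (\sum_(i < n | l < i) k * b i)%N.
  rewrite /twist [RHS]big_mkcond; apply: eq_bigr => i _; rewrite big_mkcond /=.
  rewrite (bigD1 l) //= big1 ?addn0 => [|j /negPf jl]; last by rewrite ffunE jl muln0 if_same.
  by rewrite ffunE eqxx mulnC.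
have -> : tw u b = (\sum_(i < n | i < l) k * b i)%N.
  rewrite /twist (bigD1 l) //= [X in (_ + X)%N]big1 ?addn0 => [|i /negPf il].
    by apply: eq_bigr => j _; rewrite ffunE eqxx.
  by rewrite big1 // => j _; rewrite ffunE il mul0n.
rewrite big_distrr /= [RHS](bigID (fun i : 'I_n => (l < i)%N)) /=; congr (_ + _)%N.
rewrite [RHS](bigD1 l) ?ltnn //= bl muln0 add0n.
by apply: eq_bigl => i; rewrite -leqNgt ltn_neqAle andbC; congr (_ && _).
Qed.

Lemma even_aform K nu h : (forall i k, odd k -> h i k = 0) ->
  even_part (aform K nu h) = aform K nu h.
Proof.
move=> eh; apply/funext => e; rewrite /even_part; case: ifPn => //.
move=> /forallPn[j]; rewrite negbK => oj.
by rewrite /aform (bigD1 j) //= eh // mulr0 mul0r mulr0.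
Qed.

Definition lat_moment (h : nat -> C) : C := jackson q 1 (fun t => ser h t%:C).

(** The 1 undoes the Jacobian q^|b| of the dilation of z_l; the extra 1 for i < l is the
    substitution w_i = q^(-1) z_i in the lattice integral. *)
Definition lat_step_nu (l : 'I_n) (nu : 'I_n -> int) : 'I_n -> int :=
  fun i => nu i - (1 + (i < l)%N)%:Z.

Definition lat_step_h (l : 'I_n) (h : 'I_n -> nat -> C) : 'I_n -> nat -> C :=
  fun i => if i == l then delta0 else h i.

Variable gamma : 'I_n -> R.

Lemma lat_funE l K nu h z t : (forall i, entire_coef1 (h i)) ->
  (forall i k, odd k -> h i k = 0) ->
  lat_fun q l (aform K nu h) z t = psum (aform K nu h) (lat_subst q l z t).
Proof.
move=> eh ev; rewrite /lat_fun even_aform //.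
by apply: ext_valE; apply: continuation_entire; exact: entire_aform.
Qed.

(** The factor q^(nu l + |b|) set apart on the right is the one that the weights of the Jackson sum
    need for the dilation of t; its inverse is absorbed by the new constant and the new
    exponents. *)
Lemma pterm_step (l : 'I_n) K nu h (z : Cn R n) (t : R) k (b : expv n) : b l = 0%N ->
  pterm (aform K nu h) (lat_subst q l z t) (setl l k b) =
  pterm (aform (K * (q ^ (- nu l))%:C) (lat_step_nu l nu) (lat_step_h l h)) z b *
  (q ^ (nu l + (\sum_(i < n) b i)%N%:Z))%:C *
  (h l k * ((q ^ (nu l + (\sum_(i < n) b i)%N%:Z) * t)%:C) ^+ k).
Proof.
move=> bl; rewrite pterm_setl /pterm /aform twist_setl //.
rewrite [in LHS](bigD1 (R := C) l) //= ffunE eqxx.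
rewrite [X in _ = _ * _ * X * _ * _ * _](bigD1 l) //= bl mulr0 expr0z.
rewrite /lat_step_h eqxx [delta0 0]/(1%R) mulr1 mul1r.
rewrite [\prod_(i < n) z 0 i ^+ _](bigD1 l) //= bl expr0 mul1r.
rewrite !mxE ltnn eqxx.
have -> : \prod_(i < n | i != l) ((q ^ (nu i * (setl l k b i)%:Z))%:C * h i (setl l k b i)) =
    \prod_(i < n | i != l) ((q ^ (nu i * (b i)%:Z))%:C * h i (b i)).
  by apply: eq_bigr => i /negPf il; rewrite ffunE il.
have E : \prod_(i < n | i != l) ((q ^ (lat_step_nu l nu i * (b i)%:Z))%:C *
       (if i == l then delta0 else h i) (b i)) *
     \prod_(i < n | i != l) z 0 i ^+ b i * (q ^ (\sum_(i < n) b i)%N%:Z)%:C =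
    \prod_(i < n | i != l) ((q ^ (nu i * (b i)%:Z))%:C * h i (b i)) *
    \prod_(i < n | i != l) lat_subst q l z t 0 i ^+ b i.
  have -> : (q ^ (\sum_(i < n) b i)%N%:Z)%:C =
      \prod_(i < n | i != l) (q ^+ b i)%:C :> C.
    rewrite -exprnP [in LHS](bigD1 l) //= bl add0n -prodrXr rmorph_prod.
    by apply: eq_bigr.
  rewrite -!big_split; apply: eq_bigr => i il /=.
  rewrite (negPf il) mxE (negPf il) /lat_step_nu.
  case: (ltnP i l) => _ /=.
    rewrite exprMn mulrA -[in RHS]mulrA [_ * (_ ^+ _)]mulrC.
    have -> : (nu i - (1 + 1)%:Z) * (b i)%:Z = nu i * (b i)%:Z + - (b i)%:Z + - (b i)%:Z by lia.
    rewrite !expfzDr // !rmorphM /=.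
    rewrite -rmorphXn /= exprVn -exprnN.
    have qb : (q ^- b i)%:C * (q ^+ b i)%:C = 1 :> C.
      by rewrite -rmorphM mulVf ?expf_neq0.
    rewrite -[RHS]mulr1 -qb; ring.
  have -> : (nu i - (1 + 0)%:Z) * (b i)%:Z = nu i * (b i)%:Z + - (b i)%:Z by lia.
  rewrite !expfzDr // !rmorphM /=.
  rewrite -exprnN; have qb : (q ^- b i)%:C * (q ^+ b i)%:C = 1 :> C.
    by rewrite -rmorphM mulVf ?expf_neq0.
  by rewrite -[RHS]mulr1 -qb; ring.
have qnu : (q ^ (- nu l))%:C * (q ^ nu l)%:C = 1 :> C.
  by rewrite -rmorphM -expfzDr // addNr expr0z.
rewrite expfzDr // !rmorphM /= exprD rmorphM /= -exprnP.
have -> : (q ^ (nu l * k%:Z))%:C = (q ^ nu l)%:C ^+ k :> C.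
  by rewrite -rmorphXn [(q ^ nu l) ^+ k]exprnP exprz_exp.
have -> : (q ^+ (k * \sum_(i < n) b i))%:C = (q ^+ (\sum_(i < n) b i))%:C ^+ k :> C.
  by rewrite -rmorphXn -exprM mulnC.
move: E; rewrite -exprnP => E.
rewrite !exprMn; move: E.
set P := \prod_(i < n | i != l) _; set P1 := \prod_(i < n | i != l) _.
set P2 := \prod_(i < n | i != l) _; set P3 := \prod_(i < n | i != l) _ => E.
transitivity (K * (q ^+ tw b b)%:C * (q ^+ (\sum_(i < n) b i))%:C ^+ k *
  (q ^ nu l)%:C ^+ k * h l k * t%:C ^+ k * (P2 * P3) *
  ((q ^ (- nu l))%:C * (q ^ nu l)%:C)); first by rewrite qnu; ring.
by rewrite -E; ring.
Qed.

Lemma lat_ptE (m c : R) (x : int * bool) : lat_pt q (m * c) x = m * lat_pt q c x.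
Proof. by rewrite /lat_pt; ring. Qed.

Lemma even_sum (b : expv n) : (forall i, ~~ odd (b i)) -> ~~ odd (\sum_(i < n) b i).
Proof.
by move=> h; elim/big_ind: _ => // x y hx hy; rewrite oddD (negPf hx) (negPf hy).
Qed.

(** On the support of the series |b| is even, so the dilated lattice of every b is again q^(2Z). All
    rows are then shifts of one family, with the same sum, and the integral factors. *)
Lemma lat_step (l : 'I_n) K nu h (m : int) :
  (forall i, entire_coef1 (h i)) -> (forall i k, odd k -> h i k = 0) ->
  jackson_integrable q 1 (fun t => ser (h l) t%:C) ->
  gamma l * q ^ (nu l) = q ^ (2 * m) ->
  let c := aform K nu h in
  let c' := aform (K * (q ^ (- nu l))%:C * lat_moment (h l))
    (lat_step_nu l nu) (lat_step_h l h) in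
  [/\ forall z t, continuable (even_part c) (lat_subst q l z t),
      forall z, jackson_integrable q (gamma l) (lat_fun q l c z),
      entire (lat_int q gamma l c) & taylor (lat_int q gamma l c) = c'].
Proof.
move=> eh ev sl gm c c'; have ec : entire_coef c by exact: entire_aform.
have eh' i : entire_coef1 (lat_step_h l h i).
  by rewrite /lat_step_h; case: eqP => // _; exact: entire_delta0.
pose c0 := aform (K * (q ^ (- nu l))%:C) (lat_step_nu l nu) (lat_step_h l h).
have ec0 : entire_coef c0 by exact: entire_aform.
have ec' : entire_coef c' by exact: entire_aform.
pose S := csum (jackson_term q 1 (fun t => ser (h l) t%:C)).
pose Nb (b : expv n) : int := nu l + (\sum_(i < n) b i)%N%:Z.
have c0_supp z (b : expv n) : ~~ [forall i, ~~ odd (b i)] || (b l != 0%N) -> pterm c0 z b = 0.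
  case/orP => [/forallPn[j]|bl].
    rewrite negbK => oj; rewrite /pterm /c0 /aform (bigD1 j) //=.
    have -> : lat_step_h l h j (b j) = 0; last by rewrite mulr0 mul0r mulr0 mul0r.
    rewrite /lat_step_h; case: eqP => _; last exact: ev.
    by rewrite /delta0; case: (b j) oj.
  rewrite /pterm /c0 /aform (bigD1 l) //= /lat_step_h eqxx /delta0 (negPf bl).
  by rewrite mulr0 mul0r mulr0 mul0r.
have rowx z t : csums (fun b => pterm c0 z b * (q ^ Nb b)%:C * ser (h l) (q ^ Nb b * t)%:C)
    (psum c (lat_subst q l z t)).
  have sc := csumsP (psummable_entire (lat_subst q l z t) ec).
  have := (csums_setl l _ _).1 sc => hs; apply: (csums_pair hs) => b /=.
  case: eqP => [bl|/eqP bl]; last first.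
    have -> : pterm c0 z b = 0 by apply: c0_supp; rewrite bl orbT.
    by rewrite !mul0r; exact: (csums0 R nat).2.
  have [_ <-] := csumsZ (pterm c0 z b * (q ^ Nb b)%:C) (csums_ser (q ^ Nb b * t)%:C (eh l)).
  by congr csum; apply/funext => k; rewrite pterm_step.
pose J := jackson_term q 1 (fun t => ser (h l) t%:C).
pose A z (b : expv n) (x : int * bool) := (q ^ (2 * x.1) * gamma l)%:C *
    (pterm c0 z b * (q ^ Nb b)%:C * ser (h l) (q ^ Nb b * lat_pt q (gamma l) x)%:C).
(* If b has an odd entry its row is zero and the identity serves as the shift. *)
have rowE z (b : expv n) : exists2 sh : int * bool -> int * bool, bijective sh &
    A z b = fun x => pterm c0 z b * J (sh x).
  have [evb|nevb] := boolP [forall i, ~~ odd (b i)]; last first.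
    exists id; first by exists id.
    have z0 : pterm c0 z b = 0 by apply: c0_supp; rewrite nevb.
    by apply/funext => x; rewrite /A z0 !mul0r mulr0.
  have [m' em'] : exists m' : int, q ^ Nb b * gamma l = q ^ (2 * m').
    exists (m + ((\sum_(i < n) b i)./2)%:Z); rewrite /Nb expfzDr // mulrAC.
    rewrite [_ * gamma l]mulrC gm -expfzDr // mulrDr; congr (q ^ (_ + _)).
    have : ~~ odd (\sum_(i < n) b i) by apply: even_sum; exact/forallP.
    by move=> /negPf o; rewrite -{1}(odd_double_half (\sum_(i < n) b i)) o add0n; lia.
  exists (fun x => (x.1 + m', x.2)).
    by exists (fun x => (x.1 - m', x.2)) => -[x s]; rewrite /= ?addrK ?subrK.
  apply/funext => -[x s]; rewrite /A /J /jackson_term /= -lat_ptE em'.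
  have -> : lat_pt q (q ^ (2 * m')) (x, s) = lat_pt q 1 (x + m', s).
    by rewrite /lat_pt /= mulrDr expfzDr // mulr1.
  have -> : q ^ (2 * (x + m')) * 1 = q ^ (2 * x) * (q ^ Nb b * gamma l).
    by rewrite em' mulr1 mulrDr expfzDr.
  by rewrite !rmorphM /=; ring.
have rowb z b : csums (A z b) (pterm c0 z b * S).
  have [sh bsh ->] := rowE z b; apply: csumsZ.
  exact: (csums_bij J S bsh).2 (csumsP sl).
(* A shift preserves the sum of the norms, so the row of b has norm sum |term of b| times a constant
   independent of b. This is the absolute convergence that permits exchanging the integral with the
   series. *)
have fam z : csums (fun p => A z p.1 p.2) (psum c0 z * S).
  have s0 := psummable_entire z ec0.
  apply: csums_pair' (csumsZr S (csumsP s0)) => [|b]; last by have [_ ->] := rowb z b.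
  apply: (csummable_pair (b := fun b => rsum (fun x => normc (J x)) * normc (pterm c0 z b))).
  - by move=> b; have [] := rowb z b.
  - move=> b /=; have [sh bsh ->] := rowE z b.
    under eq_fun do rewrite normcM.
    have sJ : rsummable (fun x => normc (J (sh x))).
      by apply: (@rsummable_comp R _ _ sh (fun x => normc (J x))) => //; exact: bij_inj.
    have E : rsum (fun x => normc (J (sh x))) = rsum (fun x => normc (J x)).
      symmetry; apply: (@rsum_inj R _ _ sh (fun x => normc (J x))); first exact: bij_inj.
      by move=> j out; have [sh' _ k] := bsh; have := out (sh' j); rewrite k eqxx.
    rewrite le_eqVlt; apply/orP; left; apply/eqP; apply: etrans (rsumZ (normc (pterm c0 z b)) sJ) _.
    by apply: etrans (mulrC _ _) _; exact: (congr1 (fun x => x * normc (pterm c0 z b)) E).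
  - exact: (@rsummableZ R _ _ (fun b => normc (pterm c0 z b)) s0).
have famJ z : csums (jackson_term q (gamma l) (lat_fun q l c z)) (psum c0 z * S).
  apply: (csums_pair (csums_swap (fam z))) => x /=.
  rewrite /jackson_term lat_funE //.
  have [_ <-] := csumsZ (q ^ (2 * x.1) * gamma l)%:C (rowx z (lat_pt q (gamma l) x)).
  by [].
have jackE : lat_int q gamma l c = psum c'.
  apply/funext => z; rewrite /lat_int /jackson (famJ z).2.
  rewrite mulrCA mulrC; have [_ E] := csumsZ ((1 - q ^+ 2)%:C * S) (csumsP (psummable_entire z ec0)).
  apply: etrans (esym E) _.
  rewrite /psum; congr csum; apply/funext => e; rewrite /pterm /c0 /c' /aform.
  rewrite /lat_moment /jackson -/J -/S.
  ring.
split=> [z t|z||].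
- rewrite /c even_aform //; exists (psum c (lat_subst q l z t)).
  exact: continuation_entire.
- exact: (famJ z).1.
- by rewrite jackE; exact: entire_psum.
- by rewrite jackE; apply: taylorE; exact: expansion_psum.
Qed.

End LatticeIntegral.

(** * Iterated lattice integrals and the choice of gamma *)

Section IteratedLatticeIntegral.
Variable R : realType.
Local Notation C := R[i].
Variables (q : R) (hq : 0 < q < 1) (n : nat).

Let q0 : 0 < q. Proof. by case/andP: hq. Qed.
Let qn0 : q != 0. Proof. by rewrite gt_eqF. Qed.

Local Notation tw := (@twist n (fun i j : 'I_n => (j < i)%N)).

Fixpoint lat_exp (s : seq 'I_n) (nu : 'I_n -> int) : int :=
  if s is l :: s' then - nu l + lat_exp s' (lat_step_nu l nu) else 0.

(** The shifts of [nu] do not depend on [nu], so the accumulated exponent is affine in it. This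
    separates the power of q caused by the monomial from the one caused by the order of
    integration. *)
Lemma lat_expB s (nu mu : 'I_n -> int) :
  lat_exp s (fun i => nu i - mu i) = lat_exp s nu + \sum_(l <- s) mu l.
Proof.
elim: s nu => [|l s IH] nu; first by rewrite big_nil addr0.
rewrite big_cons /= (_ : lat_step_nu l _ = fun i => lat_step_nu l nu i - mu i).
  by rewrite IH; ring.
by apply/funext => i; rewrite /lat_step_nu; ring.
Qed.

Variable gamma : 'I_n -> R.

Fixpoint lat_parity (s : seq 'I_n) (nu : 'I_n -> int) : Prop :=
  if s is l :: s' then
    (exists m : int, gamma l * q ^ (nu l) = q ^ (2 * m)) /\
    lat_parity s' (lat_step_nu l nu)
  else True.

Lemma lat_aform_seq s K nu h : uniq s ->
  (forall i, entire_coef1 (h i)) -> (forall i k, odd k -> h i k = 0) ->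
  (forall i, i \in s -> jackson_integrable q 1 (fun t => @ser R (h i) t%:C)) ->
  lat_parity s nu ->
  lat_integrable_seq q gamma s (aform q K nu h) /\
  lat_value_seq q gamma s (aform q K nu h) =
    K * (q ^ lat_exp s nu)%:C * \prod_(l <- s) lat_moment q (h l) *
    \prod_(i | i \notin s) h i 0%N.
Proof.
elim: s K nu h => [|l s IH] K nu h /=.
  move=> _ _ _ _ _; split=> //; rewrite big_nil expr0z !mulr1 /aform.
  rewrite twist0l mulr1; congr (_ * _); apply: eq_bigr => i _.
  by rewrite ffunE mulr0 expr0z mul1r.
move=> /andP[ls us] eh ev sh [[m gm] par].
have [h1 h2 h3 h4] := @lat_step R q hq n gamma l K nu h m eh ev (sh l (mem_head l s)) gm.
have eh' i : entire_coef1 (lat_step_h l h i).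
  by rewrite /lat_step_h; case: eqP => // _; exact: entire_delta0.
have ev' i k : odd k -> lat_step_h l h i k = 0.
  by rewrite /lat_step_h; case: eqP => _; [case: k|exact: ev].
have sh' i : i \in s -> jackson_integrable q 1 (fun t => ser (lat_step_h l h i) t%:C).
  move=> js; rewrite /lat_step_h; case: eqP => [il|_]; first by rewrite -il js in ls.
  by apply: sh; rewrite inE js orbT.
have [i1 v1] := IH (K * (q ^ (- nu l))%:C * lat_moment q (h l)) _ _ us eh' ev' sh' par.
split; first by split=> //; rewrite ?h4.
rewrite h4 v1 big_cons expfzDr // rmorphM /=.
have -> : \prod_(j <- s) lat_moment q (lat_step_h l h j) = \prod_(j <- s) lat_moment q (h j).
  apply: eq_big_seq => j js; congr lat_moment; rewrite /lat_step_h; case: eqP => [jl|_]; last by [].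
  by exfalso; move: ls; rewrite -jl js.
have -> : \prod_(i | i \notin s) lat_step_h l h i 0%N =
    \prod_(i | i \notin l :: s) h i 0%N.
  rewrite (bigD1 l) //= /lat_step_h eqxx mul1r; apply: eq_big => [i|i /andP[_ /negPf ->] //].
  by rewrite inE negb_or andbC.
ring.
Qed.

Lemma entire_coef0 : @entire_coef R n (fun=> 0).
Proof.
move=> rho _; have := (csums0 R (expv n)).1; rewrite csummableE.
by apply: rsummable_le => e; rewrite normc0 mul0r.
Qed.

Lemma psum0 (z : Cn R n) : psum (fun=> 0) z = 0.
Proof.
rewrite /psum; apply: etrans (csums0 R (expv n)).2; congr csum.
by apply/funext => e; rewrite /pterm mul0r.
Qed.

Lemma lat_step0 l (c : expv n -> C) : even_part c = (fun=> 0) ->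
  [/\ forall z t, continuable (even_part c) (lat_subst q l z t),
      forall z, jackson_integrable q (gamma l) (lat_fun q l c z),
      entire (lat_int q gamma l c) & taylor (lat_int q gamma l c) = fun=> 0].
Proof.
move=> c0.
have lf z : jackson_term q (gamma l) (lat_fun q l c z) = fun=> 0.
  apply/funext => x; rewrite /jackson_term [lat_fun _ _ _ _ _](_ : _ = 0) ?mulr0 //.
  rewrite /lat_fun c0; apply: etrans (psum0 (lat_subst q l z (lat_pt q (gamma l) x))).
  by apply: ext_valE; exact: continuation_entire entire_coef0.
have li : lat_int q gamma l c = psum (fun=> 0).
  apply/funext => z; rewrite psum0 /lat_int /jackson lf.
  by rewrite (csums0 R (int * bool)%type).2 mulr0.
split=> [z t|z||].
- rewrite c0; exists (psum (fun=> 0) (lat_subst q l z t)).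
  exact: continuation_entire entire_coef0.
- by rewrite /jackson_integrable lf; exact: (csums0 R (int * bool)%type).1.
- by rewrite li; exact: entire_psum entire_coef0.
- by rewrite li; apply: taylorE; exact: expansion_psum entire_coef0.
Qed.

(** For monomials of the wrong parity the lattices may miss q^(2Z), but the first integral already
    returns the zero series. *)
Lemma lat_zero_seq l s (c : expv n -> C) : even_part c = (fun=> 0) ->
  lat_integrable_seq q gamma (l :: s) c /\ lat_value_seq q gamma (l :: s) c = 0.
Proof.
elim: s l c => [|l' s IH] l c c0; have [h1 h2 h3 h4] := lat_step0 l c0.
  by split; [split|rewrite /= h4].
have c00 : @even_part R n (fun=> 0) = fun=> 0.
  by apply/funext => e; rewrite /even_part if_same.
have [i1 v1] := IH l' _ c00; split; last by rewrite -v1 -h4.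
have i2 : lat_integrable_seq q gamma (l' :: s) (taylor (lat_int q gamma l c)) by rewrite h4.
exact: And4 (fun z x => h1 z _) h2 h3 i2.
Qed.

(** Before step k the exponent of variable [sigma k] has dropped by 1 for each j < k, and once more
    for each j < k with [sigma j] above [sigma k]. The exponent in gamma restores exactly these
    losses and leaves nu + B, which is even. *)
Lemma lat_parity_perm (sigma : 'S_n) (B : 'I_n -> nat) nu :
  (forall k : 'I_n, gamma (sigma k) =
     q ^+ (B (sigma k) + k + #|[pred j : 'I_n | (j < k)%N && (sigma k < sigma j)%N]|)) ->
  (forall i, exists m : int, nu i + (B i)%:Z = 2 * m) ->
  lat_parity [seq sigma k | k <- enum 'I_n] nu.
Proof.
move=> hg hn.
(* The exponents after the first N integrations. *)
pose nuN N i := nu i - (\sum_(j < n | (j < N)%N) (1 + (i < sigma j)%N))%N%:Z.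
suff H d N : (d + N = n)%N ->
    lat_parity [seq sigma k | k <- drop N (enum 'I_n)] (nuN N).
  have := H n 0%N (addn0 n); rewrite drop0; congr lat_parity.
  by apply/funext => i; rewrite /nuN big1 ?subr0.
elim: d N => [|d IH] N dN.
  by rewrite drop_oversize // size_enum_ord -dN.
have Nn : (N < n)%N by rewrite -dN addSn ltnS leq_addl.
pose k := Ordinal Nn.
rewrite (drop_nth k) ?size_enum_ord // (_ : nth k _ _ = k) /=; last first.
  by apply: val_inj; rewrite /= nth_enum_ord.
split.
  have [m hm] := hn (sigma k); exists m; rewrite hg exprnP -expfzDr //; congr (q ^ _).
  have E1 : (\sum_(j < n | (j < N)%N) 1 = N)%N.
    by rewrite -(big_ord_widen n (fun=> 1%N) (ltnW Nn)) sum_nat_const card_ord muln1.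
  have E2 : #|[pred j : 'I_n | (j < k)%N && (sigma k < sigma j)%N]| =
      (\sum_(j < n | (j < N)%N) (sigma k < sigma j))%N.
    rewrite -sum1_card [RHS](bigID (fun j : 'I_n => (sigma k < sigma j)%N)) /=.
    rewrite [X in (_ + X)%N]big1 ?addn0 => [|j /andP[_ /negPf ->] //].
    by apply: eq_big => // j /andP[_ ->].
  rewrite -hm /nuN big_split /= E1 E2.
  by rewrite !PoszD; ring.
have -> : lat_step_nu (sigma k) (nuN N) = nuN N.+1.
  apply/funext => i; rewrite /lat_step_nu /nuN.
  have -> : (\sum_(j < n | (j < N.+1)%N) (1 + (i < sigma j)%N) =
      (1 + (i < sigma k)%N) + \sum_(j < n | (j < N)%N) (1 + (i < sigma j)%N))%N.
    rewrite (bigD1 k) /= ?ltnSn //; congr (_ + _)%N; apply: eq_bigl => j.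
    rewrite ltnS leq_eqVlt -(inj_eq val_inj) /=.
    by case: (ltngtP j N).
  by rewrite PoszD; ring.
by apply: IH; rewrite addnS -addSn.
Qed.

End IteratedLatticeIntegral.
(** * The one-variable transforms on Gaussians times polynomials *)

Section OneVariableAlgebra.
Variable R : realType.
Local Notation C := R[i].
Local Notation I := ('i%C : C).

Definition shiftc (e : nat) (a : nat -> C) : nat -> C :=
  fun k => if (k < e)%N then 0 else a (k - e)%N.

(** The linear functional sending X^k to [u k]. Multiplying a series by r and taking moments of r
    are both of this form, so identities about them can be checked on monomials. *)
Definition ppair (r : {poly C}) (u : nat -> C) : C := \sum_(k < size r) r`_k * u k.

Lemma ppair_widen N (r : {poly C}) (u : nat -> C) : (size r <= N)%N ->
  ppair r u = \sum_(k < N) r`_k * u k.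
Proof.
move=> sN; rewrite /ppair (big_ord_widen N (fun k => r`_k * u k) sN) big_mkcond.
apply: eq_bigr => k _; case: ltnP => // /(nth_default 0) ->.
by rewrite mul0r.
Qed.

Lemma ppairD (r s : {poly C}) u : ppair (r + s) u = ppair r u + ppair s u.
Proof.
pose N := maxn (size r) (size s).
rewrite !(@ppair_widen N) ?leq_maxl ?leq_maxr ?size_polyD // -big_split.
by apply: eq_bigr => k _; rewrite coefD mulrDl.
Qed.

Lemma ppairC c u : ppair c%:P u = c * u 0%N.
Proof. by rewrite (@ppair_widen 1) ?size_polyC_leq1 // big_ord1 coefC. Qed.

Lemma ppairMX (r : {poly C}) u : ppair (r * 'X) u = ppair r (fun k => u k.+1).
Proof.
have h : (size (r * 'X)%R <= (size r).+1)%N.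
  by apply: leq_trans (size_polyMleq _ _) _; rewrite size_polyX addn2.
rewrite (@ppair_widen (size r).+1) //.
rewrite big_ord_recl coefMX mul0r add0r; apply: eq_bigr => k _.
by rewrite coefMX.
Qed.

Lemma ppairZ (r : {poly C}) w u : ppair r (fun k => w * u k) = w * ppair r u.
Proof. by rewrite /ppair big_distrr; apply: eq_bigr => k _; rewrite mulrCA. Qed.

Lemma eq_ppair (r : {poly C}) u v : (forall k, u k = v k) -> ppair r u = ppair r v.
Proof. by move=> uv; apply: eq_bigr => k _; rewrite uv. Qed.

(* [r] times the power series with coefficients [a]. *)
Definition mulc (r : {poly C}) (a : nat -> C) : nat -> C :=
  fun e => ppair r (fun k => shiftc k a e).

(* Moments of [r] times a function with moments [L]. *)
Definition momc (r : {poly C}) (L : nat -> C) : nat -> C :=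
  fun e => ppair r (fun k => L (e + k)%N).

Section Dilation.
Variables (w s : C).
Hypothesis w0 : w != 0.

(* If [a(w t) = (1 + s t^2) a(t)] then [qder r * a] is
   [-i ((r a)(t) - (r a)(w t)) / t]; see [mulc_qder]. *)
Definition qder (r : {poly C}) : {poly C} :=
  \poly_(m < (size r).+1) ((if m is m'.+1 then I * s * w ^+ m' * r`_m' else 0)
     - I * (1 - w ^+ m.+1) * r`_m.+1).

Lemma coef_qder r m : (qder r)`_m =
  (if m is m'.+1 then I * s * w ^+ m' * r`_m' else 0) - I * (1 - w ^+ m.+1) * r`_m.+1.
Proof.
rewrite coef_poly; case: ltnP => //; case: m => // m rm.
by rewrite !(nth_default 0) ?mulr0 ?subr0 // ltnW // ltnW.
Qed.

(** The adjoint of [qder] on sequences. The truncated index [k.-1] is harmless at k = 0 because its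
    factor 1 - w^0 is zero. *)
Lemma ppair_qder r u : ppair (qder r) u = ppair r (fun k =>
  I * s * w ^+ k * u k.+1 - I * (1 - w ^+ k) * u k.-1).
Proof.
pose N := (size r).+1.
rewrite (@ppair_widen N.+1); last exact: leq_trans (size_poly _ _) _.
under eq_bigr do rewrite coef_qder mulrBl.
rewrite sumrB big_ord_recl mul0r add0r.
rewrite (@ppair_widen N.+2); last by rewrite /N; lia.
under [in RHS]eq_bigr do rewrite mulrBr.
rewrite sumrB; congr (_ - _).
  rewrite [RHS]big_ord_recr [X in _ = X + _]big_ord_recr /=.
  have z j : (size r <= j)%N -> r`_j = 0 by exact: nth_default.
  rewrite (z N); last by rewrite /N.
  rewrite (z N.+1); last by rewrite /N; lia.
  by rewrite !mul0r !addr0; apply: eq_bigr => k _; rewrite /bump /=; ring.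
rewrite [RHS]big_ord_recl expr0 subrr mulr0 mul0r mulr0 add0r.
by apply: eq_bigr => k _; rewrite /bump /=; ring.
Qed.

Definition qexp_coef (a : nat -> C) :=
  a 1%N = 0 /\ forall m, (1 - w ^+ m.+2) * a m.+2 = - s * a m.

(* Satisfied by the Jackson moments of a function with the functional equation
   of [qexp_coef], because the lattice is invariant under [t |-> w t]. *)
Definition qexp_moment (L : nat -> C) :=
  L 1%N = 0 /\ forall m, s * L m.+2 = (w ^- m.+1 - 1) * L m.

Lemma mulc_qder a r e : qexp_coef a ->
  mulc (qder r) a e = - I * (1 - w ^+ e.+1) * mulc r a e.+1.
Proof.
move=> [a1 rec]; rewrite /mulc ppair_qder -ppairZ; apply: eq_ppair => k.
rewrite /shiftc; have [ke|ke] := leqP k e; last first.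
  rewrite ltnS (ltnW ke) mulr0 sub0r; move: ke; rewrite leq_eqVlt => /orP[/eqP <-|ke].
    by rewrite /= !ltnn !subnn; ring.
  have -> : (e < k.-1)%N by lia.
  by rewrite ke !mulr0 oppr0.
have [m em] : exists m, e = (k + m)%N by exists (e - k)%N; rewrite subnKC.
rewrite em (_ : (k + m < k.-1)%N = false); last by lia.
rewrite (_ : ((k + m).+1 < k)%N = false); last by lia.
rewrite (_ : ((k + m).+1 - k = m.+1)%N); last by lia.
have E : I * (1 - w ^+ k) * a (k + m - k.-1)%N = I * (1 - w ^+ k) * a m.+1.
  case: k {ke em} => [|k]; first by rewrite expr0 subrr mulr0 !mul0r.
  by have -> : (k.+1 + m - k.+1.-1 = m.+1)%N by lia.
rewrite E {E}; case: m em => [|m] em.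
  rewrite a1 (_ : (k + 0 < k.+1)%N) ?addn0 ?ltnS //.
  by rewrite !mulr0 subrr.
rewrite (_ : (k + m.+1 < k.+1)%N = false); last by lia.
rewrite (_ : (k + m.+1 - k.+1 = m)%N); last by lia.
have -> : I * s * w ^+ k * a m = - (I * w ^+ k * ((1 - w ^+ m.+2) * a m.+2)).
  by rewrite rec; ring.
by rewrite -[(k + m.+1).+1]addnS exprD; ring.
Qed.

(** Integration by parts: on a lattice invariant under t -> w t, the integral of t^e (f(t) - f(w t))
    is 1 - w^(-(e+1)) times the e-th moment of f. *)
Lemma momc_qder L r e : qexp_moment L ->
  momc (qder r) L e.+1 = - I * (1 - w ^- e.+1) * momc r L e.
Proof.
move=> [L1 rec]; rewrite /momc ppair_qder -ppairZ; apply: eq_ppair => k.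
have wk j : w ^+ j != 0 by rewrite expf_neq0.
case: k => [|k].
  rewrite expr0 subrr mulr0 mul0r subr0 mulr1 !addn0 addn1 -mulrA rec; ring.
have -> : (e.+1 + k.+2 = (e + k).+1.+2)%N by lia.
have -> : (e.+1 + k.+1.-1 = (e + k).+1)%N by lia.
have -> : (e + k.+1 = (e + k).+1)%N by lia.
have -> x : I * s * x * L (e + k).+1.+2 = I * x * ((w ^- (e + k).+2 - 1) * L (e + k).+1).
  by rewrite -rec; ring.
have -> : w ^- (e + k).+2 = (w ^+ k.+1)^-1 * (w ^+ e.+1)^-1.
  by rewrite -invfM -exprD; congr (w ^- _); lia.
by field; rewrite !wk.
Qed.

(** The boundary case e = -1 of the previous identity, whose factor 1 - w^0 is zero. *)
Lemma momc_qder0 L r : qexp_moment L -> momc (qder r) L 0 = 0.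
Proof.
move=> [L1 rec]; rewrite /momc ppair_qder /ppair big1 // => -[k _] _ /=.
case: k => [|k]; first by rewrite expr0 subrr mulr0 mul0r subr0 add0n L1 !mulr0.
rewrite !add0n /=.
have -> : I * s * w ^+ k.+1 * L k.+2 = I * w ^+ k.+1 * (s * L k.+2) by ring.
have -> : I * w ^+ k.+1 * (s * L k.+2) = I * (1 - w ^+ k.+1) * L k.
  by rewrite rec; field; rewrite expf_neq0.
by rewrite subrr mulr0.
Qed.

End Dilation.

(** * Inversion in one variable *)

Section Inversion.
Variables (q : R) (hq : 0 < q < 1).
Local Notation p := ((q ^+ 2)%:C : C).

Definition Ecoef (m : nat) : C :=
  if odd m then 0 else Eq_coef (q ^+ 4) m./2 * (- (q ^+ 4)%:C) ^+ m./2.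

Definition gcoef (m : nat) : C :=
  if odd m then 0 else eq_coef (q ^+ 4) m./2 * (-1) ^+ m./2.

(** [Fcoef] and [Gcoef] are the normalising factors of the two transforms for n = 1; the remaining
    powers of q for general n are matched by twists and dilations. *)
Definition Fcoef (e : nat) : C := I ^+ e / (qpoch (q ^+ 2) (q ^+ 2) e)%:C.

Definition Gcoef (e : nat) : C :=
  (- I) ^+ e * (q ^+ (e ^ 2 + e))%:C / (qpoch (q ^+ 2) (q ^+ 2) e)%:C.

Let q0 : 0 < q. Proof. by case/andP: hq. Qed.

Lemma qpow_neq1 m : (0 < m)%N -> 1 - q ^+ m != 0.
Proof.
move=> m0; rewrite subr_eq0 eq_sym lt_eqF // exprn_ilt1 ?(ltW q0) -?lt0n //.
by case/andP: hq.
Qed.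

Lemma realC_neq0 (x : R) : x != 0 -> x%:C != 0 :> C.
Proof. by move=> x0; rewrite eq_complex /= eqxx andbT. Qed.

Lemma realCM (x y : R) : (x * y)%:C = x%:C * y%:C :> C.
Proof. exact: rmorphM. Qed.

Lemma realCV (x : R) : (x^-1)%:C = x%:C^-1 :> C.
Proof. exact: fmorphV. Qed.

Lemma p_neq0 : p != 0.
Proof. by rewrite realC_neq0 // expf_neq0 // gt_eqF. Qed.

Lemma pX_neq1 m : (0 < m)%N -> 1 - p ^+ m != 0.
Proof.
move=> m0; have -> : 1 - p ^+ m = (1 - q ^+ (2 * m))%:C.
  by rewrite rmorphB rmorph1 -rmorphXn -exprM.
by rewrite realC_neq0 // qpow_neq1 // muln_gt0.
Qed.

Lemma qpochS (a b : R) k : qpoch a b k.+1 = qpoch a b k * (1 - a * b ^+ k).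
Proof. by rewrite /qpoch big_ord_recr. Qed.

Lemma qpoch_neq0 j k : (0 < j)%N -> qpoch (q ^+ j) (q ^+ j) k != 0.
Proof.
move=> j0; elim: k => [|k IH]; first by rewrite /qpoch big_ord0 oner_eq0.
by rewrite qpochS mulf_neq0 // -exprS -exprM qpow_neq1 // muln_gt0 j0.
Qed.

Lemma qpochE j k : (qpoch (q ^+ j) (q ^+ j) k.+1)%:C =
  (qpoch (q ^+ j) (q ^+ j) k)%:C * (1 - (q ^+ j)%:C ^+ k.+1) :> C.
Proof. by rewrite qpochS rmorphM -exprS rmorphB rmorphXn rmorph1. Qed.

Let q4E k : (q ^+ 4)%:C ^+ k = p ^+ (k.*2) :> C.
Proof. by rewrite -!rmorphXn -!exprM -mul2n mulnA. Qed.

(** e_{q^4}(-t^2) = 1 / (-t^2; q^4)_oo loses the factor 1 + t^2 of its denominator under t -> q^2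
    t. *)
Lemma gcoefP : qexp_coef p 1 gcoef.
Proof.
split=> // m; rewrite /gcoef /= negbK; case: ifP => om; first by rewrite !mulr0.
set k := m./2; have mk : m.+2 = k.+1.*2.
  by rewrite -(odd_double_half m) om add0n doubleS.
rewrite mk -q4E /eq_coef !realCV qpochE [(-1) ^+ k.+1]exprS.
have h1 := realC_neq0 (@qpoch_neq0 4 k isT); have := pX_neq1 (m := m.+2) isT.
rewrite mk -q4E; move: h1; move: (qpoch _ _ _)%:C ((q ^+ 4)%:C ^+ k.+1) ((-1) ^+ k) => Q x y h1 h2.
by field; rewrite h1 h2.
Qed.

(** E_{q^4}(-q^4 t^2) = (q^4 t^2; q^4)_oo gains the factor 1 - t^2 under t -> q^(-2) t. *)
Lemma EcoefP : qexp_coef p^-1 (-1) Ecoef.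
Proof.
split=> // m; rewrite /Ecoef /= negbK; case: ifP => om; first by rewrite !mulr0.
set k := m./2; have mk : m.+2 = k.+1.*2.
  by rewrite -(odd_double_half m) om add0n doubleS.
have EE j : Eq_coef (q ^+ 4) j = ((q ^+ 4) ^+ 'C(j, 2))%:C / (qpoch (q ^+ 4) (q ^+ 4) j)%:C :> C.
  by rewrite -realCV; exact: realCM.
rewrite mk exprVn -q4E !EE qpochE.
have -> : ((q ^+ 4) ^+ 'C(k.+1, 2))%:C = ((q ^+ 4) ^+ 'C(k, 2))%:C * (q ^+ 4)%:C ^+ k :> C.
  by rewrite binS bin1 exprD realCM; congr (_ * _); exact: rmorphXn.
rewrite [(- _) ^+ k.+1]exprS.
have h1 := realC_neq0 (@qpoch_neq0 4 k isT); have := pX_neq1 (m := m.+2) isT.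
have h3 : (q ^+ 4)%:C != 0 :> C by rewrite realC_neq0 // expf_neq0 // gt_eqF.
have h4 : (q ^+ 4)%:C ^+ k != 0 :> C by rewrite expf_neq0.
rewrite mk -q4E exprS => h2; move: h1 h2 h3 h4.
move: (qpoch _ _ _)%:C ((- (q ^+ 4)%:C) ^+ k) ((q ^+ 4)%:C ^+ k) ((q ^+ 4) ^+ 'C(k, 2))%:C.
move: (q ^+ 4)%:C => P Q S Pk T h1 h2 h3 h4.
by field; rewrite h1 h2 h3 h4.
Qed.

(* The one-variable case of both inversion formulas at once: [r E] and [s e] are
   transforms of each other, for the Gaussians E = E_{q^4}(- q^4 t^2) and
   e = e_{q^4}(- t^2) and any families [mu], [lam] behaving as their moments. *)
Definition gauss_rel (r s : {poly C}) :=
  (forall mu, qexp_moment p^-1 (-1) mu -> forall e,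
     Fcoef e * momc r mu e = mu 0%N * mulc s gcoef e) /\
  (forall lam, qexp_moment p 1 lam -> forall e,
     Gcoef e * momc s lam e = lam 0%N * mulc r Ecoef e).

Lemma sqrI : I * I = -1. Proof. by rewrite -expr2 sqr_i. Qed.

(** The ratio is the factor of [mulc_qder] for w = p and also that of [momc_qder] for w = p^-1; this
    match is what the powers of i and the Pochhammer symbols are for. *)
Lemma FcoefS e : Fcoef e = - I * (1 - p ^+ e.+1) * Fcoef e.+1.
Proof.
rewrite /Fcoef qpochE [I ^+ e.+1]exprS.
have h1 := realC_neq0 (@qpoch_neq0 2 e isT); have := pX_neq1 (m := e.+1) isT.
move: h1; move: (p ^+ e.+1) (qpoch _ _ _)%:C (I ^+ e) => pe Q Ie h1 h2.
transitivity (- (I * I) * (Ie / Q)); first by rewrite sqrI opprK mul1r.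
by field; rewrite h1 h2.
Qed.

(** Here the roles are exchanged: the ratio is the factor of [mulc_qder] for w = p^-1 and of
    [momc_qder] for w = p. The exponent e^2 + e accounts for the additional p^(e+1). *)
Lemma GcoefS e : Gcoef e = I * (p ^- e.+1 - 1) * Gcoef e.+1.
Proof.
rewrite /Gcoef qpochE [(- I) ^+ e.+1]exprS.
have h1 := realC_neq0 (@qpoch_neq0 2 e isT); have := pX_neq1 (m := e.+1) isT.
have h3 : p ^+ e.+1 != 0 by rewrite expf_neq0 // p_neq0.
have -> : (q ^+ (e.+1 ^ 2 + e.+1))%:C = (q ^+ (e ^ 2 + e))%:C * p ^+ e.+1 :> C.
  by rewrite -rmorphXn -realCM -exprM -exprD; congr (_ ^+ _)%:C; lia.
move: h1 h3; move: (p ^+ e.+1) (qpoch _ _ _)%:C ((- I) ^+ e) (q ^+ (e ^ 2 + e))%:C => pe Q Ie Qe h1 h3 h2.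
transitivity (- (I * I) * (Ie * Qe / Q)); first by rewrite sqrI opprK mul1r.
by field; rewrite h1 h2 h3.
Qed.

Lemma mulcC c a e : mulc c%:P a e = c * a e.
Proof. by rewrite /mulc ppairC /shiftc ltn0 subn0. Qed.
Lemma momcC c L e : momc c%:P L e = c * L e.
Proof. by rewrite /momc ppairC addn0. Qed.
Lemma mulcD r s a e : mulc (r + s) a e = mulc r a e + mulc s a e.
Proof. exact: ppairD. Qed.
Lemma momcD r s L e : momc (r + s) L e = momc r L e + momc s L e.
Proof. exact: ppairD. Qed.
Lemma mulcMX r a e : mulc (r * 'X) a e = if e is e'.+1 then mulc r a e' else 0.
Proof.
rewrite /mulc ppairMX; case: e => [|e]; last exact: eq_ppair.
by rewrite /ppair big1 // => k _; rewrite /shiftc ltnS leq0n mulr0.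
Qed.
Lemma momcMX r L e : momc (r * 'X) L e = momc r L e.+1.
Proof. by rewrite /momc ppairMX; apply: eq_ppair => k; rewrite addnS. Qed.

(** Both sides obey the same recurrence of step two, so the induction carries two consecutive
    indices; all odd terms are zero. *)
Lemma gauss_rel1 : gauss_rel 1 1.
Proof.
have [[g1 grec] [E1 Erec]] := (gcoefP, EcoefP).
rewrite -polyC1; split=> [mu|lam] [m1 rec] e; rewrite mulcC momcC !mul1r.
  suff H k : Fcoef k * mu k = mu 0%N * gcoef k /\
      Fcoef k.+1 * mu k.+1 = mu 0%N * gcoef k.+1 by case: (H e).
  elim: k => [|k [IH1 IH2]]; split=> //.
  - have -> : Fcoef 0 = 1 by rewrite /Fcoef /qpoch big_ord0 expr0 divr1.
    by rewrite /gcoef /eq_coef /qpoch /= big_ord0 invr1 mul1r !mulr1.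
  - by rewrite m1 g1 !mulr0.
  have h := pX_neq1 (m := k.+2) isT; apply: (mulfI h).
  rewrite [RHS]mulrCA grec.
  have -> : mu 0%N * (- 1 * gcoef k) = - (Fcoef k * mu k) by rewrite IH1; ring.
  rewrite [Fcoef k]FcoefS [Fcoef k.+1]FcoefS.
  have := rec k; rewrite exprVn invrK => /eqP; rewrite mulN1r eqr_oppLR => /eqP ->.
  have -> : p ^+ k.+1 - 1 = - (1 - p ^+ k.+1) by rewrite opprB.
  move: (1 - p ^+ k.+1) (1 - p ^+ k.+2) (Fcoef k.+2) (mu k) => x y z t.
  transitivity (- (I * I) * y * z * x * t); first by rewrite sqrI; ring.
  by ring.
suff H k : Gcoef k * lam k = lam 0%N * Ecoef k /\
    Gcoef k.+1 * lam k.+1 = lam 0%N * Ecoef k.+1 by case: (H e).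
elim: k => [|k [IH1 IH2]]; split=> //.
- have -> : Gcoef 0 = 1 by rewrite /Gcoef /qpoch big_ord0 expr0 divr1 mul1r.
  by rewrite /Ecoef /Eq_coef /qpoch /= big_ord0 divr1 mul1r !mulr1.
- by rewrite m1 E1 !mulr0.
have h : 1 - p^-1 ^+ k.+2 != 0.
  rewrite exprVn; apply: contraNneq (pX_neq1 (m := k.+2) isT) => /eqP.
  by rewrite subr_eq0 eq_sym invr_eq1 subr_eq0 eq_sym.
apply: (mulfI h); rewrite [RHS]mulrCA Erec opprK mul1r -IH1 [Gcoef k]GcoefS [Gcoef k.+1]GcoefS.
have := rec k; rewrite mul1r => ->; rewrite exprVn.
have -> : 1 - p ^- k.+2 = - (p ^- k.+2 - 1) by rewrite opprB.
move: (p ^- k.+1 - 1) (p ^- k.+2 - 1) (Gcoef k.+2) (lam k) => x y z t.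
transitivity ((I * I) * y * x * z * t).
  by rewrite sqrI; ring.
by ring.
Qed.

Lemma gauss_relD r s r' s' : gauss_rel r s -> gauss_rel r' s' ->
  gauss_rel (r + r') (s + s').
Proof.
move=> [h1 h2] [h1' h2']; split=> L hL e; rewrite mulcD momcD !mulrDr.
  by rewrite h1 ?h1'.
by rewrite h2 ?h2'.
Qed.

Lemma gauss_relC c : gauss_rel c%:P c%:P.
Proof.
have [h1 h2] := gauss_rel1; split=> L hL e; rewrite mulcC momcC mulrCA [RHS]mulrCA.
  by have := h1 L hL e; rewrite -polyC1 mulcC momcC !mul1r => ->.
by have := h2 L hL e; rewrite -polyC1 mulcC momcC !mul1r => ->.
Qed.

Lemma gauss_rel_qderR r s : gauss_rel r s -> gauss_rel (r * 'X) (qder p 1 s).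
Proof.
move=> [h1 h2]; split=> L hL e.
  rewrite momcMX (mulc_qder p_neq0 _ _ gcoefP) [Fcoef e]FcoefS.
  transitivity (- I * (1 - p ^+ e.+1) * (Fcoef e.+1 * momc r L e.+1)); first by ring.
  by rewrite h1 //; ring.
rewrite mulcMX; case: e => [|e]; first by rewrite momc_qder0 ?p_neq0 // !mulr0.
rewrite (momc_qder p_neq0) // -h2 // [Gcoef e]GcoefS.
by ring.
Qed.

(** The mirror image of [gauss_rel_qderR], with the functional equation of E instead of e: the
    second inversion formula starts from s and has to construct r. *)
Lemma gauss_rel_qderL r s : gauss_rel r s -> gauss_rel (qder p^-1 (-1) r) (s * 'X).
Proof.
have pV0 : p^-1 != 0 by rewrite invr_neq0 // p_neq0.
move=> [h1 h2]; split=> L hL e.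
  rewrite mulcMX; case: e => [|e]; first by rewrite momc_qder0 // !mulr0.
  by rewrite (momc_qder pV0) // -h1 // [Fcoef e]FcoefS exprVn invrK; ring.
rewrite momcMX (mulc_qder pV0 _ _ EcoefP) [Gcoef e]GcoefS exprVn.
transitivity (I * (p ^- e.+1 - 1) * (Gcoef e.+1 * momc s L e.+1)); first by ring.
by rewrite h2 //; ring.
Qed.

Definition poly_parity (b : bool) (r : {poly C}) := forall k, odd k != b -> r`_k = 0.

Lemma poly_parity_qder b w s r : poly_parity b r -> poly_parity (~~ b) (qder w s r).
Proof.
move=> hr k ok; rewrite coef_qder hr ?mulr0 ?subr0; last first.
  by rewrite /=; case: odd ok; case: b {hr}.
case: k ok => // k ok; rewrite hr ?mulr0 //.
by move: ok => /=; case: odd; case: b {hr}.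
Qed.

Lemma poly_parity_MXaddC b (r : {poly C}) c : poly_parity b (r * 'X + c%:P) ->
  poly_parity (~~ b) r /\ poly_parity b c%:P.
Proof.
move=> h; split=> k ok.
  have := h k.+1; rewrite coefD coefMX coefC /= addr0; apply.
  by move: ok; case: odd; case: b {h}.
rewrite coefC; case: eqP => // k0; have := h 0%N.
by rewrite coefD coefMX coefC /= add0r; apply; rewrite k0 in ok.
Qed.

Lemma poly_parityD b (r s : {poly C}) :
  poly_parity b r -> poly_parity b s -> poly_parity b (r + s).
Proof. by move=> hr hs k ok; rewrite coefD hr // hs // addr0. Qed.

Lemma mulc_parity0 b (r : {poly C}) (a : nat -> C) k : (forall m, odd m -> a m = 0) ->
  poly_parity b r -> odd k != b -> mulc r a k = 0.
Proof.
move=> a0 pr ok; rewrite /mulc /ppair big1 // => -[j /= _] _.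
have [oj|oj] := eqVneq (odd j) b; last by rewrite pr ?mul0r.
rewrite /shiftc; case: ltnP => [_|jk]; first by rewrite mulr0.
by rewrite a0 ?mulr0 // oddB // oj; move: ok; case: odd; case: b {pr oj}.
Qed.

Lemma momc_parity0 b (r : {poly C}) (L : nat -> C) e : (forall m, odd m -> L m = 0) ->
  poly_parity b r -> odd e != b -> momc r L e = 0.
Proof.
move=> L0 pr oe; rewrite /momc /ppair big1 // => -[k /= _] _.
have [ok|ok] := eqVneq (odd k) b; last by rewrite pr ?mul0r.
by rewrite L0 ?mulr0 // oddD ok; move: oe; case: odd; case: b {pr ok}.
Qed.

Lemma gauss_relA b r : poly_parity b r -> exists2 s, poly_parity b s & gauss_rel r s.
Proof.
elim/poly_ind: r b => [|r c IH] b.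
  by exists 0; [move=> k _; rewrite coef0|exact: (gauss_relC 0)].
move=> /poly_parity_MXaddC[/IH[s ps rs] pc].
exists (qder p 1 s + c%:P).
  by apply: poly_parityD => //; rewrite -[b]negbK; exact: poly_parity_qder.
by apply: gauss_relD; [exact: gauss_rel_qderR|exact: gauss_relC].
Qed.

Lemma gauss_relD' b s : poly_parity b s -> exists2 r, poly_parity b r & gauss_rel r s.
Proof.
elim/poly_ind: s b => [|s c IH] b.
  by exists 0; [move=> k _; rewrite coef0|exact: (gauss_relC 0)].
move=> /poly_parity_MXaddC[/IH[r pr rs] pc].
exists (qder p^-1 (-1) r + c%:P).
  by apply: poly_parityD => //; rewrite -[b]negbK; exact: poly_parity_qder.
by apply: gauss_relD; [exact: gauss_rel_qderL|exact: gauss_relC].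
Qed.

End Inversion.
End OneVariableAlgebra.
(** * Gaussian series and their Jackson moments *)

Section GaussianSeries.
Variable R : realType.
Local Notation C := R[i].

Lemma geo_sum_le (r : R) N : 0 <= r < 1 -> \sum_(k < N) r ^+ k <= (1 - r)^-1.
Proof.
move=> /andP[r0 r1]; have h : (1 - r) * \sum_(k < N) r ^+ k = 1 - r ^+ N.
  rewrite -[1 in RHS](expr1n _ N) subrXX; congr (_ * _); apply: eq_bigr => k _.
  by rewrite expr1n mul1r.
have r1' : 0 < 1 - r by rewrite subr_gt0.
by rewrite -(ler_pM2l r1') h divff ?gt_eqF // lerBlDr lerDl exprn_ge0.
Qed.

Lemma rsummable_ratio (u : nat -> R) (r : R) N : 0 <= r < 1 ->
  (forall k, (N <= k)%N -> `|u k.+1| <= r * `|u k|) -> rsummable u.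
Proof.
move=> r01 h; have [r0 r1] := andP r01.
have hk k : `|u (N + k)%N| <= `|u N| * r ^+ k.
  elim: k => [|k IH]; first by rewrite addn0 expr0 mulr1.
  rewrite addnS; apply: le_trans (h _ (leq_addr _ _)) _.
  by rewrite exprS mulrCA ler_wpM2l.
apply: (@rsummable_nat _ _ (\sum_(k < N) `|u k| + `|u N| * (1 - r)^-1)) => n.
apply: (@le_trans _ _ (\sum_(k < N + n) `|u k|)).
  rewrite (big_ord_widen (N + n) (fun k => `|u k|) (leq_addl N n)).
  rewrite [leRHS](bigID (fun k : 'I_(N + n) => (k < n)%N)) /= lerDl sumr_ge0 //.
rewrite big_split_ord /= lerD2l; apply: le_trans (_ : _ <= \sum_(k < n) `|u N| * r ^+ k) _.
  by apply: ler_sum => k _; exact: hk.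
by rewrite -big_distrr /= ler_wpM2l // geo_sum_le.
Qed.

Lemma exprn_small (x e : R) : 0 <= x < 1 -> 0 < e ->
  exists N, forall k, (N <= k)%N -> x ^+ k <= e.
Proof.
move=> /andP[x0 x1] e0; have nx : `|x| < 1 by rewrite ger0_norm.
have /cvgrPdist_lt /(_ e e0) [N _ h] := cvg_expr nx.
exists N => k Nk; have := h k Nk; rewrite /= sub0r normrN => /ltW.
by rewrite ger0_norm ?exprn_ge0.
Qed.

(** Lets the ratio test be applied to the even-indexed coefficients alone, the odd ones being
    zero. *)
Lemma rsummable_even (a : nat -> C) (rho : R) : (forall k, odd k -> a k = 0) ->
  rsummable (fun k => normc (a k.*2) * rho ^+ k.*2) ->
  rsummable (fun k => normc (a k) * rho ^+ k).
Proof.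
move=> ev; apply: (@rsummable_inj R nat nat double (fun k => normc (a k) * rho ^+ k)).
  exact: double_inj.
move=> k out; rewrite ev ?normc0 ?mul0r //; apply/negPn/negP => ok.
by have := out k./2; rewrite even_halfK ?ok ?eqxx.
Qed.

Lemma ser_shiftc e (a : nat -> C) z : entire_coef1 a -> ser (shiftc e a) z = z ^+ e * ser a z.
Proof.
move=> ea; have [_ <-] := csumsZ (z ^+ e) (csums_ser z ea).
rewrite /ser (@csum_inj R nat nat (addn e)); last 2 first.
- by move=> x y /addnI.
- move=> j out; rewrite /shiftc; case: ltnP => [_|ej]; first by rewrite mul0r.
  by have := out (j - e)%N; rewrite subnKC // eqxx.
congr csum; apply/funext => k; rewrite /shiftc ltnNge leq_addr /= addKn exprD; ring.
Qed.

Lemma entire_shiftc e (a : nat -> C) : entire_coef1 a -> entire_coef1 (shiftc e a).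
Proof.
move=> ea rho rho0; apply: (@rsummable_inj R nat nat (addn e)
    (fun k => normc (shiftc e a k) * rho ^+ k)).
- by move=> x y /addnI.
- move=> j out; rewrite /shiftc; case: ltnP => [_|ej]; first by rewrite normc0 mul0r.
  by have := out (j - e)%N; rewrite subnKC // eqxx.
apply: rsummable_le (rsummableZ (rho ^+ e) (ea _ rho0)) => k.
by rewrite /shiftc ltnNge leq_addr /= addKn exprD mulrCA.
Qed.

Lemma csums_entire1P (a : nat -> C) : entire_coef1 a <->
  forall rho : R, 0 <= rho -> csummable (fun k => a k * rho%:C ^+ k).
Proof.
have E (rho : R) : 0 <= rho -> (fun k => normc (a k) * rho ^+ k) =
    (fun k => normc (a k * rho%:C ^+ k)).
  by move=> r0; apply/funext => k; rewrite normcM normcX normc_real ger0_norm.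
by split=> h rho r0; have := h rho r0; rewrite csummableE -E.
Qed.

Lemma entire_mulc (r : {poly C}) (a : nat -> C) : entire_coef1 a -> entire_coef1 (mulc r a).
Proof.
move=> ea; apply/csums_entire1P => rho r0.
have := csums_sum (index_enum 'I_(size r)) (fun k : 'I_(size r) =>
  csumsZ r`_k (csumsP ((csums_entire1P _).1 (entire_shiftc k ea) rho r0))).
move=> [+ _]; congr csummable; apply/funext => e.
by rewrite /mulc /ppair mulr_suml; apply: eq_bigr => k _; rewrite mulrA.
Qed.

Lemma ser_mulc (r : {poly C}) (a : nat -> C) z : entire_coef1 a ->
  ser (mulc r a) z = r.[z] * ser a z.
Proof.
move=> ea; have := csums_sum (index_enum 'I_(size r)) (fun k : 'I_(size r) =>
  csumsZ r`_k (csums_ser z (entire_shiftc k ea))).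
move=> [_ E]; transitivity (\sum_(k < size r) r`_k * ser (shiftc k a) z).
  rewrite -E /ser; congr csum; apply/funext => e.
  by rewrite /mulc /ppair mulr_suml; apply: eq_bigr => k _; rewrite mulrA.
rewrite horner_coef mulr_suml; apply: eq_bigr => k _.
by rewrite ser_shiftc // mulrA.
Qed.

Variables (q : R) (hq : 0 < q < 1).
Local Notation p := ((q ^+ 2)%:C : C).
Local Notation Ec := (@Ecoef R q).
Local Notation gc := (@gcoef R q).
Let q0 : 0 < q. Proof. by case/andP: hq. Qed.
Let p01 : 0 < q ^+ 2 < 1.
Proof. by rewrite exprn_gt0 // exprn_ilt1 ?ltW //; case/andP: hq. Qed.

Lemma Ecoef_odd k : odd k -> Ec k = 0. Proof. by rewrite /Ecoef => ->. Qed.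
Lemma gcoef_odd k : odd k -> gc k = 0. Proof. by rewrite /gcoef => ->. Qed.

Lemma entire_Ecoef : entire_coef1 Ec.
Proof.
move=> rho rho0; apply: rsummable_even; first exact: Ecoef_odd.
have [p0 p1] := andP p01.
(* Once p^(2k+2) is below this threshold, the recurrence bounds the ratio of consecutive even terms
   by 1/2. *)
have e0 : 0 < (2 * rho ^+ 2 + 1)^-1 by rewrite invr_gt0; nra.
have p01' : 0 <= q ^+ 2 < 1 by rewrite (ltW p0).
have [N hN] := exprn_small p01' e0.
apply: (@rsummable_ratio _ (2^-1) N) => [|k Nk]; first by lra.
have [_ /(_ k.*2) rec] := EcoefP hq; have pk := hN k.*2.+2.
have Nk2 : (N <= k.*2.+2)%N by rewrite (leq_trans Nk) // -addnn -addn2 -addnA leq_addr.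
have := pk Nk2; set x := (q ^+ 2) ^+ k.*2.+2 => hx.
have x0 : 0 < x by rewrite exprn_gt0.
have x1 : 0 <= x^-1 - 1.
  by rewrite subr_ge0 invf_ge1 //; apply: exprn_ile1; exact: ltW.
have {}rec : (x^-1 - 1) * normc (Ec k.*2.+2) = normc (Ec k.*2).
  have := rec; rewrite opprK mul1r exprVn => <-; rewrite normcM; congr (_ * _).
  have -> : 1 - p ^- k.*2.+2 = - (x^-1 - 1)%:C.
    by rewrite rmorphB /= rmorph1 opprB realCV; congr (_ - _^-1); exact: esym (rmorphXn _ _ _).
  by rewrite normc_opp normc_real ger0_norm.
have hxr : rho ^+ 2 <= 2^-1 * (x^-1 - 1).
  have : 2 * rho ^+ 2 + 1 <= x^-1 by rewrite -[leLHS]invrK lef_pV2 ?posrE.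
  by lra.
have -> : rho ^+ k.+1.*2 = rho ^+ 2 * rho ^+ k.*2 by rewrite -exprD add2n doubleS.
have : 0 <= rho ^+ k.*2 by rewrite exprn_ge0.
have := normc_ge0 (Ec k.*2.+2); rewrite [k.+1.*2]doubleS -rec; move: hxr; move: (rho ^+ 2) (exprn_ge0 2 rho0) => rho2 rho20 hxr.
move: (rho ^+ k.*2) (normc (Ec k.*2.+2)) => y e e_0 y_0.
rewrite !ger0_norm ?mulr_ge0 //.
have -> : e * (rho2 * y) = (e * y) * rho2 by ring.
have -> : 2^-1 * ((x^-1 - 1) * e * y) = (e * y) * (2^-1 * (x^-1 - 1)) by ring.
by rewrite ler_wpM2l // mulr_ge0.
Qed.

Lemma ser_Ecoef z : ser Ec (p^-1 * z) = (1 - z ^+ 2) * ser Ec z.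
Proof.
have eE := entire_Ecoef; have e2 := entire_shiftc 2 eE.
transitivity (ser Ec z - ser (shiftc 2 Ec) z); last by rewrite ser_shiftc //; ring.
have [_ <-] := csumsB (csums_ser z eE) (csums_ser z e2).
rewrite /ser; congr csum; apply/funext => k; rewrite exprMn mulrA -mulrBl; congr (_ * _).
have [E1 rec] := EcoefP hq; case: k => [|[|k]].
- by rewrite expr0 mulr1 /shiftc subr0.
- by rewrite E1 mul0r /shiftc subr0.
rewrite /shiftc (_ : (k.+2 < 2)%N = false) // !subSS subn0.
by have := rec k; rewrite opprK mul1r => <-; ring.
Qed.

Lemma ser_Ecoef_odd z : ser Ec (- z) = ser Ec z.
Proof.
rewrite /ser; congr csum; apply/funext => k; have [ok|ek] := boolP (odd k).
  by rewrite Ecoef_odd // !mul0r.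
by rewrite exprNn -signr_odd (negPf ek) expr0 mul1r.
Qed.

Lemma ser_Ecoef_zero k : ser Ec (p ^- k.+1) = 0.
Proof.
elim: k => [|k IH]; first by rewrite expr1 -[p^-1]mulr1 ser_Ecoef expr1n subrr mul0r.
by rewrite exprS invfM ser_Ecoef IH mulr0.
Qed.

Lemma lat_pt1 (x : int * bool) : (lat_pt q 1 x)%:C = (-1) ^+ x.2 * p ^ x.1 :> C.
Proof.
rewrite /lat_pt mulr1 rmorphM rmorphXn rmorphN1; congr (_ * _).
by rewrite -exprz_exp /=; case: (x.1) => m /=; rewrite ?NegzE -?exprnN -?exprnP ?realCV /= rmorphXn.
Qed.

(** A negative index means a point of q^(2Z) outside [-1, 1], and all of these are zeros of E. The
    Jackson sum is thereby one-sided. *)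
Lemma ser_Ecoef_lat (x : int * bool) : (x.1 < 0)%R -> ser Ec (lat_pt q 1 x)%:C = 0.
Proof.
case: x => -[m|m] b //= _; rewrite lat_pt1 /= NegzE -exprnN.
by case: b; rewrite ?expr0 ?expr1 ?mul1r ?mulN1r ?ser_Ecoef_odd ser_Ecoef_zero.
Qed.

Lemma rsummable_int (a : int -> R) : rsummable (fun k : nat => a k%:Z) ->
  rsummable (fun k : nat => a (Negz k)) -> rsummable a.
Proof.
move=> h1 h2; pose phi (x : bool * nat) : int := if x.1 then Posz x.2 else Negz x.2.
apply: (@rsummable_inj R _ _ phi).
- by move=> [[] k] [[] k'] // [] ->.
- by move=> [k|k] out; [have := out (true, k)|have := out (false, k)]; rewrite /phi eqxx.
have sB b : rsummable (fun k => a (phi (b, k))) by case: b.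
apply: (@rsummable_pair R _ _ _ (fun b => rsum (fun k => `|a (phi (b, k))|)) sB) => //.
by have [] := @rsum_fin R bool (fun b => rsum (fun k => `|a (phi (b, k))|))
  [:: true; false] erefl (fun b => match b with true => fun h => match notF h with end
  | false => fun h => match notF h with end end).
Qed.

Lemma lat_pt_norm (c : R) (x : int * bool) : `|lat_pt q c x| = q ^ (2 * x.1) * `|c|.
Proof.
rewrite /lat_pt normrM normrX normrN1 expr1n mul1r normrM; congr (_ * _).
by rewrite ger0_norm // exprz_ge0 // ltW.
Qed.

(** Weights decay geometrically towards 0, where boundedness is enough; towards infinity they grow
    like t, and decay of order t^(-2) makes the terms geometric again. *)
Lemma jackson_integrable_bound (c M : R) (phi : R -> C) : c != 0 ->
  (forall x : int * bool, (0 <= x.1)%R -> normc (phi (lat_pt q c x)) <= M) ->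
  (forall x : int * bool, (x.1 < 0)%R ->
     lat_pt q c x ^+ 2 * normc (phi (lat_pt q c x)) <= M) ->
  jackson_integrable q c phi.
Proof.
move=> c0 h1 h2; rewrite /jackson_integrable.
pose B (k : int) : R := if (0 <= k)%R then q ^ (2 * k) * (`|c| * M) else q ^ (- (2 * k)) * (M / `|c|).
have cp : 0 < `|c| by rewrite normr_gt0.
have sB : rsummable B.
  have g := rsummable_geo (r := q ^+ 2) (introT andP (conj (ltW (andP p01).1) (andP p01).2)).
  apply: rsummable_int.
    apply: rsummable_le (rsummableZ (`|c| * M) g) => k.
    by rewrite /B /= -PoszM -exprnP exprM mulrC.
  apply: rsummable_le (rsummableZ (q ^+ 2 * (M / `|c|)) g) => k.
  rewrite /B /= NegzE mulrN opprK -PoszM -exprnP exprM exprS.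
  by rewrite [X in `|X|]mulrAC.
have bd x : normc (jackson_term q c phi x) <= B x.1.
  rewrite /jackson_term normcM normc_real normrM [`|q ^ _|]ger0_norm; last first.
    by rewrite exprz_ge0 // ltW.
  rewrite /B; case: (leP 0 x.1) => x0.
    by rewrite -mulrA ler_wpM2l ?exprz_ge0 ?(ltW q0) // ler_wpM2l // h1.
  have := h2 x x0; rewrite -real_normK ?num_real // lat_pt_norm.
  set t := q ^ (2 * x.1); have t0 : 0 < t by rewrite exprz_gt0.
  have -> : q ^ (- (2 * x.1)) = t^-1 by rewrite -invr_expz.
  move=> h; rewrite -(ler_pM2l (x := t * `|c|)) ?mulr_gt0 //.
  have -> : t * `|c| * (t^-1 * (M / `|c|)) = M by field; rewrite !gt_eqF.
  by apply: le_trans h; rewrite expr2 !mulrA lexx.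
apply: csummable_le bd _.
apply: (@rsummable_pair R _ _ (fun x : int * bool => B x.1) (fun k => 2 * `|B k|)).
- move=> k; have := @rsum_fin R bool (fun=> B k) [:: true; false] erefl; case=> //.
  by case.
- move=> k; have [] := @rsum_fin R bool (fun=> `|B k|) [:: true; false] erefl.
    by case.
  by move=> _ /= ->; rewrite !big_cons big_nil addr0 mulr_natl mulr2n.
- by apply: rsummableZ; apply: rsummable_le sB => k; rewrite normr_id.
Qed.

End GaussianSeries.

(** * Properties of the Jackson integral and the moments of E *)

Section JacksonMoments.
Variable R : realType.
Local Notation C := R[i].
Variables (q : R) (hq : 0 < q < 1).
Local Notation p := ((q ^+ 2)%:C : C).
Local Notation Ec := (@Ecoef R q).
Let q0 : 0 < q. Proof. by case/andP: hq. Qed.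
Let qn0 : q != 0. Proof. by rewrite gt_eqF. Qed.

Lemma jacksonP (c : R) phi : jackson_integrable q c phi ->
  exists S, csums (jackson_term q c phi) S /\ jackson q c phi = (1 - q ^+ 2)%:C * S.
Proof. by move=> h; exists (csum (jackson_term q c phi)). Qed.

Lemma jacksonE (c : R) phi S : csums (jackson_term q c phi) S ->
  jackson_integrable q c phi /\ jackson q c phi = (1 - q ^+ 2)%:C * S.
Proof. by move=> [h1 h2]; split=> //; rewrite /jackson h2. Qed.

Lemma jacksonZ (c : R) phi w : jackson_integrable q c phi ->
  jackson_integrable q c (fun t => w * phi t) /\
  jackson q c (fun t => w * phi t) = w * jackson q c phi.
Proof.
move=> /jacksonP[S [h ->]]; rewrite [w * _]mulrCA; apply: jacksonE.
by apply: eq_csums (csumsZ w h) => x; rewrite /jackson_term mulrCA.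
Qed.

Lemma jacksonB (c : R) phi psi : jackson_integrable q c phi -> jackson_integrable q c psi ->
  jackson_integrable q c (fun t => phi t - psi t) /\
  jackson q c (fun t => phi t - psi t) = jackson q c phi - jackson q c psi.
Proof.
move=> /jacksonP[S [h ->]] /jacksonP[T [h' ->]]; rewrite -mulrBr; apply: jacksonE.
by apply: eq_csums (csumsB h h') => x; rewrite /jackson_term mulrBr.
Qed.

Lemma jackson_sum (c : R) N (phi : 'I_N -> R -> C) : (forall k, jackson_integrable q c (phi k)) ->
  jackson_integrable q c (fun t => \sum_k phi k t) /\
  jackson q c (fun t => \sum_k phi k t) = \sum_k jackson q c (phi k).
Proof.
move=> h; rewrite /jackson -big_distrr /=; apply: jacksonE.
have := csums_sum (index_enum 'I_N) (fun k => csumsP (h k)); apply: eq_csums => x.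
by rewrite /jackson_term -big_distrr.
Qed.

(** The dilation is a shift of the lattice index. *)
Lemma jackson_dilate (c : R) (m : int) phi : jackson_integrable q c phi ->
  jackson_integrable q c (fun t => phi (q ^ (2 * m) * t)) /\
  jackson q c (fun t => phi (q ^ (2 * m) * t)) = (q ^ (- (2 * m)))%:C * jackson q c phi.
Proof.
move=> /jacksonP[S [h ->]]; rewrite mulrCA; apply: jacksonE.
pose sh (x : int * bool) := (x.1 + m, x.2).
have bsh : bijective sh.
  by exists (fun x => (x.1 - m, x.2)) => -[x b]; rewrite /sh /= ?addrK ?subrK.
have := (csums_bij (jackson_term q c phi) _ bsh).2 h.
move=> /(csumsZ (q ^ (- (2 * m)))%:C); apply: eq_csums => -[x b].
rewrite /jackson_term /lat_pt /sh /= mulrDr expfzDr //.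
have -> : (-1) ^+ b * (q ^ (2 * x) * q ^ (2 * m) * c) =
    q ^ (2 * m) * ((-1) ^+ b * (q ^ (2 * x) * c)) by ring.
rewrite mulrA -rmorphM; congr (_%:C * _).
have -> : q ^ (- (2 * m)) = (q ^ (2 * m))^-1 by rewrite -invr_expz.
by field; rewrite expfz_neq0.
Qed.

Lemma jackson_odd (c : R) phi : jackson_integrable q c phi ->
  (forall t, phi (- t) = - phi t) -> jackson q c phi = 0.
Proof.
move=> /jacksonP[S [h ->]] od.
have bsh : bijective (fun x : int * bool => (x.1, ~~ x.2)).
  by exists (fun x => (x.1, ~~ x.2)) => -[x b]; rewrite /= negbK.
have h' := (csums_bij (jackson_term q c phi) _ bsh).2 h.
have : csums (jackson_term q c phi) (- S).
  apply: eq_csums (csumsN h') => -[x b]; rewrite /jackson_term /=.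
  have -> : lat_pt q c (x, ~~ b) = - lat_pt q c (x, b).
    by rewrite /lat_pt /= signrN mulNr.
  by rewrite od mulrN opprK.
move=> [_]; case: h => _ -> /eqP; rewrite -addr_eq0 -mulr2n mulrn_eq0 /= => /eqP ->.
by rewrite mulr0.
Qed.

Lemma normc_ser_le (a : nat -> C) z : entire_coef1 a -> normc z <= 1 ->
  normc (ser a z) <= 2 * rsum (fun k => normc (a k)).
Proof.
move=> ea z1; have [sa sE] := csums_ser z ea; rewrite -sE.
apply: le_trans (normc_csum sa) _; rewrite ler_pM2l // ler_rsum //.
  by apply: rsummable_le (ea 1 ler01) => k; rewrite expr1n mulr1.
move=> k; rewrite normcM normcX ler_piMr ?normc_ge0 // exprn_ile1 //; exact: normc_ge0.
Qed.

Lemma lat_pt_le1 (x : int * bool) : (0 <= x.1)%R -> `|lat_pt q 1 x| <= 1.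
Proof.
case: x => -[m|//] b _; rewrite lat_pt_norm // normr1 mulr1 /= -PoszM -exprnP.
by rewrite exprn_ile1 ?(ltW q0) // ltW //; case/andP: hq.
Qed.

Lemma jackson_integrable_Ecoef (r : {poly C}) :
  jackson_integrable q 1 (fun t => r.[t%:C] * ser Ec t%:C).
Proof.
have eE := entire_Ecoef hq; have er := entire_mulc r eE.
apply: (jackson_integrable_bound hq (M := 2 * rsum (fun k => normc (mulc r Ec k)))) => [|x x0|x x0].
- exact: oner_neq0.
- rewrite -ser_mulc //; apply: normc_ser_le => //.
  by rewrite normc_real lat_pt_le1.
- rewrite ser_Ecoef_lat // mulr0 normc0 mulr0 mulr_ge0 // rsum_ge0_ge0 // => k.
  exact: normc_ge0.
Qed.

Definition muE (k : nat) : C := jackson q 1 (fun t => t%:C ^+ k * ser Ec t%:C).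

Lemma jackson_integrable_muE k : jackson_integrable q 1 (fun t => t%:C ^+ k * ser Ec t%:C).
Proof.
have := jackson_integrable_Ecoef 'X^k; congr jackson_integrable.
by apply/funext => t; rewrite hornerXn.
Qed.

Lemma muE_odd k : odd k -> muE k = 0.
Proof.
move=> ok; apply: jackson_odd; first exact: jackson_integrable_muE.
by move=> t; rewrite rmorphN ser_Ecoef_odd exprNn -signr_odd ok expr1 mulN1r mulNr.
Qed.

(** Dilation by q^(-2) preserves the lattice and turns E(t) into (1 - t^2) E(t); evaluating the
    dilated moment in both ways gives the recurrence. *)
Lemma muEP : qexp_moment p^-1 (-1) muE.
Proof.
split=> [|m]; first exact: muE_odd.
have [_ h1] := jackson_dilate (-1) (jackson_integrable_muE m).
have [i2 h2] := jacksonB (jackson_integrable_muE m) (jackson_integrable_muE m.+2).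
have [_ h3] := jacksonZ (p ^- m) i2.
have pn0 : p != 0 := p_neq0 hq.
have E : (fun t => (q ^ (2 * -1) * t)%:C ^+ m * ser Ec (q ^ (2 * -1) * t)%:C) =
    fun t => p ^- m * (t%:C ^+ m * ser Ec t%:C - t%:C ^+ m.+2 * ser Ec t%:C).
  apply/funext => t; have -> : (q ^ (2 * -1) * t)%:C = p^-1 * t%:C.
    by rewrite realCM -realCV mulrN1 -invr_expz.
  rewrite (ser_Ecoef hq) exprMn exprVn -[m.+2]addn2 exprD.
  by ring.
have {}h1 := etrans (congr1 (jackson q 1) (esym E)) h1.
have {}h1 := etrans (esym h3) h1; rewrite h2 mulrN opprK in h1.
have := congr1 (fun x => p ^+ m * x) h1; rewrite /= mulrA divff ?expf_neq0 // mul1r.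
rewrite -/(muE m) -/(muE m.+2) mulr1 => h4.
rewrite exprVn invrK exprS mulN1r -[muE m.+2](subKr (muE m)) h4 -exprnP; ring.
Qed.

Lemma lat_moment_mulc e (r : {poly C}) :
  jackson_integrable q 1 (fun t => ser (shiftc e (mulc r Ec)) t%:C) /\
  lat_moment q (shiftc e (mulc r Ec)) = momc r muE e.
Proof.
have eE := entire_Ecoef hq; have er := entire_mulc r eE.
have -> : lat_moment q (shiftc e (mulc r Ec)) = jackson q 1 (fun t => ser (shiftc e (mulc r Ec)) t%:C) by [].
have -> : (fun t => ser (shiftc e (mulc r Ec)) t%:C) = fun t : R =>
   \sum_(k < size r) r`_k * (t%:C ^+ (e + k) * ser Ec t%:C).
  apply/funext => t; rewrite ser_shiftc // ser_mulc // horner_coef mulr_suml mulr_sumr.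
  by apply: eq_bigr => k _; rewrite exprD; ring.
have h (k : 'I_(size r)) := jacksonZ r`_k (jackson_integrable_muE (e + k)).
have [h1 h2] := jackson_sum (fun k => (h k).1); split=> //; rewrite h2.
by apply: eq_bigr => k _; rewrite (h k).2.
Qed.

End JacksonMoments.
(** * Products of one-variable elements *)

Section OneVariableElements.
Variable R : realType.
Local Notation C := R[i].
Variables (q : R) (n : nat) (r : rel 'I_n).
Local Notation qp := (qpser q r).

Definition single (j : 'I_n) (k : nat) : expv n := [ffun i => if i == j then k else 0%N].

Lemma singleP j k i : single j k i = if i == j then k else 0%N.
Proof. by rewrite ffunE. Qed.

Lemma single_add j k (b : expv n) i :
  (single j k + b) i = (if i == j then k + b i else b i)%N.
Proof. by rewrite [LHS]ffunE singleP; case: eqP. Qed.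

Lemma singleD j k l : single j k + single j l = single j (k + l).
Proof. by apply/ffunP => i; rewrite single_add !singleP; case: eqP. Qed.

Lemma single0 j : single j 0 = 0.
Proof. by apply/ffunP => i; rewrite singleP ffunE if_same. Qed.

Lemma expv_subE (e a : expv n) i : expv_sub e a i = (e i - a i)%N.
Proof. by rewrite ffunE. Qed.

Lemma qmulE (f g : qp) e : (f * g) e = \sum_(a <- below e)
    (q ^+ twist r a (expv_sub e a))%:C * (f a * g (expv_sub e a)).
Proof. by []. Qed.

Lemma qaddE (f g : qp) e : (f + g) e = f e + g e. Proof. by []. Qed.
Lemma qscaleE (w : C) (f : qp) e : (w *: f) e = w * f e. Proof. by []. Qed.

Lemma qsumE (I : Type) (s : seq I) (F : I -> qp) e : (\sum_(i <- s) F i) e = \sum_(i <- s) F i e.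
Proof. by elim: s => [|i s IH]; rewrite ?big_nil // !big_cons qaddE IH. Qed.

Lemma qmulZl (w : C) (f g : qp) : (w *: f) * g = w *: (f * g).
Proof.
apply/funext => e; rewrite qscaleE !qmulE big_distrr /=; apply: eq_bigr => a _.
by rewrite qscaleE; ring.
Qed.

Lemma qmulZr (w : C) (f g : qp) : f * (w *: g) = w *: (f * g).
Proof.
apply/funext => e; rewrite qscaleE !qmulE big_distrr /=; apply: eq_bigr => a _.
by rewrite qscaleE; ring.
Qed.

Lemma qmonMlE (f : qp) b e : (qmon q r b * f) e =
  if b \in below e then (q ^+ twist r b (expv_sub e b))%:C * f (expv_sub e b) else 0.
Proof. exact: qmonMl. Qed.

Lemma qmonMrE (f : qp) b e : (f * qmon q r b) e =
  if b \in below e then (q ^+ twist r (expv_sub e b) b)%:C * f (expv_sub e b) else 0.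
Proof.
case: ifPn => be.
  have eE : e = expv_sub e b + b by rewrite addrC expv_subK.
  by rewrite {1}eE; exact: qmonMr.
rewrite qmulE big_seq big1 // => a ae; rewrite /qmon; case: eqP => [ab|_]; last by rewrite !mulr0.
case/negP: be; rewrite -ab mem_below; apply/forallP => i; rewrite expv_subE leq_subr //.
Qed.

Lemma twist_single j k (b : expv n) : twist r (single j k) b = (k * \sum_(i < n | r j i) b i)%N.
Proof.
rewrite /twist (bigD1 j) //= [X in (_ + X)%N]big1 => [|i /negPf ij].
  rewrite addn0 big_distrr /=; apply: eq_bigr => i _; by rewrite singleP eqxx.
by rewrite big1 // => l _; rewrite singleP ij.
Qed.

Lemma twist_single2 j k l : ~~ r j j -> twist r (single j k) (single j l) = 0%N.
Proof.
move=> rj; rewrite twist_single big1 ?muln0 // => i rji; rewrite singleP.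
by case: eqP => // ij; rewrite ij (negPf rj) in rji.
Qed.

Hypothesis rirr : irreflexive r.

Lemma qmon_singleM j k l :
  qmon q r (single j k) * qmon q r (single j l) = qmon q r (single j (k + l)).
Proof. by rewrite qmonM twist_single2 ?rirr // expr0 scale1r singleD. Qed.

Lemma qgenX j k : (qgen q r j) ^+ k = qmon q r (single j k).
Proof.
elim: k => [|k IH]; first by rewrite expr0 single0.
have -> : qgen q r j = qmon q r (single j 1).
  by congr qmon; apply/ffunP => i; rewrite !ffunE; case: eqP.
rewrite exprS; have -> : qmon q r (single j 1) ^+ k = qmon q r (single j k).
  rewrite -IH; congr (_ ^+ _); congr qmon; apply/ffunP => i; rewrite !ffunE; by case: eqP.
by rewrite qmon_singleM.
Qed.

(** The series with coefficients [a] in the single generator j. *)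
Definition uni (j : 'I_n) (a : nat -> C) : qp :=
  fun e => if e == single j (e j) then a (e j) else 0.

Lemma single_below j k (e : expv n) : (single j k \in below e) = (k <= e j)%N.
Proof.
rewrite mem_below; apply/forallP/idP => [/(_ j)|kj i]; rewrite singleP ?eqxx //.
by case: eqP => [->|].
Qed.

Lemma uni_sub (j : 'I_n) k (e : expv n) : (k <= e j)%N ->
  (expv_sub e (single j k) == single j (expv_sub e (single j k) j)) = (e == single j (e j)).
Proof.
move=> ke; apply/eqP/eqP => /ffunP h; apply/ffunP => i; have := h i.
  by rewrite !singleP !expv_subE !singleP; case: eqP => [->|] //; rewrite subn0.
by rewrite !singleP !expv_subE !singleP; case: eqP => [->|_ ->]; rewrite ?eqxx.
Qed.

Lemma uni_mon j a k : uni j a * qmon q r (single j k) = uni j (shiftc k a) /\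
  qmon q r (single j k) * uni j a = uni j (shiftc k a).
Proof.
split; apply/funext => e; rewrite (qmonMrE, qmonMlE) single_below /uni /shiftc ltnNge;
  (case: leqP => //= ke; last by rewrite if_same);
  (rewrite uni_sub //; case: eqP => [->|_]; last by rewrite mulr0);
  (have -> : expv_sub (single j (e j)) (single j k) = single j (e j - k)
    by apply/ffunP => i; rewrite expv_subE !singleP; case: eqP);
  by rewrite !singleP eqxx twist_single2 ?rirr // expr0 mul1r.
Qed.

Lemma uniM_qpoly j a (p : {poly C}) : uni j a * Defs.qpoly p (qgen q r j) = uni j (mulc p a).
Proof.
rewrite /Defs.qpoly mulr_sumr; apply/funext => e; rewrite qsumE /uni /mulc /ppair.
transitivity (\sum_(k < size p) p`_k * uni j (shiftc k a) e).
  by apply: eq_bigr => k _; rewrite qgenX qmulZr (uni_mon _ _ _).1 qscaleE.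
rewrite /uni; case: eqP => // _; by rewrite big1 // => k _; rewrite mulr0.
Qed.

Lemma qpolyM_uni j a (p : {poly C}) : Defs.qpoly p (qgen q r j) * uni j a = uni j (mulc p a).
Proof.
rewrite /Defs.qpoly mulr_suml; apply/funext => e; rewrite qsumE /uni /mulc /ppair.
transitivity (\sum_(k < size p) p`_k * uni j (shiftc k a) e).
  by apply: eq_bigr => k _; rewrite qgenX qmulZl (uni_mon _ _ _).2 qscaleE.
rewrite /uni; case: eqP => // _; by rewrite big1 // => k _; rewrite mulr0.
Qed.

Lemma qcomp_square j (h : nat -> C) (w : C) :
  qcomp h (w *: qgen q r j ^+ 2) =
  uni j (fun m => if odd m then 0 else h m./2 * w ^+ m./2).
Proof.
have pw k : (w *: qgen q r j ^+ 2) ^+ k = w ^+ k *: qmon q r (single j k.*2).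
  elim: k => [|k IH]; first by rewrite !expr0 scale1r single0.
  by rewrite exprS IH qgenX qmulZl qmulZr qmon_singleM scalerA -exprS doubleS.
apply/funext => e; rewrite /qcomp /uni.
under eq_bigr do rewrite pw qscaleE /qmon.
case: eqP => [eE|ne]; last first.
  rewrite big1 // => k _; case: eqP => [ek|_]; last by rewrite !mulr0.
  by case: ne; rewrite ek singleP eqxx.
have sume : (\sum_(i < n) e i = e j)%N.
  rewrite (bigD1 j) //= big1 ?addn0 // => i /negPf ij.
  by rewrite eE singleP ij.
rewrite sume; have [oj|ej] := boolP (odd (e j)).
  rewrite big1 // => k _; case: eqP => [ek|_]; last by rewrite !mulr0.
  have ejk : e j = k.*2 by apply: etrans (congr1 (fun f : expv n => f j) ek) _; rewrite singleP eqxx.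
  by rewrite (etrans (congr1 odd ejk) (odd_double k)) in oj.
(* The only contributing power, k = e_j / 2, lies within the truncation k <= |e| of [qcomp]. *)
have hk : ((e j)./2 < (e j).+1)%N by rewrite ltnS; lia.
rewrite (bigD1 (Ordinal hk)) //= even_halfK // -eE eqxx mulr1 big1 ?addr0 // => k /eqP nk.
case: eqP => [ek|_]; last by rewrite !mulr0.
have ejk : e j = k.*2 by apply: etrans (congr1 (fun f : expv n => f j) ek) _; rewrite singleP eqxx.
by case: nk; apply: val_inj; exact: esym (etrans (congr1 half ejk) (doubleK k)).
Qed.

(** As f does not involve generator i, a single splitting of e contributes to the convolution. *)
Lemma uniM i a (f : qp) (e : expv n) : (forall b : expv n, b i != 0%N -> f b = 0) ->
  (uni i a * f) e =
  (q ^+ twist r (single i (e i)) (setl i 0 e))%:C * (a (e i) * f (setl i 0 e)).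
Proof.
move=> f0; rewrite qmulE (bigD1_seq (single i (e i))) ?below_uniq //=; last first.
  by rewrite single_below.
have -> : expv_sub e (single i (e i)) = setl i 0 e.
  by apply/ffunP => k; rewrite expv_subE singleP ffunE; case: eqP => [->|_]; rewrite ?subnn ?subn0.
rewrite /uni singleP !eqxx big_seq_cond big1 ?addr0 // => b /andP[be nb].
case: eqP => [bE|_]; last by rewrite mul0r mulr0.
rewrite f0 ?mulr0 // expv_subE subn_eq0 -ltnNge ltn_neqAle.
move: be; rewrite mem_below => /forallP/(_ i) ->; rewrite andbT.
by apply: contraNneq nb => <-; rewrite -bE.
Qed.

Definition supp_on (s : seq 'I_n) (e : expv n) := [forall i, (i \notin s) ==> (e i == 0%N)].

Lemma supp_on_cons i s (e : expv n) : i \notin s -> supp_on s (setl i 0 e) = supp_on (i :: s) e.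
Proof.
move=> is_; apply/forallP/forallP => h j; have := h j; rewrite ffunE inE negb_or.
  by case: (j == i).
by case: (j == i); rewrite //= implybT.
Qed.

(* With the factors in the reverse of the normal order every pair contributes. *)
Lemma prod_uni_rev (a : 'I_n -> nat -> C) s : uniq s -> pairwise (fun i j => ~~ r j i) s ->
  \prod_(j <- s) uni j (a j) = (fun e => if supp_on s e then
    (q ^+ twist r e e)%:C * \prod_(j <- s) a j (e j) else 0) :> qp.
Proof.
elim: s => [_ _|i s IH /= /andP[is_ us] /andP[ris prs]].
  apply/funext => e; rewrite !big_nil; have -> : supp_on [::] e = (e == 0).
    apply/forallP/eqP => [h|-> j]; last by rewrite ffunE eqxx.
    by apply/ffunP => j; rewrite ffunE; exact/eqP/(h j).
  rewrite -[LHS]/((e == 0)%:R : C); case: eqP => // ->.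
  by rewrite twist0l expr0 mulr1.
apply/funext => e; rewrite big_cons IH // uniM; last first.
  move=> b bi; case: ifP => // /forallP/(_ i); rewrite is_ /= => /eqP b0.
  by rewrite b0 in bi.
rewrite supp_on_cons //; case: ifPn => se; last by rewrite !mulr0.
have eE : e = single i (e i) + setl i 0 e.
  by apply/ffunP => j; rewrite single_add ffunE; case: eqP => [->|_]; rewrite ?addn0.
have -> : twist r e e = (twist r (single i (e i)) (setl i 0 e) +
    twist r (setl i 0 e) (setl i 0 e))%N.
  rewrite {1 2}eE !twistDl !twistDr twist_single2 ?rirr // add0n.
  suff -> : twist r (setl i 0 e) (single i (e i)) = 0%N by rewrite add0n.
  rewrite /twist big1 // => k _; rewrite big1 // => l rkl; rewrite singleP.
  case: eqP rkl => [->|_ _]; last by rewrite muln0.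
  move=> rki; rewrite ffunE; case: eqP => // _; have [ks|kns] := boolP (k \in s).
    by move/allP: ris => /(_ k ks); rewrite rki.
  have /forallP/(_ k) := se; rewrite inE negb_or kns andbT.
  by case: eqP rki => [->|_ _ /eqP -> //]; rewrite rirr.
rewrite exprD rmorphM /= big_cons.
have -> : \prod_(j <- s) a j (setl i 0 e j) = \prod_(j <- s) a j (e j).
  apply: eq_big_seq => j js; rewrite ffunE; case: eqP => // ji.
  by rewrite -ji js in is_.
by ring.
Qed.

(* With the factors in normal order no commutation is needed. *)
Lemma prod_uni (a : 'I_n -> nat -> C) s : uniq s -> pairwise (fun i j => ~~ r i j) s ->
  \prod_(j <- s) uni j (a j) = (fun e => if supp_on s e then
    \prod_(j <- s) a j (e j) else 0) :> qp.
Proof.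
elim: s => [_ _|i s IH /= /andP[is_ us] /andP[ris prs]].
  apply/funext => e; rewrite !big_nil; have -> : supp_on [::] e = (e == 0).
    apply/forallP/eqP => [h|-> j]; last by rewrite ffunE eqxx.
    by apply/ffunP => j; rewrite ffunE; exact/eqP/(h j).
  by rewrite -[LHS]/((e == 0)%:R : C); case: eqP.
apply/funext => e; rewrite big_cons IH // uniM; last first.
  move=> b bi; case: ifP => // /forallP/(_ i); rewrite is_ /= => /eqP b0.
  by rewrite b0 in bi.
rewrite supp_on_cons //; case: ifPn => se; last by rewrite !mulr0.
have -> : twist r (single i (e i)) (setl i 0 e) = 0%N.
  rewrite twist_single big1 ?muln0 // => k rik; rewrite ffunE; case: eqP => // ki.
  have [ks|kns] := boolP (k \in s).
    by move/allP: ris => /(_ k ks); rewrite rik.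
  have /forallP/(_ k) := se; rewrite inE negb_or kns andbT.
  by case: eqP ki => // _ _ /eqP.
rewrite expr0 mul1r big_cons; congr (_ * _).
apply: eq_big_seq => j js; rewrite ffunE; case: eqP => // ji.
by rewrite -ji js in is_.
Qed.

End OneVariableElements.
(** * The transform F'' of Gaussian products *)

Section TransformF.
Variable R : realType.
Local Notation C := R[i].
Variables (q : R) (hq : 0 < q < 1) (n : nat).
Local Notation Ec := (@Ecoef R q).
Local Notation ltr := (fun i j : 'I_n => (j < i)%N).
Local Notation tw := (@twist n ltr).
Let q0 : 0 < q. Proof. by case/andP: hq. Qed.
Let qn0 : q != 0. Proof. by rewrite gt_eqF. Qed.

(** The normally ordered form of h_n(x_n) ... h_1(x_1); the twist is the cost of reversing the
    factors. *)
Definition Aprod (h : 'I_n -> nat -> C) : qA q n :=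
  fun e => (q ^+ tw e e)%:C * \prod_j h j (e j).

Lemma ltr_irr : irreflexive ltr. Proof. by move=> i; exact: ltnn. Qed.

Lemma pairwise_rev_enum : pairwise (fun i j : 'I_n => (j < i)%N) (rev (enum 'I_n)).
Proof.
have trans : transitive (fun i j : 'I_n => (j < i)%N).
  by move=> j i k ji kj; exact: ltn_trans kj ji.
have trans' : transitive (fun i j : 'I_n => (i < j)%N).
  by move=> j i k; exact: ltn_trans.
rewrite -(sorted_pairwise trans) rev_sorted (sorted_pairwise trans').
rewrite -(pairwise_map (@nat_of_ord n) ltn) val_enum_ord.
by rewrite -(sorted_pairwise ltn_trans) iota_ltn_sorted.
Qed.

Lemma supp_on_rev_enum (e : expv n) : supp_on (rev (enum 'I_n)) e.
Proof. by apply/forallP => i; rewrite mem_rev mem_enum. Qed.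

Lemma prod_rev_enum (F : 'I_n -> C) : \prod_(j <- rev (enum 'I_n)) F j = \prod_j F j.
Proof.
rewrite (perm_big (enum 'I_n)) ?big_enum //.
by rewrite perm_rev.
Qed.

Lemma AeltE (p : 'I_n -> {poly C}) : Aelt q p = Aprod (fun j => mulc (p j) Ec).
Proof.
rewrite /Aelt; under eq_bigr do rewrite /Egauss (qcomp_square _ ltr_irr) (uniM_qpoly _ ltr_irr).
rewrite (prod_uni_rev _ ltr_irr) ?rev_uniq ?enum_uniq //; last first.
  by apply: sub_pairwise pairwise_rev_enum => i j ji; rewrite -leqNgt ltnW.
by apply/funext => e; rewrite supp_on_rev_enum prod_rev_enum.
Qed.

(** With a = b + e, the twist tw b b + tw b e equals tw a a - tw e a: the full quadratic form in a,
    as [aform] requires, and a correction linear in a that becomes the exponents [nu]. *)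
Lemma Aprod_qmon h e : (Aprod h * qmon q _ e : qA q n) =
  aform q 1 (fun j => - (\sum_(i < n | (j < i)%N) e i)%N%:Z) (fun j => shiftc (e j) (h j)).
Proof.
apply/funext => a; rewrite qmonMrE /aform mul1r mem_below.
case: ifPn => [/forallP ea|/forallPn[j]]; last first.
  rewrite -ltnNge => aj; rewrite (bigD1 j) //= [shiftc _ _ _](_ : _ = 0).
    by rewrite mulr0 mul0r mulr0.
  by rewrite /shiftc aj.
set b := expv_sub a e; have ab : a = b + e.
  by rewrite addrC /b expv_subK // mem_below; apply/forallP.
have -> : \prod_(j < n) ((q ^ (- (\sum_(i < n | (j < i)%N) e i)%N%:Z * (a j)%:Z))%:C *
    shiftc (e j) (h j) (a j)) =
    (q ^- (\sum_(j < n) (\sum_(i < n | (j < i)%N) e i) * a j))%:C * \prod_(j < n) h j (b j).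
  rewrite big_split /=; congr (_ * _).
    rewrite -rmorph_prod -prodrXr -prodfV; congr (_ %:C); apply: eq_bigr => j _.
    by rewrite mulNr -PoszM -exprnN.
  by apply: eq_bigr => j _; rewrite /shiftc ltnNge ea /= /b expv_subE.
have -> : (\sum_(j < n) (\sum_(i < n | (j < i)%N) e i) * a j = tw e a)%N.
  rewrite /twist (exchange_big_dep xpredT) //=.
  rewrite (eq_bigr (fun j : 'I_n => \sum_(i < n | (j < i)%N) e i * a j)%N) //.
  by move=> j _; rewrite big_distrl.
rewrite {1 2}ab twistDl -/tw -ab.
have -> : (tw b a + tw e a = tw b b + tw b e + tw e a)%N by rewrite {1}ab twistDr.
rewrite exprD mulrA -rmorphM mulfK ?expf_neq0 //.
by rewrite /Aprod mulrA -rmorphM -exprD addnC.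
Qed.

Variables (sigma : 'S_n) (gamma : 'I_n -> R) (B : 'I_n -> nat).
Local Notation sseq := [seq sigma k | k <- enum 'I_n].
Hypothesis gammaE : forall k : 'I_n, gamma (sigma k) =
  q ^+ (B (sigma k) + k + #|[pred j : 'I_n | (j < k)%N && (sigma k < sigma j)%N]|).

(** The contribution of the order of integration. It involves neither the lattice nor the monomial,
    so F'' with gamma and the constant with tgamma share it. *)
Definition lat_const : C := (q ^ lat_exp sseq (fun=> 0))%:C.

Lemma perm_sseq : perm_eq sseq (enum 'I_n).
Proof.
apply: uniq_perm => [||i].
- by rewrite (map_inj_uniq (@perm_inj _ sigma)) enum_uniq.
- exact: enum_uniq.
rewrite mem_enum; apply/mapP; exists (sigma^-1%g i); first by rewrite mem_enum.
by rewrite permKV.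
Qed.

(** The exponent that cancels the power of q in the coefficients of F''. *)
Lemma sum_above (e : expv n) : (\sum_(j < n) \sum_(i < n | (j < i)%N) e i = \sum_(i < n) i * e i)%N.
Proof.
rewrite (exchange_big_dep xpredT) //=; apply: eq_bigr => i _.
rewrite sum_nat_const; congr (_ * _)%N.
rewrite -sum1_card -(big_ord_widen n (fun=> 1%N) (ltnW (ltn_ord i))).
by rewrite sum_nat_const card_ord muln1.
Qed.

Lemma shiftc_mulc_even (r : {poly C}) e k : poly_parity (odd e) r -> odd k ->
  shiftc e (mulc r Ec) k = 0.
Proof.
move=> pr ok; rewrite /shiftc; case: ltnP => // ek.
apply: (mulc_parity0 (@Ecoef_odd R q) pr).
by rewrite oddB // ok; case: odd.
Qed.

(** [B] is kept abstract for two uses: the upper sums of the sign vector for gamma, and their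
    doubles for tgamma, where e = 0. *)
Lemma lat_Aprod (p : 'I_n -> {poly C}) (e : expv n) :
  (forall j, poly_parity (odd (e j)) (p j)) ->
  (forall j : 'I_n, odd (\sum_(i < n | (j < i)%N) e i) = odd (B j)) ->
  let f : qA q n := Aprod (fun j => mulc (p j) Ec) * qmon q _ e in
  lat_integrable sigma gamma f /\
  lat_integral sigma gamma f = lat_const * (q ^+ (\sum_(i < n) i * e i))%:C *
     \prod_j momc (p j) (muE q) (e j).
Proof.
move=> pp pB f; have eE := entire_Ecoef hq.
have fE : f = _ := Aprod_qmon _ _.
have eh j : entire_coef1 (shiftc (e j) (mulc (p j) Ec)).
  by apply: entire_shiftc; exact: entire_mulc.
have ev j k : odd k -> shiftc (e j) (mulc (p j) Ec) k = 0 by exact: shiftc_mulc_even.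
have par : lat_parity q gamma sseq (fun j => - (\sum_(i < n | (j < i)%N) e i)%N%:Z).
  apply: (lat_parity_perm hq gammaE) => i.
  have := pB i; set S := (\sum_(_ < n | _) _)%N => oS.
  have [m hm] : exists m : nat, (B i + S = m.*2)%N.
    by exists (B i + S)./2; rewrite even_halfK // oddD oS; case: odd.
  by exists (m%:Z - S%:Z); lia.
have us : uniq sseq by rewrite (perm_uniq perm_sseq) enum_uniq.
have [h1 h2] := lat_aform_seq hq 1 us eh ev (fun i _ => (lat_moment_mulc hq (e i) (p i)).1) par.
split.
  split; last by rewrite fE.
  rewrite fE; apply/near_CnP; exists 1 => // z _.
  by apply: psummable_entire; exact: entire_aform.
rewrite /lat_integral fE h2 mul1r.
have -> : \prod_(i | i \notin sseq) shiftc (e i) (mulc (p i) Ec) 0%N = 1.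
  by rewrite big1 // => i; rewrite (perm_mem perm_sseq) mem_enum.
rewrite mulr1 (perm_big _ perm_sseq) /= big_enum /=; congr (_ * _); last first.
  by apply: eq_bigr => j _; rewrite (lat_moment_mulc hq (e j) (p j)).2.
have -> : (fun j : 'I_n => - (\sum_(i < n | (j < i)%N) e i)%N%:Z) =
    (fun j : 'I_n => 0 - (\sum_(i < n | (j < i)%N) e i)%N%:Z) by apply/funext => j; rewrite sub0r.
rewrite lat_expB expfzDr // rmorphM; congr (_ * _).
rewrite (perm_big _ perm_sseq) /= big_enum /= -(big_morph Posz PoszD erefl).
by rewrite sum_above.
Qed.

Hypothesis n0 : (0 < n)%N.

Lemma lat_Aprod0 (p : 'I_n -> {poly C}) (b : 'I_n -> bool) (e : expv n) j :
  (forall j, poly_parity (b j) (p j)) -> odd (e j) != b j ->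
  let f : qA q n := Aprod (fun j => mulc (p j) Ec) * qmon q _ e in
  lat_integrable sigma gamma f /\ lat_integral sigma gamma f = 0.
Proof.
move=> pp oe f; have eE := entire_Ecoef hq.
have fE : f = _ := Aprod_qmon _ _.
have f0 : even_part f = fun=> 0.
  apply/funext => a; rewrite /even_part; case: ifPn => // /forallP/(_ j) /negPf ea.
  rewrite fE /aform (bigD1 j) //= [shiftc _ _ _](_ : _ = 0); first by rewrite mulr0 mul0r mulr0.
  rewrite /shiftc; case: ltnP => // ej.
  apply: (mulc_parity0 (@Ecoef_odd R q) (pp j)).
  by rewrite oddB // ea; move: oe; case: odd; case: (b j).
have [l [s ls]] : exists l s, sseq = l :: s.
  case E : sseq => [|l s]; last by exists l, s.
  by have := congr1 size E; rewrite size_map size_enum_ord => n00; move: (n0); rewrite n00.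
have [h1 h2] := lat_zero_seq q gamma l s f0.
split; last by rewrite /lat_integral ls.
split; last by rewrite ls.
rewrite fE; apply/near_CnP; exists 1 => // z _.
apply: psummable_entire; apply: entire_aform => // i.
by apply: entire_shiftc; exact: entire_mulc.
Qed.

Lemma Ftrans_Aprod (p : 'I_n -> {poly C}) (b : 'I_n -> bool) :
  (forall j, poly_parity (b j) (p j)) ->
  (forall j : 'I_n, odd (\sum_(i < n | (j < i)%N) b i) = odd (B j)) ->
  let f := Aprod (fun j => mulc (p j) Ec) in
  Ftrans_def sigma gamma f /\
  Ftrans sigma gamma f =
    fun e => lat_const * \prod_j (Fcoef q (e j) * momc (p j) (muE q) (e j)).
Proof.
move=> pp pB f.
have H (e : expv n) : lat_integrable sigma gamma (f * qmon q _ e) /\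
  lat_integral sigma gamma (f * qmon q _ e) = lat_const * (q ^+ (\sum_(i < n) i * e i))%:C *
     \prod_j momc (p j) (muE q) (e j).
  (* A wrong parity in one variable makes both sides zero: the even part on the left, a moment on
     the right. Otherwise e and b have the same parities, and the lattice condition follows from the
     one on B. *)
  have [/forallP pe|/forallPn[j oj]] := boolP [forall j, odd (e j) == b j]; last first.
    have [h1 h2] := lat_Aprod0 pp oj; split => //; rewrite h2.
    by rewrite [\prod_(_ < _) _](bigD1 j) //= (momc_parity0 (muE_odd hq) (pp j) oj) mul0r mulr0.
  apply: lat_Aprod => j; first by rewrite (eqP (pe j)).
  rewrite -pB; elim/big_ind2: _ => // [x y z t|i _].
    by rewrite !oddD => -> ->.
  by rewrite (eqP (pe i)); case: (b i).
split=> [e|]; first by case: (H e).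
apply/funext => e; rewrite /Ftrans (H e).2 big_split /=.
have -> : \prod_j Fcoef q (e j) =
    'i%C ^+ (\sum_(j < n) e j) / (\prod_(j < n) qpoch (q ^+ 2) (q ^+ 2) (e j))%:C.
  by rewrite -prodrXr rmorph_prod -prodfV -big_split.
have qs : (q ^+ (\sum_(i < n) i * e i))%:C != 0 :> C.
  by rewrite realC_neq0 // expf_neq0.
rewrite (realCV (q ^+ _)).
move: (_%:C) qs => x x0.
move: lat_const (\prod_j momc _ _ _) ('i%C ^+ _) (_%:C^-1) => c m y z.
by field; rewrite x0.
Qed.

(* The coefficient of [(sum_j x_j^2)^k], a q-multinomial theorem. *)
Definition qmultinom (k : nat) (e : expv n) : C :=
  if [forall j, ~~ odd (e j)] && (\sum_(j < n) e j == k.*2)%N then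
    (qpoch (q ^+ 4) (q ^+ 4) k)%:C / (\prod_(j < n) qpoch (q ^+ 4) (q ^+ 4) (e j)./2)%:C
  else 0.

Lemma telescope_qpow (P : C) (m : nat -> nat) N :
  \sum_(j < N) P ^+ (\sum_(i < j) m i) * (1 - P ^+ m j) = 1 - P ^+ (\sum_(i < N) m i).
Proof.
elim: N => [|N IH]; first by rewrite !big_ord0 expr0 subrr.
by rewrite big_ord_recr /= IH [in RHS]big_ord_recr /= exprD; ring.
Qed.

Lemma telescope_expv (P : C) (m : 'I_n -> nat) :
  \sum_(j < n) P ^+ (\sum_(i < n | (i < j)%N) m i) * (1 - P ^+ m j) =
  1 - P ^+ (\sum_(i < n) m i).
Proof.
pose m' k := if insub k is Some i then m i else 0%N.
have mE (i : 'I_n) : m' i = m i by rewrite /m' valK.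
rewrite -(eq_bigr _ (fun i _ => mE i)) -telescope_qpow; apply: eq_bigr => j _.
rewrite mE (big_ord_widen n m' (ltnW (ltn_ord j))); congr (P ^+ _ * _).
by apply: eq_bigr => i _; rewrite mE.
Qed.

(** Multiplying by x_j^2 on the left moves it past the x_i with i < j. For P = q^4 and e = 2m, term
    j enters with weight P^(sum_{i<j} m_i) (1 - P^(m_j)), and these weights telescope to 1 -
    P^(k+1). *)
Lemma qmultinomE k : (\sum_(j < n) qgen q _ j ^+ 2 : qA q n) ^+ k = qmultinom k.
Proof.
elim: k => [|k IH].
  rewrite expr0; apply/funext => e; rewrite -[LHS]/((e == 0)%:R : C) /qmultinom.
  case: eqP => [->|ne].
    rewrite (_ : [forall j, _]); last by apply/forallP => j; rewrite ffunE.
    rewrite big1 => [|j _]; last by rewrite ffunE.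
    rewrite eqxx /= {1}/qpoch big_ord0 big1 ?divr1 // => j _.
    by rewrite ffunE /qpoch big_ord0.
  case: ifP => // /andP[_]; rewrite sum_nat_eq0 => /forallP h; case: ne.
  by apply/ffunP => j; rewrite ffunE; apply/eqP; exact: h.
rewrite exprS IH mulr_suml; apply/funext => e; rewrite qsumE.
under eq_bigr do rewrite (qgenX _ ltr_irr) qmonMlE single_below twist_single.
have [/andP[/forallP ev /eqP se]|] := boolP ([forall j, ~~ odd (e j)] && (\sum_(j < n) e j == k.+1.*2)%N);
  last first.
  move=> ne; rewrite {2}/qmultinom (negPf ne) big1 // => j _; case: leqP => // ej.
  rewrite /qmultinom; case: ifP; rewrite ?mulr0 // => /andP[/forallP ev /eqP se].
  case/negP: ne; apply/andP; split.
    apply/forallP => i; have := ev i; rewrite expv_subE singleP; case: eqP => [->|_]; last by rewrite subn0.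
    by rewrite oddB //= addbF.
  have -> : (\sum_(i < n) e i = \sum_(i < n) expv_sub e (single j 2) i + 2)%N.
    rewrite (bigD1 j) //= [in RHS](bigD1 j) //= expv_subE singleP eqxx addnAC subnK //.
    congr (_ + _)%N; apply: eq_bigr => i /negPf ij.
    by rewrite expv_subE singleP ij subn0.
  by rewrite se addn2 -doubleS.
pose P : C := (q ^+ 4)%:C; pose m (j : 'I_n) := (e j)./2.
have em j : e j = (m j).*2 by rewrite /m even_halfK.
have sm : (\sum_(j < n) m j = k.+1)%N.
  apply: double_inj; rewrite -se (eq_bigr _ (fun j _ => em j)).
  by rewrite (big_morph double doubleD (erefl 0%N.*2)).
rewrite {2}/qmultinom (introT forallP ev) se eqxx /=.
pose Q (j : 'I_n) : R := qpoch (q ^+ 4) (q ^+ 4) (m j).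
have Q0 j : Q j != 0 by exact: qpoch_neq0.
have qk := qpochE q 4 k.
transitivity ((qpoch (q ^+ 4) (q ^+ 4) k)%:C / (\prod_(j < n) Q j)%:C *
  \sum_(j < n) P ^+ (\sum_(i < n | (i < j)%N) m i) * (1 - P ^+ m j)); last first.
  by rewrite telescope_expv sm qk mulrAC.
rewrite mulr_sumr; apply: eq_bigr => j _.
case: (leqP 2 (e j)) => ej; last first.
  have -> : m j = 0%N by rewrite /m; case: (e j) ej => [|[]].
  by rewrite expr0 subrr !mulr0.
have -> : (q ^+ (2 * \sum_(i < n | (i < j)%N) expv_sub e (single j 2) i))%:C =
    P ^+ (\sum_(i < n | (i < j)%N) m i) :> C.
  rewrite /P -rmorphXn -exprM; congr (q ^+ _)%:C.
  rewrite (_ : 4 = 2 * 2)%N // -mulnA; congr (2 * _)%N; rewrite big_distrr /=.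
  apply: eq_bigr => i ij; rewrite expv_subE singleP.
  case: eqP ij => [->|_ _]; first by rewrite ltnn.
  by rewrite subn0 em mul2n.
rewrite [RHS]mulrCA; congr (_ * _); rewrite /qmultinom.
have ev' i : expv_sub e (single j 2) i = (if i == j then (m j).-1 else m i).*2.
  rewrite expv_subE singleP; case: eqP => [->|_]; last by rewrite subn0 em.
  by rewrite em; case: (m j) => // m'; rewrite doubleS !subSS subn0.
rewrite (_ : [forall i, _]); last by apply/forallP => i; rewrite ev' odd_double.
have mj0 : (0 < m j)%N by rewrite /m half_gt0.
have -> : (\sum_(i < n) expv_sub e (single j 2) i)%N = k.*2.
  rewrite (eq_bigr _ (fun i _ => ev' i)).
  have -> : (\sum_(i < n) (if i == j then (m j).-1 else m i).*2 =
     (\sum_(i < n) (if i == j then (m j).-1 else m i)).*2)%N.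
    by rewrite (big_morph double doubleD (erefl 0%N.*2)).
  congr _.*2; rewrite (bigD1 j) //= eqxx; move: sm; rewrite (bigD1 j) //=.
  rewrite (_ : (\sum_(i < n | i != j) (if i == j then (m j).-1 else m i) = \sum_(i < n | i != j) m i)%N).
    by rewrite -{1}(prednK mj0) addSn => -[].
  by apply: eq_bigr => i /negPf ->.
rewrite eqxx /=.
have -> : \prod_(i < n) qpoch (q ^+ 4) (q ^+ 4) (expv_sub e (single j 2) i)./2 =
    qpoch (q ^+ 4) (q ^+ 4) (m j).-1 * \prod_(i < n | i != j) Q i.
  rewrite (bigD1 j) //= ev' eqxx doubleK; congr (_ * _).
  by apply: eq_bigr => i /negPf ij; rewrite ev' ij doubleK.
rewrite [\prod_(i < n) Q i](bigD1 j) //= {1}/Q.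
have := qpochE q 4 (m j).-1; rewrite (prednK mj0) => qj.
rewrite !rmorphM /= qj -/P.
have h1 : (qpoch (q ^+ 4) (q ^+ 4) (m j).-1)%:C != 0 :> C by rewrite realC_neq0 // qpoch_neq0.
have h2 : 1 - P ^+ m j != 0.
  by have := realC_neq0 (Q0 j); rewrite /Q -{1}(prednK mj0) qpochE prednK // mulf_eq0 negb_or => /andP[].
have h3 : (\prod_(i < n | i != j) Q i)%:C != 0 :> C.
  by rewrite realC_neq0 // prodf_seq_neq0; apply/allP => i _; rewrite Q0 implybT.
move: h1 h2 h3; move: (P ^+ m j) (\prod_(i < n | i != j) Q i)%:C (qpoch _ _ (m j).-1)%:C (qpoch _ _ k)%:C.
move=> x y z t h1 h2 h3.
by field; rewrite h1 h2 h3.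
Qed.

Lemma qscaleX (w : C) (u : qA q n) k : (w *: u) ^+ k = w ^+ k *: u ^+ k.
Proof.
elim: k => [|k IH]; first by rewrite !expr0 scale1r.
by rewrite !exprS IH qmulZl qmulZr scalerA.
Qed.

(** The twist of e with itself is the sum over unordered pairs, half of the off-diagonal part of the
    square. *)
Lemma sqr_sum_expv (e : expv n) :
  ((\sum_(i < n) e i) ^ 2 = \sum_(i < n) e i ^ 2 + 2 * tw e e)%N.
Proof.
have -> : (2 * tw e e = tw e e + \sum_(i < n) \sum_(j < n | (i < j)%N) e i * e j)%N.
  rewrite mul2n -addnn; congr (_ + _)%N; rewrite /twist (exchange_big_dep xpredT) //=.
  by apply: eq_bigr => i _; apply: eq_bigr => j _; rewrite mulnC.
rewrite addnA -big_split -big_split /= -mulnn big_distrl /=; apply: eq_bigr => i _.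
rewrite big_distrr /= (bigID (fun j : 'I_n => (j < i)%N)) /=.
rewrite [X in (_ + X)%N](bigD1 i) ?ltnn //= mulnn addnCA addnA; congr (_ + _)%N.
by apply: eq_bigl => j; rewrite -leqNgt ltn_neqAle andbC -(inj_eq val_inj) /= eq_sym.
Qed.

Lemma bin2_sqr k : ('C(k, 2) * 2 + k = k ^ 2)%N.
Proof. by elim: k => // k IH; rewrite binS bin1; nia. Qed.

Lemma bin2_sum_expv (m : expv n) :
  ('C(\sum_(i < n) m i, 2) = \sum_(i < n) 'C(m i, 2) + tw m m)%N.
Proof.
have := sqr_sum_expv m; rewrite -bin2_sqr.
under [X in _ = (X + _)%N -> _]eq_bigr do rewrite -bin2_sqr.
rewrite big_split /= -big_distrl /=; lia.
Qed.

(** The symbol (q^4; q^4)_K cancels against the multinomial coefficient. The power q^(4 C(K,2))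
    splits into the one-variable powers and q^(4 tw m m), which for e = 2m is the twist q^(tw e e)
    of [Aprod]. *)
Lemma Egauss_sumE : Egauss_sum q n = Aprod (fun=> Ec).
Proof.
apply/funext => e; rewrite /Egauss_sum /Egauss /qcomp.
under eq_bigr do rewrite qscaleX qscaleE qmultinomE /qmultinom.
have [/forallP ev|/forallPn[j]] := boolP [forall j, ~~ odd (e j)]; last first.
  rewrite negbK => oj; rewrite big1 => [|k _]; last by rewrite !mulr0.
  by rewrite /Aprod (bigD1 j) //= Ecoef_odd // mul0r mulr0.
pose m : expv n := [ffun j => (e j)./2].
have em j : e j = (m j).*2 by rewrite ffunE even_halfK.
have se : (\sum_(j < n) e j = (\sum_(j < n) m j).*2)%N.
  by rewrite (eq_bigr _ (fun j _ => em j)) (big_morph double doubleD (erefl 0%N.*2)).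
set K := (\sum_(j < n) m j)%N in se *.
have hk : (K < (\sum_(j < n) e j).+1)%N by rewrite se; lia.
rewrite (bigD1 (Ordinal hk)) //= [X in _ + X]big1 ?addr0 => [|k /eqP nk]; last first.
  case: eqP => [ek|_]; last by rewrite !mulr0.
  case: nk; apply: val_inj => /=; apply: double_inj.
  by apply: etrans (esym ek) se.
rewrite se eqxx /Aprod.
pose P : C := (q ^+ 4)%:C.
have -> : (\prod_(j < n) qpoch (q ^+ 4) (q ^+ 4) (e j)./2)%:C^-1 =
   \prod_(j < n) (qpoch (q ^+ 4) (q ^+ 4) (m j))%:C^-1 :> C.
  rewrite rmorph_prod -prodfV; apply: eq_bigr => j _; by rewrite ffunE.
have -> : \prod_j Ec (e j) =
   P ^+ (\sum_(j < n) 'C(m j, 2)) * (- P) ^+ K * \prod_(j < n) (qpoch (q ^+ 4) (q ^+ 4) (m j))%:C^-1.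
  rewrite -!prodrXr -!big_split; apply: eq_bigr => j _ /=.
  rewrite /Ecoef (negPf (ev j)) em doubleK /Eq_coef realCM realCV -exprM mulrAC; congr (_ * _ * _).
  by rewrite /P -rmorphXn -exprM.
have -> : (q ^+ tw e e)%:C = P ^+ tw m m.
  rewrite /P -rmorphXn -exprM; congr (q ^+ _)%:C.
  rewrite /twist big_distrr /=; apply: eq_bigr => i _.
  rewrite big_distrr /=; apply: eq_bigr => j _; rewrite !em -!muln2; lia.
have -> : Eq_coef (q ^+ 4) K = P ^+ 'C(K, 2) / (qpoch (q ^+ 4) (q ^+ 4) K)%:C.
  by rewrite /Eq_coef realCM realCV /P -rmorphXn.
rewrite bin2_sum_expv exprD -/P.
have := realC_neq0 (qpoch_neq0 hq K (j := 4) isT).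
move: (_%:C) (P ^+ _) (P ^+ _) ((- P) ^+ K) (\prod_(_ < n) _) => x y z t w x0.
by field; rewrite x0.
Qed.

End TransformF.
(** * Analytic functions of one variable and the Gaussian 1 / (-z^2; q^4)_oo *)

Section Analytic1.
Variable R : realType.
Local Notation C := R[i].

Definition ana1 (f : C -> C) (a : C) := exists (d : nat -> C) (r : R),
  0 < r /\ forall u, normc u < r -> csums (fun k => d k * u ^+ k) (f (a + u)).

Lemma ana1_near (f g : C -> C) a (r : R) : 0 < r ->
  (forall u, normc u < r -> g (a + u) = f (a + u)) -> ana1 f a -> ana1 g a.
Proof.
move=> r0 fg [d [r' [r'0 h]]]; exists d, (Num.min r r'); split; first by rewrite lt_min r0.
by move=> u; rewrite lt_min => /andP[u1 u2]; rewrite fg //; exact: h.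
Qed.

Lemma ana1_cst w a : ana1 (fun=> w) a.
Proof.
exists (fun k => if k == 0%N then w else 0), 1; split=> // u _.
have := @csums_single R nat (fun k => (if k == 0%N then w else 0) * u ^+ k) 0%N.
by rewrite eqxx expr0 mulr1; apply=> k /negPf ->; rewrite mul0r.
Qed.

Lemma csums_recl (a : nat -> C) s : csums (fun k => a k.+1) s -> csums a (a 0%N + s).
Proof.
move=> h; pose b k := if k is k'.+1 then a k else 0.
have hb : csums b s.
  apply/(@csums_inj R nat nat S b s) => [x y []|[|k] out|] //.
  by have := out k; rewrite eqxx.
have h0 := @csums_single R nat (fun k => if k == 0%N then a 0%N else 0) 0%N.
have h1 : csums (fun k => if k == 0%N then a 0%N else 0) (a 0%N) by apply: h0 => j /negPf ->.
have := csumsD h1 hb; apply: eq_csums => -[|k] /=.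
  by rewrite addr0.
by rewrite add0r.
Qed.

Lemma csums_recl_inv (a : nat -> C) s : csums a s -> csums (fun k => a k.+1) (s - a 0%N).
Proof.
move=> h; have h1 : csummable (fun k => a k.+1).
  by apply: (csummable_comp (e := S) (a := a)) => [x y []|] //; case: h.
have [_ <-] := h; have [_ ->] := csums_recl (csumsP h1).
by rewrite addrC addKr.
Qed.

Lemma ana1_id a : ana1 id a.
Proof.
exists (fun k => if k == 0%N then a else (k == 1%N)%:R), 1; split=> // u _.
rewrite -[X in X + u](mulr1 a) -[X in _ * X](expr0 u).
apply: (csums_recl (a := fun k => (if k == 0%N then a else (k == 1%N)%:R) * u ^+ k)).
have := @csums_single R nat (fun k => (k == 0%N)%:R * u ^+ k.+1) 0%N.
rewrite eqxx mul1r expr1; apply=> k /negPf ->; exact: mul0r.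
Qed.

Lemma csums_geo (x : C) : normc x < 1 -> csums (fun k => x ^+ k) (1 - x)^-1.
Proof.
move=> x1; have sx : csummable (fun k => x ^+ k).
  have x01 : 0 <= normc x < 1 by rewrite normc_ge0.
  by apply: csummable_le (rsummable_geo x01) => k; rewrite normcX.
split=> //; have h := csums_recl_inv (csumsP sx).
have h' := csumsZ x (csumsP sx).
have E : csum (fun k => x ^+ k) - x ^+ 0 = x * csum (fun k => x ^+ k).
  rewrite -h.2 -h'.2; congr csum; apply/funext => k; exact: exprS.
have n1 : 1 - x != 0.
  by rewrite subr_eq0; apply: contraTneq x1 => <-; rewrite normc1 ltxx.
apply: (mulfI n1); rewrite divff // mulrBl mul1r -E expr0; ring.
Qed.

Lemma ana1_inv_affine (w v a : C) : v + w * a != 0 -> ana1 (fun z => (v + w * z)^-1) a.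
Proof.
move=> c0; set c := v + w * a in c0 *.
pose x := - w / c; exists (fun k => c^-1 * x ^+ k), (normc x + 1)^-1.
have x1 : 0 < normc x + 1 by rewrite ltr_wpDl ?normc_ge0.
split=> [|u hu]; first by rewrite invr_gt0.
have xu : normc (x * u) < 1.
  rewrite normcM; apply: le_lt_trans (_ : (normc x + 1) * normc u < 1).
    by rewrite ler_wpM2r ?normc_ge0 // lerDl.
  by rewrite mulrC -ltr_pdivlMr // mul1r.
have := csumsZ c^-1 (csums_geo xu).
have -> : (v + w * (a + u))^-1 = c^-1 * (1 - x * u)^-1.
  by rewrite -invfM; congr (_^-1); rewrite /x /c; field.
by apply: eq_csums => k; rewrite exprMn mulrA.
Qed.

Lemma ana1M (f g : C -> C) a : ana1 f a -> ana1 g a -> ana1 (fun z => f z * g z) a.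
Proof.
move=> [d [r [r0 h]]] [d' [r' [r0' h']]].
pose e k := \sum_(i < k.+1) d i * d' (k - i)%N.
exists e, (Num.min r r'); split; first by rewrite lt_min r0.
move=> u; rewrite lt_min => /andP[/h H /h' H'].
have := csums_mul H H'; set s := f (a + u) * g (a + u) => S.
pose phi (x : nat * nat) := ((x.1 + x.2)%N, x.1).
pose G (y : nat * nat) := if (y.2 <= y.1)%N then d y.2 * d' (y.1 - y.2)%N * u ^+ y.1 else 0.
have iphi : injective phi by move=> [x1 x2] [y1 y2] [] /= + e1; rewrite e1 => /addnI ->.
have SG : csums G s.
  apply/(csums_inj _ iphi) => [[k i] out|].
    rewrite /G /=; case: leqP => // ik; have := out (i, (k - i)%N).
    by rewrite /phi /= subnKC // eqxx.
  by apply: eq_csums S => -[i j]; rewrite /G /phi /= leq_addr addKn exprD; ring.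
apply: (csums_pair SG) => k; rewrite /G /= /e.
have := @csums_fin R nat (fun j => if (j <= k)%N then d j * d' (k - j)%N * u ^+ k else 0)
  (iota 0 k.+1) (iota_uniq _ _); case=> [j|_ ->].
  by rewrite mem_iota add0n /= ltnS => /negPf ->.
rewrite -[iota 0 _]/(index_iota 0 k.+1) big_mkord mulr_suml; apply: eq_bigr => i _.
by rewrite -ltnS ltn_ord.
Qed.

Lemma ana1_prod N (f : nat -> C -> C) a : (forall l, (l < N)%N -> ana1 (f l) a) ->
  ana1 (fun z => \prod_(l < N) f l z) a.
Proof.
elim: N => [|N IH] h.
  by apply: ana1_near (ana1_cst 1 a) => [|u _]; [exact: ltr01|rewrite big_ord0].
have := ana1M (IH (fun l lN => h l (ltnW lN))) (h N (ltnSn N)).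
by apply: ana1_near => [|u _]; [exact: ltr01|rewrite big_ord_recr].
Qed.

Lemma ana1X (f : C -> C) a k : ana1 f a -> ana1 (fun z => f z ^+ k) a.
Proof.
move=> h; have := @ana1_prod k (fun _ => f) a (fun _ _ => h).
by apply: ana1_near => [|u _]; [exact: ltr01|rewrite prodr_const card_ord].
Qed.

Lemma ana1D (f g : C -> C) a : ana1 f a -> ana1 g a -> ana1 (fun z => f z + g z) a.
Proof.
move=> [d [r [r0 h]]] [d' [r' [r0' h']]].
exists (fun k => d k + d' k), (Num.min r r'); split; first by rewrite lt_min r0.
move=> u; rewrite lt_min => /andP[/h H /h' H'].
by apply: eq_csums (csumsD H H') => k; rewrite mulrDl.
Qed.

Lemma ana1_horner (p : {poly C}) a : ana1 (fun z => p.[z]) a.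
Proof.
elim/poly_ind: p => [|p c IH].
  by apply: ana1_near (ana1_cst 0 a) => [|u _]; [exact: ltr01|rewrite horner0].
have := ana1D (ana1M IH (ana1_id a)) (ana1_cst c a).
by apply: ana1_near => [|u _]; [exact: ltr01|rewrite hornerMXaddC].
Qed.

Lemma ana1_dilate (f : C -> C) w a : ana1 f (w * a) -> ana1 (fun z => f (w * z)) a.
Proof.
move=> [d [r [r0 h]]]; exists (fun k => d k * w ^+ k), (r / (normc w + 1)).
have w1 : 0 < normc w + 1 by rewrite ltr_wpDl ?normc_ge0.
split=> [|u hu]; first by rewrite divr_gt0.
rewrite mulrDr; have := h (w * u).
have wu : normc (w * u) < r.
  rewrite normcM; apply: le_lt_trans (_ : (normc w + 1) * normc u < r).
    by rewrite ler_wpM2r ?normc_ge0 // lerDl.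
  by rewrite mulrC -ltr_pdivlMr.
by move=> /(_ wu); apply: eq_csums => k; rewrite exprMn mulrA.
Qed.

(** Recentring by binomial expansion, as in [analytic_psum]. *)
Lemma ana1_ser (g : nat -> C) (rho : R) b : rsummable (fun k => normc (g k) * rho ^+ k) ->
  normc b < rho -> ana1 (ser g) b.
Proof.
move=> sg bl; have r0 : 0 < rho - normc b by rewrite subr_gt0.
pose G (u : C) (x : nat * nat) := g x.1 * ('C(x.1, x.2)%:R * b ^+ (x.1 - x.2) * u ^+ x.2).
have sG u : normc u < rho - normc b -> csummable (G u).
  move=> ur; have bu0 : 0 <= normc b + normc u by rewrite addr_ge0 ?normc_ge0.
  have sb : rsummable (fun m => normc (g m) * (normc b + normc u) ^+ m).
    apply: rsummable_le sg => m; rewrite !ger0_norm ?mulr_ge0 ?normc_ge0 ?exprn_ge0 //; last first.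
      by apply: le_trans (ltW bl); exact: normc_ge0.
    rewrite ler_wpM2l ?normc_ge0 // lerXn2r ?nnegrE //; last by lra.
    by apply: le_trans (ltW bl); exact: normc_ge0.
  apply: (csummable_pair _ _ sb) => m; rewrite /G /=.
    by have [] := csumsZ (g m) (csums_binomial b u m).
  pose N (z : C) := (normc z)%:C.
  have [_] := csumsZ (N (g m)) (csums_binomial (N b) (N u) m).
  set A := (fun k => _); have -> : A = fun k => (normc (g m *
     ('C(m, k)%:R * b ^+ (m - k) * u ^+ k)))%:C.
    apply/funext => k; rewrite /A !normcM !normcX !rmorphM !rmorphXn /=; congr (_ * (_ * _ * _)).
    by rewrite -(rmorph_nat (real_complex R)) normc_real ger0_norm.
  rewrite rsum_csum (_ : N (g m) * _ = (normc (g m) * (normc b + normc u) ^+ m)%:C).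
    by move=> /complexI ->.
  by rewrite rmorphM; congr (_ * _); rewrite rmorphXn rmorphD.
have rowk k : csummable (fun m => g m * ('C(m, k)%:R * b ^+ (m - k))).
  pose u0 : C := ((rho - normc b) / 2)%:C.
  have hu0 : normc u0 < rho - normc b by rewrite normc_real gtr0_norm; lra.
  have [h0 _] := csums_swap (csumsP (sG _ hu0)); have h := csummable_row k h0.
  have [+ _] := csumsZr (u0 ^- k) (csumsP h); congr csummable; apply/funext => m.
  rewrite /G /= -!mulrA mulfV ?mulr1 // expf_neq0 // realC_neq0 // gt_eqF //; lra.
exists (fun k => csum (fun m => g m * ('C(m, k)%:R * b ^+ (m - k)))), (rho - normc b).
split=> [|u hu]; first exact: r0.
have h3 : csums (fun m => g m * (b + u) ^+ m) (csum (G u)).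
  apply: (csums_pair (csumsP (sG _ hu))) => m; rewrite /G /=.
  by have [_ ->] := csumsZ (g m) (csums_binomial b u m).
rewrite /ser h3.2; apply: (csums_pair (csums_swap (csumsP (sG _ hu)))) => k /=.
have [_ <-] := csumsZr (u ^+ k) (csumsP (rowk k)).
by congr csum; apply/funext => m; rewrite /G /=; ring.
Qed.

Lemma analytic_prod n (f : 'I_n -> C -> C) (w : C) (a : Cn R n) :
  (forall i, ana1 (f i) (a 0 i)) -> analytic_at (fun z => w * \prod_i f i (z 0 i)) a.
Proof.
move=> h; have [d hd] : {d : 'I_n -> nat -> C & {r : 'I_n -> R | forall i, 0 < r i /\
    forall u, normc u < r i -> csums (fun k => d i k * u ^+ k) (f i (a 0 i + u))}}.
  have h' i : {dr : (nat -> C) * R | 0 < dr.2 /\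
      forall u, normc u < dr.2 -> csums (fun k => dr.1 k * u ^+ k) (f i (a 0 i + u))}.
    by apply: cid; have [d [r hr]] := h i; exists (d, r).
  exists (fun i => (sval (h' i)).1), (fun i => (sval (h' i)).2) => i.
  exact: (svalP (h' i)).
case: hd => r hr; exists (fun e => w * \prod_i d i (e i)); apply/expansionP.
exists (\big[Num.min/1]_i r i).
  by elim/big_ind: _ => // [x y x0 y0|i _]; [rewrite lt_min x0|case: (hr i)].
move=> u hu; have hui i : normc (u 0 i) < r i.
  apply: lt_le_trans (hu i) _; rewrite (bigD1 i) //= ge_min lexx //.
have := csumsZ w (csums_ffun (fun i => (hr i).2 (u 0 i) (hui i))).
have -> : (fun z : Cn R n => w * \prod_i f i (z 0 i)) (a + u) = w * \prod_i f i (a 0 i + u 0 i).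
  by congr (_ * _); apply: eq_bigr => i _; rewrite mxE.
by apply: eq_csums => e; rewrite /pterm big_split mulrA.
Qed.

End Analytic1.

(** * The Gaussian e as an analytic function on a strip *)

Section GaussianFunction.
Variable R : realType.
Local Notation C := R[i].
Implicit Types (z u : C).

Lemma csums_shiftc e (a : nat -> C) u A : csums (fun k => a k * u ^+ k) A ->
  csums (fun k => shiftc e a k * u ^+ k) (u ^+ e * A).
Proof.
move=> h; apply/(@csums_inj R nat nat (addn e) (fun k => shiftc e a k * u ^+ k)).
- by move=> x y /addnI.
- move=> j out; rewrite /shiftc; case: ltnP => [_|ej]; first by rewrite mul0r.
  by have := out (j - e)%N; rewrite subnKC // eqxx.
apply: eq_csums (csumsZ (u ^+ e) h) => k.
by rewrite /shiftc ltnNge leq_addr /= addKn exprD; ring.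
Qed.

Lemma csums_mulc (r : {poly C}) (a : nat -> C) u A : csums (fun k => a k * u ^+ k) A ->
  csums (fun k => mulc r a k * u ^+ k) (r.[u] * A).
Proof.
move=> h; have := csums_sum (index_enum 'I_(size r)) (fun k : 'I_(size r) =>
  csumsZ r`_k (csums_shiftc k h)).
have -> : \sum_(k <- index_enum 'I_(size r)) r`_k * (u ^+ k * A) = r.[u] * A.
  by rewrite horner_coef mulr_suml; apply: eq_bigr => k _; rewrite mulrA.
apply: eq_csums => e.
by rewrite /mulc /ppair mulr_suml; apply: eq_bigr => k _; rewrite mulrA.
Qed.

Variables (q : R) (hq : 0 < q < 1).
Local Notation P := (q ^+ 2).
Local Notation p := ((q ^+ 2)%:C : C).
Local Notation gc := (@gcoef R q).
Let q0 : 0 < q. Proof. by case/andP: hq. Qed.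
Let qn0 : q != 0. Proof. by rewrite gt_eqF. Qed.
Let P0 : 0 < P. Proof. by rewrite exprn_gt0. Qed.
Let P1 : P < 1. Proof. by rewrite exprn_ilt1 // ?ltW //; case/andP: hq. Qed.

Lemma normc_p m : normc (p ^+ m) = P ^+ m.
Proof. by rewrite normcX normc_real gtr0_norm. Qed.

Lemma gcoef_summable (rho : R) : 0 <= rho < 1 -> rsummable (fun k => normc (gc k) * rho ^+ k).
Proof.
move=> /andP[r0 r1]; apply: rsummable_even; first exact: gcoef_odd.
have x01 : 0 <= P < 1 by rewrite ltW.
have r2 : rho ^+ 2 < 1 by rewrite exprn_ilt1.
have r20 : 0 <= rho ^+ 2 by rewrite exprn_ge0.
set y := rho ^+ 2 in r2 r20.
(* For x = p^(2k+2) below this threshold the ratio y / (1 - x) is at most (1 + y) / 2, which is less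
   than 1. *)
have e0 : 0 < (1 - y) / (1 + y) by rewrite divr_gt0; lra.
have [N hN] := exprn_small x01 e0.
apply: (@rsummable_ratio _ _ ((1 + y) / 2) N) => [|k Nk]; first by lra.
have [_ /(_ k.*2) rec] := gcoefP hq.
have Nk2 : (N <= k.*2.+2)%N by rewrite (leq_trans Nk) // -addnn -addn2 -addnA leq_addr.
have := hN _ Nk2; set x := P ^+ k.*2.+2 => hx.
have hx' : x * (1 + y) <= 1 - y by rewrite -ler_pdivlMr //; lra.
have x0 : 0 < x by rewrite exprn_gt0.
have x1 : 0 < 1 - x by rewrite subr_gt0 exprn_ilt1 // ltW.
have {}rec : (1 - x) * normc (gc k.*2.+2) = normc (gc k.*2).
  have := congr1 (@normc R) rec; rewrite mulN1r normc_opp => <-; rewrite normcM; congr (_ * _).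
  have -> : 1 - p ^+ k.*2.+2 = (1 - x)%:C.
    by rewrite rmorphB /= rmorph1; congr (_ - _); exact: esym (rmorphXn _ _ _).
  by rewrite normc_real gtr0_norm.
have -> : rho ^+ k.+1.*2 = y * rho ^+ k.*2 by rewrite -exprD add2n doubleS.
have : 0 <= rho ^+ k.*2 by rewrite exprn_ge0.
have := normc_ge0 (gc k.*2.+2); rewrite [k.+1.*2]doubleS -rec.
move: (rho ^+ k.*2) (normc (gc k.*2.+2)) => t e e_0 t_0.
have x1' := ltW x1.
rewrite !ger0_norm ?mulr_ge0 //.
have -> : e * (y * t) = (e * t) * y by ring.
have -> : (1 + y) / 2 * ((1 - x) * e * t) = (e * t) * ((1 + y) / 2 * (1 - x)) by ring.
rewrite ler_wpM2l ?mulr_ge0 //; lra.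
Qed.

Lemma csums_gc z : normc z < 1 -> csums (fun k => gc k * z ^+ k) (ser gc z).
Proof.
move=> z1; have z01 : 0 <= normc z < 1 by rewrite normc_ge0.
split=> //; apply: csummable_le (gcoef_summable z01) => k.
by rewrite normcM normcX.
Qed.

Lemma normc_pM m z : normc (p ^+ m * z) = P ^+ m * normc z.
Proof. by rewrite normcM normc_p. Qed.

Lemma normc_pM_lt1 m z : normc z < 1 -> normc (p ^+ m * z) < 1.
Proof.
move=> z1; rewrite normc_pM; apply: le_lt_trans z1.
by rewrite ler_piMl ?normc_ge0 // exprn_ile1 // ltW.
Qed.

Lemma ser_gc_dilate z : normc z < 1 -> ser gc (p * z) = (1 + z ^+ 2) * ser gc z.
Proof.
move=> z1; have h := csums_gc z1; have h2 := csums_shiftc 2 h.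
rewrite mulrDl mul1r; have [_ <-] := csumsD h h2.
rewrite /ser; congr csum; apply/funext => k; rewrite exprMn mulrA -mulrDl; congr (_ * _).
have [E1 rec] := gcoefP hq; case: k => [|[|k]].
- by rewrite expr0 mulr1 /shiftc addr0.
- by rewrite E1 mul0r /shiftc addr0.
rewrite /shiftc (_ : (k.+2 < 2)%N = false) // !subSS subn0.
have := rec k; rewrite mulN1r => /(congr1 -%R); rewrite opprK => <-; ring.
Qed.

Lemma sqr_add1_neq0 z : normc z < 1 -> 1 + z ^+ 2 != 0.
Proof.
move=> z1; rewrite addr_eq0; apply: contraTneq z1 => /(congr1 (@normc R)).
rewrite normc_opp normcX normc1 -leNgt => h.
have := normc_ge0 z; nra.
Qed.

Definition dprod (m : nat) (z : C) : C := \prod_(l < m) (1 + (p ^+ l * z) ^+ 2).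

Lemma dprodS m z : dprod m.+1 z = dprod m z * (1 + (p ^+ m * z) ^+ 2).
Proof. by rewrite /dprod big_ord_recr. Qed.

Lemma dprodSl m z : dprod m.+1 z = (1 + z ^+ 2) * dprod m (p * z).
Proof.
rewrite /dprod big_ord_recl expr0 mul1r; congr (_ * _); apply: eq_bigr => l _.
by rewrite lift0 [p ^+ _.+1]exprSr mulrA.
Qed.

Lemma dilate_small (z : C) (e : R) : 0 < e -> exists m, P ^+ m * normc z < e.
Proof.
move=> e0; have x01 : 0 <= P < 1 by rewrite ltW.
have n1 : 0 < normc z + 1 by rewrite ltr_wpDl ?normc_ge0.
have [N hN] := exprn_small x01 (divr_gt0 e0 n1); exists N.
have pN : 0 < P ^+ N by rewrite exprn_gt0.
apply: lt_le_trans (_ : P ^+ N * (normc z + 1) <= e).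
  by rewrite ltr_pM2l // ltrDl.
by rewrite -ler_pdivlMr // hN.
Qed.

(* 1 / (- z^2; q^4)_oo: the functional equation moves the argument into the unit
   disc, where the series applies; [gauss1E] shows that any [m] will do. *)
Definition gauss1 (z : C) : C :=
  let m := xget 0%N [set m | P ^+ m * normc z < 1] in ser gc (p ^+ m * z) / dprod m z.

Lemma gauss1_step m j z : P ^+ m * normc z < 1 ->
  ser gc (p ^+ (m + j) * z) / dprod (m + j) z = ser gc (p ^+ m * z) / dprod m z.
Proof.
move=> h; elim: j => [|j IH]; first by rewrite addn0.
apply: etrans IH; rewrite addnS dprodS exprS -[p * _ * z]mulrA.
have hj : normc (p ^+ (m + j) * z) < 1.
  rewrite addnC exprD -mulrA; apply: normc_pM_lt1; by rewrite normc_pM.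
rewrite ser_gc_dilate // invfM.
have := sqr_add1_neq0 hj; move: (1 + _ ^+ 2) (ser _ _) ((dprod _ _)^-1) => x y w x0.
by field; rewrite x0.
Qed.

Lemma gauss1E m z : P ^+ m * normc z < 1 -> gauss1 z = ser gc (p ^+ m * z) / dprod m z.
Proof.
move=> h; rewrite /gauss1; set m' := xget _ _.
have h' : P ^+ m' * normc z < 1.
  exact: (@xgetPex _ 0%N [set m | P ^+ m * normc z < 1] (ex_intro _ m h)).
have [mm|mm] := leqP m m'.
  by have := gauss1_step (m' - m) h; rewrite subnKC.
have := gauss1_step (m - m') h'; rewrite (subnKC (ltnW mm)) => E; exact: esym E.
Qed.

Lemma gauss1_ser z : normc z < 1 -> gauss1 z = ser gc z.
Proof.
by move=> z1; rewrite (@gauss1E 0) ?expr0 ?mul1r // /dprod big_ord0 divr1.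
Qed.

Lemma gauss1_dilate z : 1 + z ^+ 2 != 0 -> gauss1 (p * z) = (1 + z ^+ 2) * gauss1 z.
Proof.
move=> z0; have [m hm] := dilate_small z ltr01.
have hm1 : P ^+ m.+1 * normc z < 1.
  apply: le_lt_trans hm; rewrite exprS -mulrA ler_piMl ?mulr_ge0 ?exprn_ge0 ?normc_ge0 //; exact: ltW.
have hm2 : P ^+ m * normc (p * z) < 1.
  by rewrite -[p]expr1 normc_pM mulrA -exprD addn1.
rewrite (gauss1E hm1) (gauss1E hm2) dprodSl [p ^+ m.+1]exprSr -[p ^+ m * p * z]mulrA invfM.
move: z0; move: (1 + z ^+ 2) (ser gc _) ((dprod m (p * z))^-1) => x s d x0.
by field; rewrite x0.
Qed.

Lemma gauss1_even z : gauss1 (- z) = gauss1 z.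
Proof.
have [m hm] := dilate_small z ltr01.
have hm' : P ^+ m * normc (- z) < 1 by rewrite normc_opp.
have e1 : ser gc (p ^+ m * - z) = ser gc (p ^+ m * z).
  rewrite mulrN /ser; congr csum; apply/funext => k; have [ok|ek] := boolP (odd k).
    by rewrite gcoef_odd // !mul0r.
  by rewrite exprNn -signr_odd (negPf ek) expr0 mul1r.
have e2 : dprod m (- z) = dprod m z.
  by apply: eq_bigr => l _; rewrite mulrN sqrrN.
rewrite (gauss1E hm').
refine (etrans _ (esym (gauss1E hm))).
exact (f_equal2 (fun x y : C => x / y) e1 e2).
Qed.

(** The factor 1 + (p^l z)^2 vanishes only at i p^(-l) and -i p^(-l), whose imaginary parts have
    modulus at least 1. *)
Lemma ana1_gauss1 a : `|complex.Im a| < 1 -> ana1 gauss1 a.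
Proof.
(* Taking |a| + 1 instead of |a| makes one m valid on the whole unit disc about a. *)
move=> ima; have [m hm] := dilate_small ((normc a + 1)%:C) ltr01.
have na1 : 0 < normc a + 1 by rewrite ltr_wpDl ?normc_ge0.
rewrite normc_real gtr0_norm // in hm.
apply: (@ana1_near _ (fun z => ser gc (p ^+ m * z) * \prod_(l < m) (1 + (p ^+ l * z) ^+ 2)^-1) _ _ 1) => //.
  move=> u u1; rewrite (@gauss1E m).
    by congr (_ * _); rewrite prodfV.
  apply: le_lt_trans hm; rewrite ler_pM2l ?exprn_gt0 //.
  by apply: le_trans (normcD _ _) _; rewrite lerD2l ltW.
apply: ana1M.
  apply: ana1_dilate; have ha : P ^+ m * normc a < 1.
    by apply: le_lt_trans hm; rewrite ler_pM2l ?exprn_gt0 // lerDl.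
  apply: (@ana1_ser _ _ ((1 + P ^+ m * normc a) / 2)); last by rewrite normc_pM; lra.
  apply: gcoef_summable; have : 0 <= P ^+ m * normc a.
    by rewrite mulr_ge0 ?normc_ge0 // exprn_ge0 // ltW.
  by lra.
apply: (@ana1_prod _ m (fun l z => (1 + (p ^+ l * z) ^+ 2)^-1)) => l _.
(* Each quadratic factor is split into two affine ones, with s = i and s = -i, whose inverses are
   geometric series. *)
have h (s : C) : s ^+ 2 = -1 -> 1 + s * p ^+ l * a != 0.
  move=> s2; rewrite addr_eq0; apply: contraTneq ima => E.
  rewrite -leNgt.
  have E' : p ^+ l * a = s.
    have : s * 1 = s * - (s * p ^+ l * a) by rewrite -E.
    rewrite mulr1 => E3; apply: (etrans _ (esym E3)); have -> : s * - (s * p ^+ l * a) = - (s ^+ 2) * (p ^+ l * a) by ring.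
    by rewrite s2 opprK mul1r.
  have := congr1 (fun x => `|complex.Im x|) E'.
  have -> : complex.Im (p ^+ l * a) = P ^+ l * complex.Im a.
    by rewrite -rmorphXn; case: (a) => x y /=; rewrite mul0r addr0.
  rewrite normrM gtr0_norm ?exprn_gt0 // => E2.
  have s1 : `|complex.Im s| = 1.
    move: s2; case: (s) => x y; rewrite expr2 => -[] h1 h2 /=.
    have : x * y = 0 by lra.
    move=> /eqP; rewrite mulf_eq0 => /orP[/eqP x0|/eqP y0].
      have : y ^+ 2 = 1 by rewrite expr2; move: h1; rewrite x0; lra.
      by move=> /eqP; rewrite sqrf_eq1 => /orP[/eqP ->|/eqP ->]; rewrite ?normrN normr1.
    by move: h1; rewrite y0; nra.
  move: E2; rewrite s1 => <-; rewrite ler_piMl // exprn_ile1 // ltW //.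
have i2 : ('i%C : C) ^+ 2 = -1 by exact: sqr_i.
have n2 : (- 'i%C : C) ^+ 2 = -1 by rewrite sqrrN.
have := ana1M (ana1_inv_affine (h _ i2)) (ana1_inv_affine (h _ n2)).
apply: ana1_near ltr01 _ => u _; rewrite -invfM; congr (_^-1).
move: (a + u) (p ^+ l) => x y.
have -> : (1 + 'i%C * y * x) * (1 + - 'i%C * y * x) = 1 - 'i%C ^+ 2 * (y * x) ^+ 2 by ring.
by rewrite i2 mulN1r opprK.
Qed.

End GaussianFunction.

(** * Decay, moments and numerical values of e on the real line *)

Section GaussianMoments.
Variable R : realType.
Local Notation C := R[i].
Variables (q : R) (hq : 0 < q < 1).
Local Notation P := (q ^+ 2).
Local Notation p := ((q ^+ 2)%:C : C).
Local Notation gc := (@gcoef R q).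
Local Notation g1 := (@gauss1 R q).
Let q0 : 0 < q. Proof. by case/andP: hq. Qed.
Let qn0 : q != 0. Proof. by rewrite gt_eqF. Qed.
Let P0 : 0 < P. Proof. by rewrite exprn_gt0. Qed.
Let P1 : P < 1. Proof. by rewrite exprn_ilt1 // ?ltW //; case/andP: hq. Qed.

Definition rprod (m : nat) (t : R) : R := \prod_(l < m) (1 + (P ^+ l * t) ^+ 2).

Lemma dprod_real m t : dprod q m t%:C = (rprod m t)%:C.
Proof.
rewrite rmorph_prod; apply: eq_bigr => l _.
rewrite rmorphD rmorph1; congr (_ + _); rewrite -rmorphXn -realCM.
exact: esym (rmorphXn _ _ _).
Qed.

Lemma rprod_ge1 m t : 1 <= rprod m t.
Proof.
rewrite /rprod; elim/big_ind: _ => // [x y x1 y1|l _].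
  by rewrite -[1]mul1r ler_pM.
by rewrite lerDl sqr_ge0.
Qed.

(** At real points the denominator is at least 1, and the numerator is a value of the series in the
    disc of radius 1/2. *)
Lemma gauss1_bounded : exists2 M : R, 0 <= M & forall t : R, normc (g1 t%:C) <= M.
Proof.
have h2 : 0 <= (2^-1 : R) < 1 by lra.
have sg := gcoef_summable hq h2.
have g0 k : 0 <= normc (gc k) * 2^-1 ^+ k by rewrite mulr_ge0 ?normc_ge0 ?exprn_ge0.
exists (2 * rsum (fun k => normc (gc k) * 2^-1 ^+ k)).
  by rewrite mulr_ge0 // rsum_ge0_ge0.
move=> t; have e0 : 0 < (2^-1 : R) by lra.
have [m hm] := dilate_small hq t%:C e0.
have hm1 : P ^+ m * normc t%:C < 1 by apply: lt_trans hm _; lra.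
rewrite (gauss1E hq hm1) dprod_real normcM -realCV normc_real normfV.
have r1 := rprod_ge1 m t.
have i1 : `|rprod m t|^-1 <= 1.
  have r0 : 0 < rprod m t by exact: lt_le_trans ltr01 r1.
  by rewrite ger0_norm ?(ltW r0) // invf_le1.
have hz : normc (p ^+ m * t%:C) < 1 by rewrite normc_pM.
have [sz ez] := csums_gc hq hz.
apply: (@le_trans _ _ (normc (ser gc (p ^+ m * t%:C)))).
  by rewrite ler_piMr ?normc_ge0.
rewrite -ez; apply: le_trans (normc_csum sz) _; rewrite ler_pM2l //.
apply: ler_rsum => // k; rewrite normcM normcX ler_wpM2l ?normc_ge0 //.
by rewrite lerXn2r ?nnegrE ?normc_ge0 ?invr_ge0 // normc_pM // ltW.
Qed.

Lemma one_add_sqr_neq0 (t : R) : 1 + t%:C ^+ 2 != 0 :> C.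
Proof.
have -> : 1 + t%:C ^+ 2 = (1 + t ^+ 2)%:C :> C by rewrite rmorphD rmorph1 rmorphXn.
by rewrite realC_neq0 // gt_eqF // ltr_pwDl // sqr_ge0.
Qed.

(** Since e(q^2 t) = (1 + t^2) e(t), a bound for t^(2j) e(t) taken at q^2 t bounds t^(2j+2) e(t):
    decay is faster than any power. *)
Lemma gauss1_decay j : exists2 M : R, 0 <= M & forall t : R, (t ^+ 2) ^+ j * normc (g1 t%:C) <= M.
Proof.
elim: j => [|j [M M0 IH]].
  by have [M M0 h] := gauss1_bounded; exists M => // t; rewrite expr0 mul1r.
exists ((P ^+ 2) ^- j * M); first by rewrite mulr_ge0 // invr_ge0 exprn_ge0 // exprn_ge0 // ltW.
move=> t; rewrite -ler_pdivrMl ?invr_gt0 ?exprn_gt0 ?exprn_gt0 // invrK.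
have h := IH (P * t); apply: le_trans h.
have -> : (P * t)%:C = p * t%:C by exact: realCM.
rewrite gauss1_dilate ?one_add_sqr_neq0 //.
have -> : 1 + t%:C ^+ 2 = (1 + t ^+ 2)%:C :> C by rewrite rmorphD rmorph1 rmorphXn.
have t2 : 0 <= t ^+ 2 by rewrite sqr_ge0.
have p2 : 0 <= (P ^+ 2) ^+ j by rewrite exprn_ge0 // exprn_ge0 // ltW.
have t2j : 0 <= (t ^+ 2) ^+ j by rewrite exprn_ge0.
rewrite [normc (_ * g1 _)]normcM normc_real ger0_norm ?addr_ge0 //.
have -> : ((P * t) ^+ 2) ^+ j = (P ^+ 2) ^+ j * (t ^+ 2) ^+ j by rewrite [(P * t) ^+ 2]exprMn exprMn.
rewrite [(t ^+ 2) ^+ j.+1]exprSr; have := normc_ge0 (g1 t%:C).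
move: (normc _) (t ^+ 2) (_ ^+ j) (_ ^+ j) t2 p2 t2j => g x y z x0 y0 z0 g0.
rewrite -!mulrA; apply: (ler_wpM2l y0); apply: (ler_wpM2l z0).
by apply: (ler_wpM2r g0); rewrite lerDr.
Qed.

Lemma gauss1_poly_bound k : exists2 M : R, 0 <= M &
  forall t : R, normc (t%:C ^+ k * g1 t%:C) <= M.
Proof.
have [M M0 hM] := gauss1_bounded; have [M' M'0 hM'] := gauss1_decay k.
exists (M + M') => [|t]; first exact: addr_ge0.
rewrite normcM normcX normc_real.
have g0 := normc_ge0 (g1 t%:C).
have h : `|t| ^+ k <= 1 + (t ^+ 2) ^+ k.
  have [t1|t1] := leP `|t| 1.
    have : `|t| ^+ k <= 1 by rewrite exprn_ile1.
    have : 0 <= (t ^+ 2) ^+ k by rewrite exprn_ge0 // sqr_ge0.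
    by lra.
  have : `|t| ^+ k <= (t ^+ 2) ^+ k.
    by rewrite -real_normK ?num_real // lerXn2r ?nnegrE ?sqr_ge0 // ler_eXnr // ltW.
  by lra.
apply: le_trans (ler_wpM2r g0 h) _; rewrite mulrDl mul1r.
by apply: lerD.
Qed.

Lemma jackson_integrable_gauss1 c k : c != 0 ->
  jackson_integrable q c (fun t => t%:C ^+ k * g1 t%:C).
Proof.
move=> c0; have [M M0 hM] := gauss1_poly_bound k; have [M' M'0 hM'] := gauss1_poly_bound k.+2.
apply: (jackson_integrable_bound hq (M := M + M')) => // x _.
  by apply: le_trans (hM _) _; rewrite lerDl.
have := hM' (lat_pt q c x); rewrite -[k.+2]add2n exprD -mulrA normcM normcX normc_real.
rewrite real_normK ?num_real // => h; apply: le_trans h _; by rewrite lerDr.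
Qed.

Definition muG c (k : nat) : C := jackson q c (fun t => t%:C ^+ k * g1 t%:C).

Lemma muG_odd c k : c != 0 -> odd k -> muG c k = 0.
Proof.
move=> c0 ok; apply: jackson_odd; first exact: jackson_integrable_gauss1.
by move=> t; rewrite rmorphN /= gauss1_even // exprNn -signr_odd ok expr1 mulN1r mulNr.
Qed.

(** The argument of [muEP] with dilation by q^2; here any nonzero c is allowed, because e decays on
    every lattice. *)
Lemma muGP c : c != 0 -> qexp_moment p 1 (muG c).
Proof.
move=> c0; split=> [|m]; first exact: muG_odd.
have [_ h1] := jackson_dilate hq 1 (jackson_integrable_gauss1 m c0).
have iB : jackson_integrable q c (fun t => - (t%:C ^+ m.+2 * g1 t%:C)).
  have := (jacksonZ (-1) (jackson_integrable_gauss1 m.+2 c0)).1; congr jackson_integrable.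
  by apply/funext => t; rewrite mulN1r.
have jB : jackson q c (fun t => - (t%:C ^+ m.+2 * g1 t%:C)) = - muG c m.+2.
  have := (jacksonZ (-1) (jackson_integrable_gauss1 m.+2 c0)).2; rewrite mulN1r => <-.
  by congr jackson; apply/funext => t; rewrite mulN1r.
have [i2 h2] := jacksonB (jackson_integrable_gauss1 m c0) iB.
have [_ h3] := jacksonZ (p ^+ m) i2.
have pn0 : p != 0 := p_neq0 hq.
have E : (fun t => (q ^ (2 * 1) * t)%:C ^+ m * g1 (q ^ (2 * 1) * t)%:C) =
    fun t => p ^+ m * (t%:C ^+ m * g1 t%:C - - (t%:C ^+ m.+2 * g1 t%:C)).
  apply/funext => t; have -> : (q ^ (2 * 1) * t)%:C = p * t%:C by exact: realCM.
  rewrite gauss1_dilate ?one_add_sqr_neq0 // exprMn -[m.+2]addn2 exprD.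
  by ring.
have {}h1 := etrans (congr1 (jackson q c) (esym E)) h1.
have {}h1 := etrans (esym h3) h1; rewrite h2 jB opprK in h1.
have h4 : p ^+ m.+1 * (muG c m + muG c m.+2) = muG c m.
  rewrite exprS -mulrA h1 mulrA; have -> : p * (q ^ (- (2 * 1)))%:C = 1.
    by rewrite -realCM (_ : q ^ (- (2 * 1)) = q ^- 2) // mulfV ?expf_neq0.
  exact: mul1r.
rewrite mul1r -[in RHS]h4 mulrBl mulrA mulVf ?expf_neq0 // !mul1r h4; ring.
Qed.

(** Quantitative continuity at 0, where e equals 1; it drives the limit in [gauss_funE]. *)
Lemma ser_gc_near0 : exists2 M : R, 0 <= M &
  forall z : C, normc z <= 2^-1 -> normc (ser gc z - 1) <= normc z * M.
Proof.
have h2 : 0 <= (2^-1 : R) < 1 by lra.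
have sg := rsummable_comp (e := S) (fun x y => @succn_inj x y) (gcoef_summable hq h2).
pose u k := 2 * (normc (gc k.+1) * 2^-1 ^+ k.+1).
have su : rsummable u by exact: rsummableZ.
have u0 k : 0 <= u k by rewrite /u !mulr_ge0 ?normc_ge0 ?exprn_ge0.
exists (2 * rsum u) => [|z z2]; first by rewrite mulr_ge0 // rsum_ge0_ge0.
have z1 : normc z < 1 by apply: le_lt_trans z2 _; lra.
have := csums_recl_inv (csums_gc hq z1).
have -> : gc 0 * z ^+ 0 = 1.
  by rewrite /gcoef /eq_coef /qpoch /= big_ord0 invr1 !mulr1.
move=> [sz <-]; apply: le_trans (normc_csum sz) _.
rewrite mulrCA ler_pM2l // -rsumZ //; apply: ler_rsum => //; first exact: rsummableZ.
move=> k; rewrite normcM normcX exprS mulrCA ler_wpM2l ?normc_ge0 //.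
rewrite /u mulrCA ler_wpM2l ?normc_ge0 // exprS mulrA divff ?mul1r ?pnatr_eq0 //.
by rewrite lerXn2r ?nnegrE ?normc_ge0 // invr_ge0.
Qed.

Lemma qpoch_rprod t m : qpoch (- t ^+ 2) (q ^+ 4) m = rprod m t.
Proof.
apply: eq_bigr => l _; rewrite /= mulNr opprK.
suff -> : (P ^+ l * t) ^+ 2 = t ^+ 2 * (q ^+ 4) ^+ l by [].
by rewrite exprMn [LHS]mulrC -!exprM; congr (_ * q ^+ _); lia.
Qed.

Lemma gauss1_pow m (t : R) : g1 (p ^+ m * t%:C) = (rprod m t)%:C * g1 t%:C.
Proof.
elim: m => [|m IH]; first by rewrite expr0 mul1r /rprod big_ord0 mul1r.
have e : p ^+ m * t%:C = (P ^+ m * t)%:C.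
  have pm : p ^+ m = (P ^+ m)%:C by exact: esym (rmorphXn _ _ _).
  by rewrite pm -realCM.
have n0 : 1 + (p ^+ m * t%:C) ^+ 2 != 0 by rewrite e; exact: one_add_sqr_neq0.
rewrite exprS -[p * _ * _]mulrA (gauss1_dilate hq n0).
have -> : 1 + (p ^+ m * t%:C) ^+ 2 = (1 + (P ^+ m * t) ^+ 2)%:C.
  by rewrite e rmorphD rmorph1 rmorphXn.
by rewrite IH mulrA -realCM /rprod big_ord_recr /= [(1 + _) * _]mulrC.
Qed.

(** By the functional equation, (-t^2; q^4)_m e(t) = e(q^(2m) t), which tends to 1. Hence the finite
    products converge to 1 / e(t). The same limit forces Im e(t) = 0, because the products are at
    least 1. *)
Lemma gauss_funE t : Defs.gauss_fun q t = g1 t%:C.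
Proof.
have [M M0 hM] := ser_gc_near0.
pose G := complex.Re (g1 t%:C); pose H := complex.Im (g1 t%:C).
have e2 : 0 < (2^-1 : R) by lra.
have x01 : 0 <= P < 1 by rewrite ltW.
have small (e : R) : 0 < e -> exists N, forall m, (N <= m)%N ->
    normc (g1 (p ^+ m * t%:C) - 1) <= e.
  move=> e0; pose d := Num.min (2^-1) (e / (M + 1)).
  have d0 : 0 < d by rewrite lt_min e2 divr_gt0 //; lra.
  have n1 : 0 < normc t%:C + 1 by rewrite ltr_wpDl ?normc_ge0.
  have [N hN] := exprn_small x01 (divr_gt0 d0 n1); exists N => m Nm.
  have hz : normc (p ^+ m * t%:C) <= d.
    rewrite normc_pM //; apply: le_trans (_ : P ^+ m * (normc t%:C + 1) <= d).
      by apply: ler_wpM2l; [exact/exprn_ge0/ltW|rewrite lerDl].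
    by rewrite -ler_pdivlMr // hN.
  have hz2 : normc (p ^+ m * t%:C) <= 2^-1 by apply: le_trans hz _; rewrite ge_min lexx.
  rewrite gauss1_ser //; last by apply: le_lt_trans hz2 _; lra.
  apply: le_trans (hM _ hz2) _; apply: le_trans (_ : e / (M + 1) * M <= e).
    rewrite ler_wpM2r //; apply: le_trans hz _; by rewrite ge_min lexx orbT.
  rewrite mulrAC ler_pdivrMr; last by lra.
  by rewrite ler_pM2l //; lra.
have reE m : g1 (p ^+ m * t%:C) - 1 = (rprod m t * G - 1) +i* (rprod m t * H).
  rewrite gauss1_pow /G /H; case: (g1 t%:C) => x y.
  apply/eqP; rewrite eq_complex /=; apply/andP; split; apply/eqP; ring.
have H0 : H = 0.
  apply/eqP; rewrite -normr_le0; apply/ler_addgt0Pl => e e0; rewrite addr0.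
  have [N hN] := small e e0; have := hN N (leqnn N); rewrite reE.
  apply: le_trans; apply: le_trans (normc_Im _); rewrite /= normrM ler_peMl //.
  have r1 := rprod_ge1 N t; rewrite ger0_norm //; exact: le_trans r1.
have cv : (fun m => rprod m t * G) @ \oo --> (1 : R).
  apply/cvgrPdist_le => e e0; have [N hN] := small e e0; exists N => // m Nm /=.
  rewrite distrC; have := hN m Nm; rewrite reE; apply: le_trans.
  exact: (normc_Re ((rprod m t * G - 1) +i* (rprod m t * H))).
have Gn0 : G != 0.
  apply/eqP => G0; have [N hN] := small _ e2.
  have := le_trans (normc_Re _) (hN N (leqnn N)).
  by rewrite reE /= G0 mulr0 sub0r normrN1; lra.
have cv2 : (fun m => qpoch (- t ^+ 2) (q ^+ 4) m) @ \oo --> G^-1.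
  have E : (fun m => qpoch (- t ^+ 2) (q ^+ 4) m) = (fun m => rprod m t * G * G^-1).
    by apply/funext => m; rewrite qpoch_rprod mulfK.
  by rewrite E -[G^-1 in X in _ --> X]mul1r; apply: cvgM => //; exact: cvg_cst.
rewrite /Defs.gauss_fun /eq_val (cvg_lim (@norm_hausdorff _ _) cv2) invrK /G.
by apply/eqP; rewrite eq_complex /= eqxx -/H H0 eqxx.
Qed.

End GaussianMoments.
(** * The transform G_S of Gaussian products *)

Section GaussianJackson.
Variable R : realType.
Local Notation C := R[i].
Variables (q : R) (hq : 0 < q < 1).
Local Notation gc := (@gcoef R q).
Local Notation g1 := (@gauss1 R q).
Let q0 : 0 < q. Proof. by case/andP: hq. Qed.
Let qn0 : q != 0. Proof. by rewrite gt_eqF. Qed.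

Lemma jackson_scale (c w : R) (phi : R -> C) : w != 0 ->
  jackson_integrable q (w * c) phi ->
  jackson_integrable q c (fun t => phi (w * t)) /\
  jackson q c (fun t => phi (w * t)) = w%:C^-1 * jackson q (w * c) phi.
Proof.
move=> w0 /jacksonP[S [h ->]]; rewrite mulrCA; apply: jacksonE.
move/(csumsZ (w%:C^-1)): h; apply: eq_csums => x; rewrite /jackson_term.
have -> : lat_pt q (w * c) x = w * lat_pt q c x by rewrite /lat_pt; ring.
have -> : (q ^ (2 * x.1) * (w * c))%:C = w%:C * (q ^ (2 * x.1) * c)%:C :> C.
  by rewrite -realCM; congr (_%:C); ring.
by rewrite -[w%:C * _ * _]mulrA mulKf // realC_neq0.
Qed.

(** The moments see the lattice only modulo q^2. *)
Lemma muG_shift (c : R) (m : nat) k : c != 0 -> muG q (q ^+ m.*2 * c) k = muG q c k.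
Proof.
move=> c0; have w0 : q ^+ m.*2 != 0 by rewrite expf_neq0.
have wc0 : q ^+ m.*2 * c != 0 by rewrite mulf_neq0.
have [_ h1] := jackson_scale w0 (jackson_integrable_gauss1 hq k wc0).
have [_ h2] := jackson_dilate hq m (jackson_integrable_gauss1 hq k c0).
have E : q ^ (2 * m%:Z) = q ^+ m.*2 by rewrite -PoszM mul2n.
have V : (q ^ (- (2 * m%:Z)))%:C = (q ^+ m.*2)%:C^-1 :> C by rewrite -E -realCV -invr_expz.
rewrite E V in h2; refine (mulfI _ (etrans (esym h1) h2)).
by rewrite invr_eq0 realC_neq0.
Qed.

(** What variable j contributes to a monomial times g: the power z^e, and its Gaussian factor
    dilated by q^N, where N is the sum of the exponents of the lower generators moved past it. *)
Definition gaussM (e N : nat) (r : {poly C}) (z : C) : C :=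
  z ^+ e * (r.[(q ^+ N)%:C * z] * g1 ((q ^+ N)%:C * z)).

Definition gaussM_coef (e N : nat) (r : {poly C}) : nat -> C :=
  shiftc e (fun k => (q ^+ N)%:C ^+ k * mulc r gc k).

Lemma normc_qX_le N (z : C) : normc ((q ^+ N)%:C * z) <= normc z.
Proof.
rewrite normcM normc_real ger0_norm ?exprn_ge0 ?(ltW q0) //.
by rewrite ler_piMl ?normc_ge0 // exprn_ile1 // ltW //; case/andP: hq.
Qed.

Lemma csums_gaussM e N r z : normc z < 1 ->
  csums (fun k => gaussM_coef e N r k * z ^+ k) (gaussM e N r z).
Proof.
move=> z1; have l1 := le_lt_trans (normc_qX_le N z) z1.
apply: csums_shiftc; rewrite gauss1_ser //.
by have := csums_mulc r (csums_gc hq l1); apply: eq_csums => k; rewrite exprMn; ring.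
Qed.

Lemma ana1_gaussM e N r z : `|complex.Im z| < 1 -> ana1 (gaussM e N r) z.
Proof.
move=> z1; apply: ana1M; first exact: (ana1X e (ana1_id z)).
apply: (@ana1_dilate R (fun z => r.[z] * g1 z)); apply: ana1M; first exact: ana1_horner.
apply: ana1_gauss1 => //; apply: le_lt_trans z1.
have -> : complex.Im ((q ^+ N)%:C * z) = q ^+ N * complex.Im z.
  by case: (z) => x y /=; rewrite mul0r addr0.
rewrite normrM ger0_norm ?exprn_ge0 ?(ltW q0) //.
by rewrite ler_piMl ?normr_ge0 // exprn_ile1 // ltW //; case/andP: hq.
Qed.

Lemma jackson_gaussM (c : R) e N r : c != 0 ->
  jackson_integrable q c (fun t => gaussM e N r t%:C) /\
  jackson q c (fun t => gaussM e N r t%:C) =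
    (q ^+ (N * e.+1))%:C^-1 * momc r (muG q (q ^+ N * c)) e.
Proof.
move=> c0; have w0 : q ^+ N != 0 by rewrite expf_neq0.
have wc0 : q ^+ N * c != 0 by rewrite mulf_neq0.
have h (k : 'I_(size r)) := jacksonZ r`_k (jackson_integrable_gauss1 hq (e + k) wc0).
have [h1 h2] := jackson_sum (fun k => (h k).1).
have [/(jacksonZ ((q ^+ N)%:C ^+ e)^-1)[h3 h4] h5] := jackson_scale w0 h1.
have E : (fun t : R => ((q ^+ N)%:C ^+ e)^-1 *
    \sum_(k < size r) r`_k * ((q ^+ N * t)%:C ^+ (e + k) * g1 (q ^+ N * t)%:C)) =
    (fun t => gaussM e N r t%:C).
  apply/funext => t; rewrite /gaussM horner_coef mulr_suml mulr_sumr mulr_sumr.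
  apply: eq_bigr => k _; rewrite (realCM (q ^+ N) t) exprD exprMn.
  have : (q ^+ N)%:C ^+ e != 0 :> C by rewrite expf_neq0 // realC_neq0.
  move: (_ ^+ e) => x x0; move: (g1 _) (t%:C ^+ e) (_ ^+ k) => y z u.
  by field.
have h3' := eq_ind _ (jackson_integrable q c) h3 _ E; split=> //.
have -> := congr1 (jackson q c) (esym E).
have -> : (q ^+ (N * e.+1))%:C = (q ^+ N)%:C ^+ e * (q ^+ N)%:C by rewrite exprM rmorphXn exprSr.
rewrite h4 h5 h2 mulrA -invfM [_ * (q ^+ N)%:C]mulrC; congr (_ * _).
by apply: eq_bigr => k _; rewrite (h k).2.
Qed.

Variable n : nat.

Lemma mjackson_prod (c : 'I_n -> R) (phi : 'I_n -> R -> C) (K : C) :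
  (forall j, jackson_integrable q (c j) (phi j)) ->
  mjackson_integrable q c (fun t => K * \prod_j phi j (t 0 j)) /\
  mjackson q c (fun t => K * \prod_j phi j (t 0 j)) = K * \prod_j jackson q (c j) (phi j).
Proof.
move=> h; split.
  have [+ _] := csumsZ K (csums_ffun (fun j => csumsP (h j))).
  congr csummable; apply/funext => x; rewrite mulrCA; congr (_ * _).
  rewrite rmorph_prod -big_split; apply: eq_bigr => j _.
  by rewrite /jackson_term mxE.
(* Generalised to the variables in [s] being integrated, the others keeping their values at t. *)
suff H s t : uniq s -> foldr (fun j (psi : 'rV[R]_n -> C) t =>
       jackson q (c j) (fun s => psi (\row_i if i == j then s else t 0 i)))
    (fun t => K * \prod_j phi j (t 0 j)) s t =
    K * \prod_j (if j \in s then jackson q (c j) (phi j) else phi j (t 0 j)).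
  rewrite /mjackson H ?enum_uniq //; congr (_ * _); apply: eq_bigr => j _.
  by rewrite mem_enum.
elim: s t => [|j s IH] t /= => [_|/andP[js us]].
  by congr (_ * _); apply: eq_bigr => j _.
pose P := \prod_(i | i != j) (if i \in s then jackson q (c i) (phi i) else phi i (t 0 i)).
transitivity (jackson q (c j) (fun s => K * P * phi j s)).
  congr jackson; apply/funext => u; rewrite IH // -mulrA; congr (_ * _).
  rewrite (bigD1 j) //= (negPf js) mxE eqxx mulrC; congr (_ * _).
  by apply: eq_bigr => i /negPf ij; rewrite mxE ij.
have [_ ->] := jacksonZ (K * P) (h j).
rewrite -mulrA; congr (_ * _); rewrite [RHS](bigD1 j) //= inE eqxx mulrC; congr (_ * _).
by apply: eq_bigr => i /negPf ij; rewrite inE ij.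
Qed.

End GaussianJackson.

(** * G_S on products of one-variable elements *)

Section TransformG.
Variable R : realType.
Local Notation C := R[i].
Variables (q : R) (hq : 0 < q < 1) (n : nat).
Local Notation gc := (@gcoef R q).
Local Notation ltr := (fun i j : 'I_n => (j < i)%N).
Local Notation gtr := (fun i j : 'I_n => (i < j)%N).
Local Notation tw := (@twist n ltr).
Let q0 : 0 < q. Proof. by case/andP: hq. Qed.
Let qn0 : q != 0. Proof. by rewrite gt_eqF. Qed.

(** The tube R^n + i (-1,1)^n: it contains all real points, is star-shaped about 0 and avoids the
    poles of the Gaussians. *)
Definition strip : set (Cn R n) := [set z | forall i, `|complex.Im (z 0 i)| < 1].

Lemma open_unit_cube : open [set t : 'rV[R]_n | forall i, `|t 0 i| < 1].
Proof.
rewrite openE => a /= ha; apply/near_RnP.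
exists (\big[Num.min/1]_i (1 - `|a 0 i|)).
  by elim/big_ind: _ => // [x y x0 y0|i _]; [rewrite lt_min x0|rewrite subr_gt0].
move=> z hz i; have : `|z 0 i - a 0 i| < 1 - `|a 0 i|.
  by apply: lt_le_trans (hz i) _; rewrite (bigD1 i) //= ge_min lexx.
have := ler_normD (z 0 i - a 0 i) (a 0 i); rewrite subrK; lra.
Qed.

Lemma open_strip : open strip.
Proof.
rewrite openE => a /= ha; apply/near_CnP.
exists (\big[Num.min/1]_i (1 - `|complex.Im (a 0 i)|)).
  by elim/big_ind: _ => // [x y x0 y0|i _]; [rewrite lt_min x0|rewrite subr_gt0].
move=> z hz i; have : normc (z 0 i - a 0 i) < 1 - `|complex.Im (a 0 i)|.
  by apply: lt_le_trans (hz i) _; rewrite (bigD1 i) //= ge_min lexx.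
have := normc_Im (z 0 i - a 0 i).
have -> : complex.Im (z 0 i - a 0 i) = complex.Im (z 0 i) - complex.Im (a 0 i).
  by case: (z 0 i) (a 0 i) => x y [u v].
have := ler_normD (complex.Im (z 0 i) - complex.Im (a 0 i)) (complex.Im (a 0 i)); rewrite subrK; lra.
Qed.

(** The product of the one-variable continuations continues the series to the strip. It serves both
    the tube condition and the values at real points, after which the iterated integral factors. *)
Lemma Jint_prod (g : qD q n) (K : C) (H : 'I_n -> nat -> C) (Phi : 'I_n -> C -> C) :
  even_part g = (fun a => K * \prod_j H j (a j)) ->
  (forall j z, normc z < 1 -> csums (fun k => H j k * z ^+ k) (Phi j z)) ->
  (forall j z, `|complex.Im z| < 1 -> ana1 (Phi j) z) ->
  (forall j (c : R), c != 0 -> jackson_integrable q c (fun t => Phi j t%:C)) ->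
  Jint_def g /\ forall delta : 'I_n -> R, (forall j, delta j != 0) ->
    Jint delta g = K * \prod_(j < n) jackson q (q ^+ (n - j.+1) * delta j) (fun t => Phi j t%:C).
Proof.
move=> gE sH aP iP; pose F (z : Cn R n) := K * \prod_j Phi j (z 0 j).
have aF a : strip a -> analytic_at F a.
  by move=> ha; apply: analytic_prod => i; exact: aP.
have eF : expansion F 0 (even_part g).
  apply/expansionP; exists 1 => // u hu; rewrite add0r gE /F.
  have := csumsZ K (csums_ffun (fun i => sH i (u 0 i) (hu i))).
  by apply: eq_csums => e; rewrite /pterm big_split mulrA.
have cF : continues (even_part g) strip F by split => //; exact: open_strip.
have JE : Jfun g = fun t => K * \prod_j Phi j (t 0 j)%:C.
  apply/funext => t; apply: ext_valE; exists strip, F; split=> //.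
  - move=> z s hz /andP[s0 s1] i; rewrite mxE.
    have -> : complex.Im (s%:C * z 0 i) = s * complex.Im (z 0 i).
      by case: (z 0 i) => x y /=; rewrite mul0r addr0.
    rewrite normrM ger0_norm //; apply: le_lt_trans (hz i).
    by rewrite ler_piMl.
  - by move=> i; rewrite mxE /= normr0.
  - by rewrite /F; congr (_ * _); apply: eq_bigr => j _; rewrite mxE.
split.
  split; last first.
    by move=> c c0; rewrite JE; apply: (mjackson_prod (phi := fun j t => Phi j t%:C) K (fun j => iP j _ (c0 j))).1.
  exists [set t : 'rV[R]_n | forall i, `|t 0 i| < 1], F; split.
  - exact: open_unit_cube.
  - by move=> i; rewrite mxE normr0.
  - have E : strip = [set z : Cn R n | [set t : 'rV[R]_n | forall i, `|t 0 i| < 1]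
        (\row_i complex.Im (z 0 i))].
      by apply/seteqP; split=> z hz i; have := hz i; rewrite mxE.
    exact: (eq_ind strip (fun W => continues _ W F) cF _ E).
move=> delta d0; rewrite /Jint JE.
have c0 (j : 'I_n) : q ^+ (n - j.+1) * delta j != 0 by rewrite mulf_neq0 ?expf_neq0.
exact: (mjackson_prod (phi := fun j t => Phi j t%:C) K (fun j => iP j _ (c0 j))).2.
Qed.

Definition Dprod (h : 'I_n -> nat -> C) : qD q n := fun e => \prod_j h j (e j).

Lemma gtr_irr : irreflexive gtr. Proof. by move=> i; exact: ltnn. Qed.

Lemma DeltE (r : 'I_n -> {poly C}) : Delt q r = Dprod (fun j => mulc (r j) gc).
Proof.
rewrite /Delt; under eq_bigr => j _.
  rewrite /egauss -scaleN1r (qcomp_square _ gtr_irr) (qpolyM_uni _ gtr_irr); over.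
rewrite prod_uni ?rev_uniq ?enum_uniq //; last first.
  by apply: sub_pairwise (pairwise_rev_enum n) => i j ji; rewrite -leqNgt ltnW.
by apply/funext => e; rewrite supp_on_rev_enum prod_rev_enum.
Qed.

Lemma qmon_Dprod (r : 'I_n -> {poly C}) (e : expv n) :
  qmon q _ e * Dprod (fun j => mulc (r j) gc) =
  Dprod (fun j => gaussM_coef q (e j) (\sum_(i < n | (i < j)%N) e i) (r j)).
Proof.
apply/funext => a; rewrite qmonMlE mem_below.
case: ifPn => [/forallP ea|/forallPn[j]]; last first.
  by rewrite -ltnNge => aj; rewrite /Dprod (bigD1 j) //= /gaussM_coef /shiftc aj mul0r.
pose N j := (\sum_(i < n | (i < j)%N) e i)%N.
have -> : twist gtr e (expv_sub a e) = (\sum_(j < n) N j * expv_sub a e j)%N.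
  rewrite /twist (exchange_big_dep xpredT) //=; apply: eq_bigr => j _.
  by rewrite big_distrl.
rewrite /Dprod -prodrXr rmorph_prod -big_split; apply: eq_bigr => j _.
rewrite /gaussM_coef /shiftc ltnNge ea /= expv_subE exprM; congr (_ * _).
exact: rmorphXn.
Qed.

Lemma gaussM_coef0 b e N (r : {poly C}) k : poly_parity b r -> odd k != odd e (+) b ->
  gaussM_coef q e N r k = 0.
Proof.
move=> pr ok; rewrite /gaussM_coef /shiftc; case: ltnP => // ek.
rewrite (mulc_parity0 (@gcoef_odd R q) pr) ?mulr0 //.
by rewrite oddB //; move: ok; case: odd; case: odd; case: (b).
Qed.

(** Only the parity of the dilation exponent matters, so the lattice is fixed by the sign vector and
    does not vary with e. *)
Lemma muG_parity (c : R) N B k : c != 0 -> odd N = odd B ->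
  muG q (q ^+ N * c) k = muG q (q ^+ B * c) k.
Proof.
move=> c0 NB; wlog le : N B NB / (B <= N)%N => [H|].
  have [|/ltnW] := leqP B N; first exact: H.
  by move/(H B N (esym NB)) => ->.
have [m ->] : exists m, N = (m.*2 + B)%N.
  by exists (N - B)./2; rewrite even_halfK ?subnK // oddB // NB addbb.
by rewrite exprD -mulrA muG_shift // mulf_neq0 ?expf_neq0.
Qed.

(** Of the three parts, the first belongs to the one-variable [Gcoef], the second is the twist of
    [Aprod], and the third cancels the factors q^(-N_j (e_j + 1)) that the dilations leave in the
    Jackson integrals. *)
Lemma Gexponent (e : expv n) :
  ((\sum_(j < n) e j) ^ 2 + \sum_(j < n) e j + \sum_(j < n) (n - j.+1) * e j =
   \sum_(j < n) (e j ^ 2 + e j) + tw e e +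
   \sum_(j < n) (\sum_(i < n | (i < j)%N) e i) * (e j).+1)%N.
Proof.
have -> : (\sum_(j < n) (\sum_(i < n | (i < j)%N) e i) * (e j).+1 =
    tw e e + \sum_(j < n) \sum_(i < n | (i < j)%N) e i)%N.
  rewrite /twist -big_split; apply: eq_bigr => j _ /=.
  by rewrite mulnS addnC mulnC big_distrr.
have -> : (\sum_(j < n) \sum_(i < n | (i < j)%N) e i = \sum_(j < n) (n - j.+1) * e j)%N.
  rewrite (exchange_big_dep xpredT) //=; apply: eq_bigr => i _.
  rewrite sum_nat_const; congr (_ * _)%N.
  have := cardC [pred j : 'I_n | (i < j)%N]; rewrite card_ord.
  have -> : #|[predC [pred j : 'I_n | (i < j)%N]]| = i.+1.
    rewrite -sum1_card -[RHS](card_ord i.+1) -[RHS]muln1 -sum_nat_const.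
    rewrite (big_ord_widen n (fun=> 1%N) (ltn_ord i)); apply: eq_bigl => j.
    by rewrite !inE -leqNgt.
  by move=> h; rewrite -[X in (X - _)%N]h addnK; apply: eq_card.
rewrite sqr_sum_expv big_split /=; lia.
Qed.

Lemma Gtrans_Dprod (r : 'I_n -> {poly C}) (b : 'I_n -> bool) (B : 'I_n -> nat) (K : C)
    (delta : 'I_n -> R) :
  (forall j, poly_parity (b j) (r j)) ->
  (forall j : 'I_n, odd (\sum_(i < n | (i < j)%N) b i) = odd (B j)) ->
  (forall j, delta j != 0) ->
  let g := K *: Dprod (fun j => mulc (r j) gc) in
  Gtrans_def g /\
  Gtrans delta g = fun e => K * ((q ^+ tw e e)%:C * \prod_j (Gcoef q (e j) *
     momc (r j) (muG q (q ^+ (n - j.+1 + B j) * delta j)) (e j))).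
Proof.
move=> pr pB d0 g.
have c0 (j : 'I_n) : q ^+ (n - j.+1 + B j) * delta j != 0 by rewrite mulf_neq0 ?expf_neq0.
pose N (e : expv n) (j : 'I_n) := (\sum_(i < n | (i < j)%N) e i)%N.
have H (e : expv n) : Jint_def (qmon q _ e * g) /\
  Jint delta (qmon q _ e * g) = K * \prod_j ((q ^+ (N e j * (e j).+1))%:C^-1 *
     momc (r j) (muG q (q ^+ (n - j.+1 + B j) * delta j)) (e j)).
  have eE : qmon q _ e * g = K *: Dprod (fun j => gaussM_coef q (e j) (N e j) (r j)).
    by rewrite /g qmulZr qmon_Dprod.
  have [/forallP pe|/forallPn[j oj]] := boolP [forall j, odd (e j) == b j]; last first.
    (* Wrong parity: the zero series is presented as a product so that [Jint_prod] applies to it as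
       well. *)
    have evE : even_part (qmon q _ e * g) = (fun a => 0 * \prod_(j < n) (fun _ _ => 0) j (a j)).
      apply/funext => a; rewrite mul0r /even_part; case: ifP => // /forallP/(_ j) /negPf ea.
      rewrite eE qscaleE /Dprod (bigD1 j) //= (gaussM_coef0 _ (pr j)) ?mul0r ?mulr0 //.
      by rewrite ea; move: oj; case: odd; case: (b j).
    have [] := Jint_prod (H := fun _ _ => 0) (Phi := fun _ _ => 0) evE.
    - by move=> i z _; apply: eq_csums (csums0 R _) => k; rewrite mul0r.
    - by move=> i z _; exact: ana1_cst.
    - move=> i c _; apply: (proj1 (eq_csums _ (csums0 R _))) => x.
      by rewrite /jackson_term mulr0.
    move=> h1 /(_ delta d0) h2; split=> //; rewrite h2 mul0r.
    by rewrite [\prod_(_ < _) _](bigD1 j) //= (momc_parity0 (fun m => @muG_odd R q hq _ m (c0 j)) (pr j) oj) !(mulr0, mul0r).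
  have evE : even_part (qmon q _ e * g) =
      (fun a => K * \prod_j gaussM_coef q (e j) (N e j) (r j) (a j)).
    apply/funext => a; rewrite /even_part eE; case: ifPn => // /forallPn[j].
    rewrite negbK => oa; rewrite (bigD1 j) //= (gaussM_coef0 _ (pr j)) ?mul0r ?mulr0 //.
    by rewrite oa (eqP (pe j)) addbb.
  have [] := Jint_prod (H := fun j => gaussM_coef q (e j) (N e j) (r j))
    (Phi := fun j => gaussM q (e j) (N e j) (r j)) evE.
  - by move=> j z; exact: csums_gaussM.
  - by move=> j z; exact: ana1_gaussM.
  - by move=> j c cn0; have [] := jackson_gaussM hq (e j) (N e j) (r j) cn0.
  move=> h1 /(_ delta d0) h2; split=> //; rewrite h2; congr (_ * _); apply: eq_bigr => j _.
  have dj0 : q ^+ (n - j.+1) * delta j != 0 by rewrite mulf_neq0 ?expf_neq0.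
  have [_ hj] := jackson_gaussM hq (e j) (N e j) (r j) dj0; apply: etrans hj _.
  have NB : odd (N e j) = odd (B j).
    rewrite -pB /N; elim/big_ind2: _ => // [x y z t|i _].
      by rewrite !oddD => -> ->.
    by rewrite (eqP (pe i)); case: (b i).
  have -> // : muG q (q ^+ N e j * (q ^+ (n - j.+1) * delta j)) =
      muG q (q ^+ (n - j.+1 + B j) * delta j).
  apply/funext => k; apply: etrans (muG_parity k dj0 NB) _.
  by rewrite mulrA -exprD addnC.
split=> [e|]; first by case: (H e).
apply/funext => e; rewrite /Gtrans (H e).2 Gexponent !exprD !realCM [\prod_(j < n) (_^-1 * _)]big_split /=.
have -> : \prod_(j < n) (Gcoef q (e j) * momc (r j) (muG q (q ^+ (n - j.+1 + B j) * delta j)) (e j)) =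
    (- 'i%C) ^+ (\sum_(j < n) e j) * (q ^+ (\sum_(j < n) (e j ^ 2 + e j)))%:C /
    (\prod_(j < n) qpoch (q ^+ 2) (q ^+ 2) (e j))%:C *
    \prod_(j < n) momc (r j) (muG q (q ^+ (n - j.+1 + B j) * delta j)) (e j).
  rewrite -!prodrXr !rmorph_prod -prodfV -!big_split; by apply: eq_bigr.
have -> : \prod_(j < n) (q ^+ (N e j * (e j).+1))%:C^-1 =
    (q ^+ (\sum_(j < n) N e j * (e j).+1))%:C^-1.
  by rewrite -prodrXr rmorph_prod prodfV.
have : (q ^+ (\sum_(j < n) N e j * (e j).+1))%:C != 0 :> C by rewrite realC_neq0 // expf_neq0.
rewrite -/(N e); move: (_%:C) (\prod_(j < n) momc _ _ _) (_ ^+ _) (_%:C) (_%:C^-1) (_%:C) => x m y z w t x0.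
by field.
Qed.

End TransformG.

(** * Sign vectors and the two inversion formulas *)

Section SignVectors.
Variable R : realType.
Local Notation C := R[i].

Lemma poly_eq0_eval (p : {poly C}) : (forall t, p.[t] = 0) -> p = 0.
Proof.
move=> h; apply/eqP; apply: contraT => p0.
have := max_poly_roots (rs := [seq (k%:R : R)%:C | k <- iota 0 (size p)]) p0.
rewrite size_map size_iota ltnn => -> //.
  by apply/allP => x _; exact/eqP/h.
rewrite map_inj_uniq ?iota_uniq // => k l /(congr1 (@complex.Re R)) /= /eqP.
by rewrite eqr_nat => /eqP.
Qed.

(** The boolean [b != 1] is the exponent b_j of the statement. Equality of all values makes the
    polynomial with coefficients ((-1)^k - b) p_k zero. *)
Lemma poly_parity_sign (b : int) (p : {poly C}) : b = 1 \/ b = -1 ->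
  (forall t, p.[- t] = b%:~R * p.[t]) -> poly_parity (b != 1) p.
Proof.
move=> hb h k ok; have [kp|kp] := ltnP k (size p); last by rewrite nth_default.
pose s : {poly C} := \poly_(k < size p) ((-1) ^+ k * p`_k - b%:~R * p`_k).
have s0 : s = 0.
  apply: poly_eq0_eval => t; rewrite horner_poly.
  transitivity (p.[- t] - b%:~R * p.[t]); last by rewrite h subrr.
  rewrite !horner_coef mulr_sumr -sumrB; apply: eq_bigr => j _.
  by rewrite [(- t) ^+ j]exprNn; ring.
have := congr1 (fun u : {poly C} => u`_k) s0; rewrite coef_poly kp coef0 -signr_odd.
have two : (2 : C) != 0 by rewrite pnatr_eq0.
move: (p`_k) => x E; apply: (mulfI two); rewrite mulr0; move: ok E.
case: hb => -> /=; case: odd => //= _ E; last by apply: etrans E; ring.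
by rewrite -[RHS]oppr0 -E; ring.
Qed.

Lemma ppairZl w (r : {poly C}) u : ppair (w *: r) u = w * ppair r u.
Proof.
rewrite (ppair_widen _ (size_scale_leq w r)) /ppair mulr_sumr.
by apply: eq_bigr => k _; rewrite coefZ mulrA.
Qed.

End SignVectors.

Theorem mainTheorem5 (R : realType) (q : R) (hq : 0 < q < 1)
    (n : nat) (hn : (0 < n)%N)
    (beta : 'I_n -> int) (hbeta : forall i, beta i = 1 \/ beta i = -1)
    (sigma : 'S_n) (gamma tgamma : 'I_n -> R)
    (hgamma : forall k : 'I_n, gamma (sigma k) =
       q ^+ (sgn_upper beta (sigma k) + k +
             #|[pred j : 'I_n | (j < k)%N && (sigma k < sigma j)%N]|))
    (htgamma : forall k : 'I_n, tgamma k = gamma k * q ^+ sgn_upper beta k) :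
  [/\ (forall delta : 'I_n -> R, (forall j, delta j != 0) ->
         kappa_def q beta sigma tgamma delta),
      (forall (p : 'I_n -> {poly R[i]}) (delta : 'I_n -> R),
         (forall (j : 'I_n) (t : R[i]), (p j).[- t] = (beta j)%:~R * (p j).[t]) ->
         (forall j, delta j != 0) ->
         let f := Aelt q p in
         [/\ Ftrans_def sigma gamma f,
             Gtrans_def (Ftrans sigma gamma f) &
             Gtrans delta (Ftrans sigma gamma f) =
               kappa q beta sigma tgamma delta *: f]) &
      (forall (r : 'I_n -> {poly R[i]}) (delta : 'I_n -> R),
         (forall (j : 'I_n) (t : R[i]), (r j).[- t] = (beta j)%:~R * (r j).[t]) ->
         (forall j, delta j != 0) ->
         let g := Delt q r in
         [/\ Gtrans_def g,
             Ftrans_def sigma gamma (Gtrans delta g) &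
             Ftrans sigma gamma (Gtrans delta g) =
               kappa q beta sigma tgamma delta *: g])].
Proof.
have [q0 q1] := andP hq; have qn0 : q != 0 by rewrite gt_eqF.
pose b (j : 'I_n) := beta j != 1.
have bE j : sgn_exp beta j = b j by rewrite /sgn_exp /b; case: eqP.
have oU (j : 'I_n) : odd (\sum_(i < n | (j < i)%N) b i) = odd (sgn_upper beta j).
  by congr odd; apply: eq_bigr => i _; rewrite bE.
have oL (j : 'I_n) : odd (\sum_(i < n | (i < j)%N) b i) = odd (sgn_lower beta j).
  by congr odd; apply: eq_bigr => i _; rewrite bE.
pose c (delta : 'I_n -> R) := kappa_lattice q beta delta.
have c0 delta j : (forall j, delta j != 0) -> c delta j != 0.
  by move=> d0; rewrite mulf_neq0 ?expf_neq0.
(* tgamma is gamma with B^j doubled, hence an admissible lattice for the exponent e = 0. *)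
have tgE (k : 'I_n) : tgamma (sigma k) = q ^+ ((sgn_upper beta (sigma k)).*2 + k +
    #|[pred j : 'I_n | (j < k)%N && (sigma k < sigma j)%N]|).
  by rewrite htgamma hgamma -exprD; congr (q ^+ _); lia.
have prod_cst (x : R[i]) : x ^+ n = \prod_(j < n) x by rewrite prodr_const card_ord.
have gaussE k0 : jackson q k0 (Defs.gauss_fun q) = muG q k0 0.
  congr jackson; apply/funext => t; rewrite expr0 mul1r; exact: gauss_funE.
(* The Gaussian of the constant is the case p = 1, e = 0 of [lat_Aprod]. *)
have [EI EV] : lat_integrable sigma tgamma (Egauss_sum q n) /\
    lat_integral sigma tgamma (Egauss_sum q n) = lat_const q sigma * muE q 0 ^+ n.
  pose e0 : expv n := 0.
  have e0E (j : 'I_n) : e0 j = 0%N by rewrite ffunE.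
  have h1 (j : 'I_n) : poly_parity (odd (e0 j)) (1 : {poly R[i]}).
    by move=> k; rewrite e0E coef1; case: k.
  have h2 (j : 'I_n) : odd (\sum_(i < n | (j < i)%N) e0 i) = odd (sgn_upper beta j).*2.
    by rewrite odd_double big1 // => i _; exact: e0E.
  have := lat_Aprod hq tgE h1 h2.
  have -> : (Aprod q (fun j : 'I_n => mulc 1 (@Ecoef R q)) * qmon q _ e0 : qA q n) = Egauss_sum q n.
    rewrite Egauss_sumE // -[qmon q _ e0]/(1 : qA q n) mulr1; congr (Aprod q _); apply/funext => j.
    by apply/funext => k; rewrite mulcC mul1r.
  move=> [h3 h4]; split=> //; rewrite h4 big1 ?expr0 => [|i _]; last by rewrite e0E muln0.
  rewrite mulr1 prod_cst; congr (_ * _).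
  by apply: eq_bigr => j _; rewrite momcC mul1r e0E.
have kE delta : kappa q beta sigma tgamma delta =
    lat_const q sigma * muE q 0 ^+ n * \prod_(j < n) muG q (c delta j) 0.
  by rewrite /kappa EV; congr (_ * _); apply: eq_bigr => j _; rewrite gaussE.
split.
- move=> delta d0; split=> // j.
  have -> : Defs.gauss_fun q = fun t => t%:C ^+ 0 * gauss1 q t%:C.
    apply/funext => t; rewrite expr0 mul1r; exact: gauss_funE.
  exact: jackson_integrable_gauss1 (c0 _ _ d0).
- move=> p delta hp d0 f.
  have pp j : poly_parity (b j) (p j) by exact: poly_parity_sign.
  have [s hs] : {s : 'I_n -> {poly R[i]} | forall j, poly_parity (b j) (s j) /\ gauss_rel q (p j) (s j)}.
    have h j : {s : {poly R[i]} | poly_parity (b j) s /\ gauss_rel q (p j) s}.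
      by apply: cid; have [s] := gauss_relA hq (pp j); exists s.
    by exists (fun j => sval (h j)) => j; exact: (svalP (h j)).
  have fE : f = Aprod q (fun j => mulc (p j) (@Ecoef R q)) by exact: AeltE.
  have [Fd Fv] := Ftrans_Aprod hq hgamma hn pp oU.
  (* E and p_j are exchanged for e and the partner s_j; the scalar collects the order constant and
     the n zeroth moments of E. *)
  have FE : Ftrans sigma gamma f = (lat_const q sigma * muE q 0 ^+ n) *:
      Dprod q (fun j => mulc (s j) (@gcoef R q)).
    rewrite fE Fv; apply/funext => e; rewrite qscaleE -mulrA; congr (_ * _).
    rewrite prod_cst -big_split; apply: eq_bigr => j _.
    exact: (hs j).2.1 _ (muEP hq) _.
  have [Gd Gv] := Gtrans_Dprod hq (lat_const q sigma * muE q 0 ^+ n) (fun j => (hs j).1) oL d0.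
  split; [by rewrite fE|by rewrite FE|].
  rewrite FE Gv kE fE; apply/funext => e; rewrite qscaleE -[RHS]mulrA; congr (_ * _).
  rewrite [RHS]mulrCA; congr (_ * _); rewrite -big_split; apply: eq_bigr => j _.
  exact: (hs j).2.2 _ (muGP hq (c0 delta j d0)) _.
move=> r delta hr d0 g.
have pr j : poly_parity (b j) (r j) by exact: poly_parity_sign.
have [p hp] : {p : 'I_n -> {poly R[i]} | forall j, poly_parity (b j) (p j) /\ gauss_rel q (p j) (r j)}.
  have h j : {p : {poly R[i]} | poly_parity (b j) p /\ gauss_rel q p (r j)}.
    by apply: cid; have [p] := gauss_relD' hq (pr j); exists p.
  by exists (fun j => sval (h j)) => j; exact: (svalP (h j)).
have gE : g = 1 *: Dprod q (fun j => mulc (r j) (@gcoef R q)) by rewrite scale1r; exact: DeltE.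
have [Gd Gv] := Gtrans_Dprod hq 1 pr oL d0.
(* The zeroth moments of e are put into the polynomials, because F'' was computed for products
   without a scalar in front. *)
pose p' j := muG q (c delta j) 0 *: p j.
have GE : Gtrans delta g = Aprod q (fun j => mulc (p' j) (@Ecoef R q)).
  rewrite gE Gv; apply/funext => e; rewrite mul1r /Aprod; congr (_ * _); apply: eq_bigr => j _.
  rewrite /mulc ppairZl; exact: (hp j).2.2 _ (muGP hq (c0 delta j d0)) _.
have pp j : poly_parity (b j) (p' j).
  by move=> k ok; rewrite coefZ (hp j).1 ?mulr0.
have [Fd Fv] := Ftrans_Aprod hq hgamma hn pp oU.
split; [by rewrite gE|by rewrite GE|].
rewrite GE Fv kE gE scale1r; apply/funext => e; rewrite qscaleE -!mulrA; congr (_ * _).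
rewrite prod_cst -!big_split; apply: eq_bigr => j _ /=.
have h := (hp j).2.1 _ (muEP hq) (e j).
have -> : momc (p' j) (muE q) (e j) = muG q (c delta j) 0 * momc (p j) (muE q) (e j).
  exact: ppairZl.
exact: etrans (mulrCA _ _ _) (etrans (congr1 (fun x => _ * x) h) (mulrCA _ _ _)).
Qed.
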